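(* Let $n,l>1$ be integers and $s\in\mathbb{Z}$. Let $L^{+}(s)$ (resp. $L^{-}(s)$) be the $\mathbb{Q}[q]$-span (resp. $\mathbb{Q}[q^{-1}]$-span) of $\{\varphi(\lambda,s)\mid\lambda\in\Pi\}$ in $\bigwedge^{s+\frac\infty2}V_{n,l}$. There are unique bases $\{G^+(\lambda,s)\mid\lambda\in\Pi\}$ and $\{G^-(\lambda,s)\mid\lambda\in\Pi\}$ of $\bigwedge^{s+\frac\infty2}V_{n,l}$ such that, for all $\lambda\in\Pi$: (i) $\overline{G^{\pm}(\lambda,s)}=G^{\pm}(\lambda,s)$; (ii) $G^{\pm}(\lambda,s)\equiv\varphi(\lambda,s)\bmod q^{\pm1}L^{\pm}(s)$.
   Context: **The $q$-wedge space.** Fix integers $n>1$, $l>1$. $V_{n,l}$ is the $\mathbb{Q}(q)$-vector space with basis $u_k$ ($k\in\mathbb{Z}$), where each $k$ is written uniquely as $k=a+n(b-1)-nlm$ with $a\in\{1,\dots,n\}$, $b\in\{1,\dots,l\}$, $m\in\mathbb{Z}$. We always write $k_i=a_i+n(b_i-1)-nlm_i$ in this way. For a statement $P$, $\delta(P)=1$ if $P$ is true and $0$ otherwise. $\bigwedge^2V_{n,l}$ is the $\mathbb{Q}(q)$-space generated by the monomials $u_{k_1}\wedge u_{k_2}$ modulo the following relations, one for each pair $k_1\le k_2$. Let $\alpha,\beta\in\{0,\dots,nl-1\}$ be the residues of $a_2-a_1$ and $n(b_2-b_1)$ modulo $nl$. (Ri) If $\alpha=\beta=0$: $u_{k_1}\wedge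 u_{k_2}=-u_{k_2}\wedge u_{k_1}$. (Rii) If $\alpha>0,\beta=0$: $u_{k_1}\wedge u_{k_2}=-q^{-1}u_{k_2}\wedge u_{k_1}+(q^{-2}-1)\{\sum_{m\ge0}q^{-2m}u_{k_2-\alpha-nlm}\wedge u_{k_1+\alpha+nlm}-\sum_{m\ge1}q^{-2m+1}u_{k_2-nlm}\wedge u_{k_1+nlm}\}$. (Riii) If $\alpha=0,\beta>0$: $u_{k_1}\wedge u_{k_2}=-q\,u_{k_2}\wedge u_{k_1}+(q^{2}-1)\{\sum_{m\ge0}q^{2m}u_{k_2-\beta-nlm}\wedge u_{k_1+\beta+nlm}-\sum_{m\ge1}q^{2m-1}u_{k_2-nlm}\wedge u_{k_1+nlm}\}$. (Riv) If $\alpha,\beta>0$: $u_{k_1}\wedge u_{k_2}=-u_{k_2}\wedge u_{k_1}+(q-q^{-1})\sum_{m\ge0}\frac{q^{2m+1}+q^{-2m-1}}{q+q^{-1}}u_{k_2-\beta-nlm}\wedge u_{k_1+\beta+nlm}-(q-q^{-1})\sum_{m\ge0}\frac{q^{2m+1}+q^{-2m-1}}{q+q^{-1}}u_{k_2-\alpha-nlm}\wedge u_{k_1+\alpha+nlm}+(q-q^{-1})\sum_{m\ge1}\frac{q^{2m}-q^{-2m}}{q+q^{-1}}u_{k_2+nl-\alpha-\beta-nlm}\wedge u_{k_1-nl+\alpha+\beta+nlm}-(q-q^{-1})\sum_{m\ge1}\frac{q^{2m}-q^{-2m}}{q+q^{-1}}u_{k_2-nlm}\wedge u_{k_1+nlm}$.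 All sums continue only as long as the monomials $u_c\wedge u_d$ in them are ordered, i.e. $c>d$. $\bigwedge^rV_{n,l}$ is generated by $u_{k_1}\wedge\cdots\wedge u_{k_r}$ modulo these relations in each adjacent pair of factors; the ordered monomials ($k_1>\cdots>k_r$) form a basis. For $s\in\mathbb{Z}$, $\bigwedge^{s+\frac\infty2}V_{n,l}$ is the inductive limit of the $\bigwedge^rV_{n,l}$ along $v\mapsto v\wedge u_{s-r}$; it is spanned by semi-infinite monomials $u_{k_1}\wedge u_{k_2}\wedge\cdots$ with $k_i=s-i+1$ for $i\gg1$, and the ordered ones ($k_1>k_2>\cdots$) form a basis. **The basis $\varphi$.** $\Pi$ is the set of partitions. For $\lambda\in\Pi$, $|\lambda,s\rangle=u_{k_1}\wedge u_{k_2}\wedge\cdots$ with $k_i=\lambda_i+s-i+1$. For each $b\in\{1,\dots,l\}$ arrange $\{a_i-nm_i\mid b_i=b\}$ as $k^{(b)}_1>k^{(b)}_2>\cdots$; let $s_b$ be the unique integer with $k^{(b)}_i=s_b-i+1$ for $i\gg1$, and $\lambda^{(b)}_i=k^{(b)}_i-s_b+i-1$. This gives a bijection $\iota_l:\Pi\times\mathbb{Z}\to\Pi^l\times\mathbb{Z}^l$, $(\lambda,s)\mapsto(\boldsymbol{\lambda}_l,\boldsymbol{s}_l)$, with $\boldsymbol{\lambda}_l=(\lambda^{(1)},\dots,\lambda^{(l)})$, $\boldsymbol{s}_l=(s_1,\dots,s_l)$, $\sum_bs_b=s$; write $|\boldsymbol{\lambda}_l,\boldsymbol{s}_l\rangle=|\lambda,s\rangle$.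 Let $|\boldsymbol{0}_l,\boldsymbol{s}_l\rangle=u_{k_1^\circ}\wedge u_{k_2^\circ}\wedge\cdots$ (ordered, $\boldsymbol{0}_l$ the $l$-tuple of zero partitions, $k_i^\circ=a_i^\circ+n(b_i^\circ-1)-nlm_i^\circ$), and put $\Phi(\boldsymbol{\lambda}_l,\boldsymbol{s}_l)=\sum_{j\ge1}\big(\#\{i<j\mid b_i<b_j\}-\#\{i<j\mid b^\circ_i<b^\circ_j\}\big)$ (a finite sum). Then $\varphi(\lambda,s)=(-1)^{\Phi(\boldsymbol{\lambda}_l,\boldsymbol{s}_l)}|\lambda,s\rangle$. **Bar involution.** For a semi-infinite monomial $u=u_{k_1}\wedge u_{k_2}\wedge\cdots$ put $\deg(u)=\sum_{i\ge1}(k_i-(s-i+1))$ and $C_r(u)=\sum_{1\le i<j\le r}(\delta(b_i=b_j)-\delta(a_i=a_j))$. For $u$ ordered and any $r\ge\deg(u)$ put $\overline{u}=(-1)^{r(r-1)/2}q^{C_r(u)}u_{k_r}\wedge u_{k_{r-1}}\wedge\cdots\wedge u_{k_1}\wedge u_{k_{r+1}}\wedge u_{k_{r+2}}\wedge\cdots$ (independent of $r$), and extend to $\bigwedge^{s+\frac\infty2}V_{n,l}$ by $\overline{\sum_ic_i(q)u^{(i)}}=\sum_ic_i(q^{-1})\overline{u^{(i)}}$ with $u^{(i)}$ ordered. This is a semi-linear involution. *)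

(* Defs.v *)
From HB Require Import structures.
From mathcomp Require Import all_boot all_order all_algebra.
From mathcomp Require Import boolp classical_sets functions cardinality fsbigop.
From mathcomp Require Import finmap monalg.
Set Implicit Arguments.
Unset Strict Implicit.
Unset Printing Implicit Defensive.
Import Order.TTheory GRing.Theory Num.Theory.
Local Open Scope classical_set_scope.
Local Open Scope quotient_scope.
Local Open Scope ring_scope.

Definition Qq : fieldType := {fraction {poly rat}}.

Definition q : Qq := tofrac 'X.

Definition eval_at (x : Qq) (p : {poly rat}) : Qq :=
  (map_poly (fun c : rat => tofrac c%:P : Qq) p).[x].

(* c(q) |-> c(q^-1), computed on the numerator and denominator of the
   representative of c; the value does not depend on the representative. *)
Definition qinv (c : Qq) : Qq :=
  eval_at q^-1 (\n_(repr (c : {fraction {poly rat}}))) /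
  eval_at q^-1 (\d_(repr (c : {fraction {poly rat}}))).

Definition polyQ : set Qq := range (eval_at q).
Definition polyQinv : set Qq := range (eval_at q^-1).

(* The set of finite combinations of elements of P with coefficients in A. *)
Definition lspan (V : lmodType Qq) (A : set Qq) (P : set V) : set V :=
  [set v | exists2 t : seq (Qq * V),
     (forall x, x \in t -> A x.1 /\ P x.2) & v = \sum_(x <- t) x.1 *: x.2].

Definition lincomb (I : choiceType) (V : lmodType Qq) (b : I -> V)
    (c : {malg Qq[I]}) : V :=
  \sum_(i <- msupp c) c@_i *: b i.

Definition is_basis (I : choiceType) (V : lmodType Qq) (b : I -> V) : Prop :=
  (forall v, exists c, v = lincomb b c) /\
  (forall c, lincomb b c = 0 -> c = 0).

(* x = y modulo c L *)
Definition eq_mod (V : lmodType Qq) (c : Qq) (L : set V) (x y : V) : Prop :=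
  exists2 v, L v & x - y = c *: v.

Definition ares (n : nat) (k : int) : int := ((k - 1) %% n%:Z)%Z + 1.
Definition bres (n l : nat) (k : int) : int :=
  (((k - 1) %/ n%:Z)%Z %% l%:Z)%Z + 1.
Definition mres (n l : nat) (k : int) : int :=
  - (((k - 1) %/ n%:Z)%Z %/ l%:Z)%Z.

Lemma abm_eq (n l : nat) (k : int) :
  k = ares n k + n%:Z * (bres n l k - 1) - (n * l)%:Z * mres n l k.
Proof.
rewrite /ares /bres /mres addrK mulrN opprK PoszM -mulrA -addrA -mulrDr.
set d := ((k - 1) %/ n%:Z)%Z.
rewrite [_ + l%:Z * _]addrC [l%:Z * _]mulrC -(divz_eq d) addrAC.
by rewrite [_ + _ * d]addrC [n%:Z * d]mulrC -divz_eq subrK.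
Qed.

Lemma ares_itv (n : nat) (k : int) : (0 < n)%N -> 1 <= ares n k <= n%:Z.
Proof.
by move=> n0; rewrite lerDr modz_ge0 ?lezD1 ?ltz_pmod // ?eqz_nat -?lt0n.
Qed.

Lemma bres_itv (n l : nat) (k : int) : (0 < l)%N -> 1 <= bres n l k <= l%:Z.
Proof.
by move=> n0; rewrite lerDr modz_ge0 ?lezD1 ?ltz_pmod // ?eqz_nat -?lt0n.
Qed.

Section Straightening.
Variables (n l : nat) (V : lmodType Qq) (w : int -> int -> V) (k1 k2 : int).

(* The sum of f m * w (k2 - e - nlm) (k1 + e + nlm) over the m >= m0 for which
   k2 - e - nlm > k1 + e + nlm.  In the rules e >= - nl, so every such m is
   smaller than |k2 - k1| + 2. *)
Definition ordered_sum (m0 : nat) (e : int) (f : nat -> Qq) : V :=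
  \sum_(m0 <= m < `|k2 - k1|%N.+2
        | k1 + e + (n * l * m)%:Z < k2 - e - (n * l * m)%:Z)
     f m *: w (k2 - e - (n * l * m)%:Z) (k1 + e + (n * l * m)%:Z).

(* The right-hand side of the rule for k1 <= k2; w c d stands for u_c /\ u_d. *)
Definition straighten : V :=
  let alpha := ((ares n k2 - ares n k1) %% (n * l)%:Z)%Z in
  let beta := ((n%:Z * (bres n l k2 - bres n l k1)) %% (n * l)%:Z)%Z in
  if alpha == 0 then
    if beta == 0 then - w k2 k1
    else
      - q *: w k2 k1
      + (q ^+ 2 - 1) *:
          (ordered_sum 0 beta (fun m => q ^+ (2 * m))
           - ordered_sum 1 0 (fun m => q ^ (2 * m%:Z - 1)))
  else
    if beta == 0 then
      - q^-1 *: w k2 k1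
      + (q ^- 2 - 1) *:
          (ordered_sum 0 alpha (fun m => q ^- (2 * m))
           - ordered_sum 1 0 (fun m => q ^ (1 - 2 * m%:Z)))
    else
      let fodd m := (q ^+ (2 * m).+1 + q ^- (2 * m).+1) / (q + q^-1) in
      let feven m := (q ^+ (2 * m) - q ^- (2 * m)) / (q + q^-1) in
      - w k2 k1
      + (q - q^-1) *: ordered_sum 0 beta fodd
      - (q - q^-1) *: ordered_sum 0 alpha fodd
      + (q - q^-1) *: ordered_sum 1 (alpha + beta - (n * l)%:Z) feven
      - (q - q^-1) *: ordered_sum 1 0 feven.

End Straightening.

(* A sequence x of length r stands for the monomial u_{x_1} /\ ... /\ u_{x_r}
   of the r-fold wedge space, hence, in the inductive limit, for
   u_{x_1} /\ ... /\ u_{x_r} /\ u_{s-r} /\ u_{s-r-1} /\ ...  The limit is the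
   quotient of the direct sum over r of the spaces of monomials of length r by
   the straightening rules and by the identifications v = v /\ u_{s-r}. *)
Definition free_wedge : lmodType Qq := {malg Qq[seq int]}.

Definition mono (x : seq int) : free_wedge := mkmalgU x 1.

Inductive wedge_rel (n l : nat) (s : int) : set free_wedge :=
| Rel_straighten x y k1 k2 : k1 <= k2 ->
    wedge_rel n l s
      (mono (x ++ [:: k1; k2] ++ y)
       - straighten n l (fun c d => mono (x ++ [:: c; d] ++ y)) k1 k2)
| Rel_limit x :
    wedge_rel n l s (mono x - mono (rcons x (s - (size x)%:Z))).

Definition wedge_ker (n l : nat) (s : int) : {pred free_wedge} :=
  fun v => `[< lspan setT (wedge_rel n l s) v >].

Section WedgeKer.
Variables (n l : nat) (s : int).

Lemma wedge_kerZ (a : Qq) (v : free_wedge) :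
  v \in wedge_ker n l s -> a *: v \in wedge_ker n l s.
Proof.
move=> /asboolP[t tP ->]; apply/asboolP.
exists [seq (a * x.1, x.2) | x <- t].
  by move=> x /mapP[y /tP[_ Py] ->]; split.
by rewrite big_map scaler_sumr; apply: eq_bigr => x _; rewrite scalerA.
Qed.

Lemma wedge_ker_zmod : zmod_closed (wedge_ker n l s).
Proof.
split; first by apply/asboolP; exists [::] => //; rewrite big_nil.
move=> u v /asboolP[t tP ->] /(wedge_kerZ (-1)); rewrite scaleN1r.
move=> /asboolP[t' t'P ->]; apply/asboolP; exists (t ++ t').
  by move=> x; rewrite mem_cat => /orP[/tP|/t'P].
by rewrite big_cat.
Qed.

HB.instance Definition _ :=
  GRing.isZmodClosed.Build free_wedge (wedge_ker n l s) wedge_ker_zmod.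

Definition wedge : Type := Quotient.quot (wedge_ker n l s).

HB.instance Definition _ := GRing.Zmodule.on wedge.

Definition wedge_pi (v : free_wedge) : wedge :=
  \pi_(Quotient.quot (wedge_ker n l s)) v.

Definition wedge_scale (a : Qq) (v : wedge) : wedge :=
  wedge_pi (a *: repr (v : Quotient.quot (wedge_ker n l s))).

Lemma wedge_piE (u v : free_wedge) :
  (wedge_pi u = wedge_pi v) <-> u - v \in wedge_ker n l s.
Proof. by rewrite Quotient.idealrBE; split=> [h|/eqP//]; apply/eqP. Qed.

Lemma wedge_piD (u v : free_wedge) :
  wedge_pi (u + v) = wedge_pi u + wedge_pi v.
Proof. exact: Quotient.pi_add. Qed.

Lemma wedge_pi_surj (v : wedge) : exists u, v = wedge_pi u.
Proof.
by exists (repr (v : Quotient.quot (wedge_ker n l s))); rewrite /wedge_pi reprK.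
Qed.

Lemma wedge_piZ (a : Qq) (v : free_wedge) :
  wedge_pi (a *: v) = wedge_scale a (wedge_pi v).
Proof.
apply/wedge_piE; rewrite -scalerBr; apply: wedge_kerZ.
by apply/wedge_piE; rewrite /wedge_pi reprK.
Qed.

Fact wedge_scaleA (a b : Qq) (v : wedge) :
  wedge_scale a (wedge_scale b v) = wedge_scale (a * b) v.
Proof.
by have [u ->] := wedge_pi_surj v; rewrite -!wedge_piZ scalerA.
Qed.

Fact wedge_scale1 : left_id 1 wedge_scale.
Proof.
by move=> v; have [u ->] := wedge_pi_surj v; rewrite -wedge_piZ scale1r.
Qed.

Fact wedge_scaleDr : right_distributive wedge_scale +%R.
Proof.
move=> a v v'; have [u ->] := wedge_pi_surj v; have [u' ->] := wedge_pi_surj v'.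
by rewrite -wedge_piD -!wedge_piZ scalerDr wedge_piD.
Qed.

Fact wedge_scaleDl (v : wedge) : {morph wedge_scale^~ v : a b / a + b}.
Proof.
move=> a b; have [u ->] := wedge_pi_surj v.
by rewrite -!wedge_piZ scalerDl wedge_piD.
Qed.

HB.instance Definition _ := GRing.Zmodule_isLmodule.Build Qq wedge
  wedge_scaleA wedge_scale1 wedge_scaleDr wedge_scaleDl.

(* u_{x_1} /\ ... /\ u_{x_r} /\ u_{s-r} /\ u_{s-r-1} /\ ..., r = size x *)
Definition umono (x : seq int) : wedge := wedge_pi (mono x).

End WedgeKer.

Record intpart : Type := IntPart {
  parts :> seq nat;
  _ : sorted geq parts && (0%N \notin parts)
}.
HB.instance Definition _ := [isSub for parts].
HB.instance Definition _ := [Choice of intpart by <:].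

(* Sequences k_1, k_2, ... are indexed from 0 below: kseq lam s i is k_{i+1}. *)
Definition kseq (lam : intpart) (s : int) (i : nat) : int :=
  (nth 0%N lam i)%:Z + s - i%:Z.

Definition ket (n l : nat) (s : int) (lam : intpart) : wedge n l s :=
  umono n l s (mkseq (kseq lam s) (size lam)).

Section Iota.
Variables (n l : nat).

(* k^(b): the elements a_i - n m_i with b_i = b, in decreasing order *)
Definition arrangement (lam : intpart) (s b : int) : nat -> int :=
  xget (fun=> 0) [set f : nat -> int |
    {homo f : i j / (i < j)%N >-> j < i} /\
    range f = [set ares n (kseq lam s i) - n%:Z * mres n l (kseq lam s i)
              | i in [set i | bres n l (kseq lam s i) = b]]].

Definition multicharge (lam : intpart) (s b : int) : int :=
  xget 0 [set c : int | exists N : nat, forall i, (N <= i)%N ->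
    arrangement lam s b i = c - i%:Z].

Definition multipart (lam : intpart) (s b : int) (i : nat) : int :=
  arrangement lam s b i - multicharge lam s b + i%:Z.

(* The pair (mu, t) with iota_l(mu, t) = (0_l, s_l), where s_l is the
   multicharge of (lam, s): |mu, t> is the monomial |0_l, s_l>. *)
Definition vacuum (lam : intpart) (s : int) : intpart * int :=
  xget (lam, s) [set mt : intpart * int | forall b : int, 1 <= b <= l%:Z ->
    (forall i, multipart mt.1 mt.2 b i = 0) /\
    multicharge mt.1 mt.2 b = multicharge lam s b].

Definition ascents (k : nat -> int) (j : nat) : int :=
  (\sum_(i < j) (bres n l (k i) < bres n l (k j))%R)%N%:Z.

Definition Phi (lam : intpart) (s : int) : int :=
  let mt := vacuum lam s in
  \sum_(j \in [set: nat]) (ascents (kseq lam s) j - ascents (kseq mt.1 mt.2) j).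

End Iota.

Definition phi (n l : nat) (s : int) (lam : intpart) : wedge n l s :=
  (-1 : Qq) ^ Phi n l lam s *: ket n l s lam.

Definition Cexp (n l : nat) (k : nat -> int) (r : nat) : int :=
  \sum_(j < r) \sum_(i < j)
    ((bres n l (k i) == bres n l (k j))%:Z - (ares n (k i) == ares n (k j))%:Z).

(* The bar of |lam, s>, computed with the integer r >= deg |lam, s> = |lam|.
   As r is at least the number of parts of lam, the factors u_{k_i}, i > r,
   are those implicit in umono. *)
Definition bar_ket (n l : nat) (s : int) (lam : intpart) (r : nat) :
    wedge n l s :=
  ((-1) ^+ (r * (r - 1))./2 * q ^ Cexp n l (kseq lam s) r)
    *: umono n l s (rev (mkseq (kseq lam s) r)).

Definition coord (n l : nat) (s : int) (v : wedge n l s) : {malg Qq[intpart]} :=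
  xget 0 [set c | v = lincomb (ket n l s) c].

(* The result of bar_ket is the same for all r >= |lam|; r = |lam| is used. *)
Definition bar (n l : nat) (s : int) (v : wedge n l s) : wedge n l s :=
  let c := coord v in
  \sum_(lam <- msupp c) qinv c@_lam *: bar_ket n l s lam (sumn lam).

Definition Lplus (n l : nat) (s : int) : set (wedge n l s) :=
  lspan polyQ (range (phi n l s)).

Definition Lminus (n l : nat) (s : int) : set (wedge n l s) :=
  lspan polyQinv (range (phi n l s)).

Arguments Lplus : clear implicits.
Arguments Lminus : clear implicits.

(* Main.v *)
(* The theorem follows by the Kazhdan-Lusztig argument once three things are
   known: the ordered monomials |lambda, s> are a basis, the bar map is a
   semilinear involution, and it is unitriangular over Q[q, q^-1] for a
   suitable height.

   The key to all three is that the straightening rules are generated by the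
   rules with k_1 <= k_2 < k_1 + nl, together with the shift
   u_c /\ u_d |-> u_{c - nl} /\ u_d + u_c /\ u_{d - nl}: the error in the rule for
   the pair at distance p satisfies a two-step recurrence in p, the step being
   the error of the shifted rule.

   Independence.  Write u_k as a pair of letters a and (b, m).  A functional on
   words on which the Hecke operators X_i on the letters a and Y_i on the
   letters (b, m) agree kills the rules, and a product of sums of X_i Y_i makes
   such functionals.  Modulo q - 1 they are antisymmetrizations of
   the coordinate functions, so they separate the ordered monomials.

   Bar map.  The rules are stable under reversing the monomials and q |-> q^-1,
   so reversal of the first R factors is well defined; it does not depend on R
   because words of length R + 1 whose letters exceed s - R vanish when their
   degree is at most R.  It is triangular because all the monomials that a
   rule produces besides the leading one have smaller sum of squares. *)

Require Import Defs.
From HB Require Import structures.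
From mathcomp Require Import all_boot all_order all_algebra.
From mathcomp Require Import boolp classical_sets functions.
From mathcomp Require Import finmap monalg.
From mathcomp Require Import ring zify.
Set Implicit Arguments.
Unset Strict Implicit.
Unset Printing Implicit Defensive.
Import Order.TTheory GRing.Theory Num.Theory.
Local Open Scope ring_scope.

(** The obstacle is that the rules at large distance are long sums, too unwieldy to verify one by
    one. The rule of h at distance p + 2 follows from the rule of h at distance p and the rule of
    the shifted function at p + 1, so the induction runs over classes of functions closed under the
    shift, not over one function. On exponents the shift is the symmetric sum z_1 + z_2. This is why
    reversal respects it, and why it preserves the functions on which X_i and Y_i agree: the
    corrections for z_1 and z_2 in the affine Hecke algebra cancel in the sum. X_i and Y_i satisfy
    the same relation T^2 = kap T + 1, so (X - Y)(1 + XY) = 0; the product of sums is the sum of X_w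
    Y_w over the permutations w of the first r + 1 letters, built along coset representatives.
    Functionals are evaluated on infinite padded words, which makes the limit identifications
    automatic; r is chosen after the relation is given. No coefficient of an antisymmetrizer is
    computed: over the local ring at q = 1 a relation is normalised to contain the coefficient 1,
    and its reduction is contradictory. *)

(* The square-zero extension R + V: identities in the R-module V become
   identities in a commutative ring, to which [ring] applies. *)
Section SquareZero.
Variables (R : comNzRingType) (V : lmodType R).

Definition sqzero : Type := (R * V)%type.

HB.instance Definition _ := GRing.Zmodule.copy sqzero (R * V)%type.

Definition sqz_one : sqzero := (1, 0).
Definition sqz_mul (x y : sqzero) : sqzero := (x.1 * y.1, x.1 *: y.2 + y.1 *: x.2).

Fact sqz_mulA : associative sqz_mul.
Proof.
move=> x y z; rewrite /sqz_mul /= mulrA; congr pair.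
by rewrite !scalerDr !scalerA -addrA [z.1 * x.1]mulrC [z.1 * y.1]mulrC.
Qed.

Fact sqz_mulC : commutative sqz_mul.
Proof. by move=> x y; rewrite /sqz_mul mulrC addrC. Qed.

Fact sqz_mul1 : left_id sqz_one sqz_mul.
Proof. by case=> a v; rewrite /sqz_mul /= mul1r scale1r scaler0 addr0. Qed.

Fact sqz_mulD : left_distributive sqz_mul +%R.
Proof.
move=> x y z; rewrite /sqz_mul /=; congr pair; first by rewrite mulrDl.
by rewrite scalerDl scalerDr addrACA.
Qed.

Fact sqz_one_neq0 : sqz_one != 0.
Proof. by apply/eqP => -[/eqP]; rewrite oner_eq0. Qed.

HB.instance Definition _ := GRing.Zmodule_isComNzRing.Build sqzero
  sqz_mulA sqz_mulC sqz_mul1 sqz_mulD sqz_one_neq0.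

Definition sqz_scal (a : R) : sqzero := (a, 0).
Definition sqz_vec (v : V) : sqzero := (0, v).

Fact sqz_scal_zmod : zmod_morphism sqz_scal.
Proof. by move=> a b; congr pair; rewrite subrr. Qed.

HB.instance Definition _ := GRing.isZmodMorphism.Build R sqzero sqz_scal sqz_scal_zmod.

Fact sqz_scal_monoid : monoid_morphism sqz_scal.
Proof. by split=> // a b; congr pair; rewrite /= !scaler0 addr0. Qed.

HB.instance Definition _ :=
  GRing.isMonoidMorphism.Build R sqzero sqz_scal sqz_scal_monoid.

Fact sqz_vec_zmod : zmod_morphism sqz_vec.
Proof. by move=> a b; congr pair; rewrite subrr. Qed.

HB.instance Definition _ := GRing.isZmodMorphism.Build V sqzero sqz_vec sqz_vec_zmod.

Lemma sqz_vecZ a v : sqz_vec (a *: v) = sqz_scal a * sqz_vec v.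
Proof. by congr pair; rewrite /= ?mulr0 // scale0r addr0. Qed.

Lemma sqz_vec_inj : injective sqz_vec.
Proof. by move=> u v []. Qed.

Lemma sqz_vecD u v : sqz_vec (u + v) = sqz_vec u + sqz_vec v.
Proof. exact: raddfD. Qed.

Lemma sqz_vecN v : sqz_vec (- v) = - sqz_vec v.
Proof. exact: raddfN. Qed.

Lemma sqz_vec0 : sqz_vec 0 = 0.
Proof. by []. Qed.

Lemma sqz_vecMn v n : sqz_vec (v *+ n) = sqz_vec v *+ n.
Proof. exact: raddfMn. Qed.

Definition sqz_vecE := (sqz_vecD, sqz_vecN, sqz_vec0, sqz_vecMn, sqz_vecZ).

End SquareZero.

Ltac lmod := apply: sqz_vec_inj; rewrite !sqz_vecE; ring.

(** * The substitution of [q^-1] for [q] *)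

Definition rat_emb : rat -> Qq := @tofrac {poly rat} \o polyC.

HB.instance Definition _ := GRing.RMorphism.copy rat_emb rat_emb.

Lemma eval_atE x p : eval_at x p = (map_poly rat_emb p).[x].
Proof. by []. Qed.

Lemma eval_at_is_zmod_morphism x : zmod_morphism (eval_at x).
Proof. by move=> p r; rewrite !eval_atE rmorphB hornerD hornerN. Qed.

HB.instance Definition _ x :=
  GRing.isZmodMorphism.Build _ _ (eval_at x) (eval_at_is_zmod_morphism x).

Lemma eval_at_is_monoid_morphism x : monoid_morphism (eval_at x).
Proof.
by split=> [|p r]; rewrite !eval_atE ?rmorph1 ?hornerC // rmorphM hornerM.
Qed.

HB.instance Definition _ x :=
  GRing.isMonoidMorphism.Build _ _ (eval_at x) (eval_at_is_monoid_morphism x).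

Lemma eval_atX x : eval_at x 'X = x.
Proof. by rewrite eval_atE map_polyX hornerX. Qed.

Lemma eval_atC x c : eval_at x c%:P = rat_emb c.
Proof. by rewrite eval_atE map_polyC hornerC. Qed.

Lemma eval_at_q p : eval_at q p = tofrac p.
Proof.
elim/poly_ind: p => [|p c IH]; first by rewrite !rmorph0.
by rewrite !rmorphD !rmorphM /= IH eval_atX eval_atC.
Qed.

Lemma eval_at_sum x (p : {poly rat}) : eval_at x p = \sum_(i < size p) rat_emb p`_i * x ^+ i.
Proof.
rewrite -{1}[p]coefK poly_def rmorph_sum; apply: eq_bigr => i _.
by rewrite -mul_polyC rmorphM rmorphXn /= eval_atC eval_atX.
Qed.

Lemma q_neq0 : q != 0.
Proof. by rewrite tofrac_eq0 polyX_eq0. Qed.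

(** Multiplying p(q^-1) by q^N gives a reciprocal polynomial of p, so questions about [eval_at q^-1]
    become questions about polynomials in q. *)
Lemma eval_at_qinv_rev (p : {poly rat}) (N : nat) : (size p <= N.+1)%N ->
  q ^+ N * eval_at q^-1 p = tofrac (\poly_(i < N.+1) p`_(N - i)).
Proof.
move=> sp; rewrite -eval_at_q eval_atE.
rewrite (horner_coef_wide (n := N.+1)); last by rewrite size_map_poly.
rewrite mulr_sumr poly_def rmorph_sum (reindex_inj rev_ord_inj) /=.
apply: eq_bigr => i _; rewrite subSS coef_map /= -mul_polyC rmorphM rmorphXn /=.
rewrite eval_atX eval_atC mulrCA; congr (_ * _).
have iN : (i <= N)%N by rewrite -ltnS.
by rewrite -{1}(subnK iN) exprD exprVn mulrAC mulfV ?mul1r // expf_neq0 ?q_neq0.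
Qed.

Lemma eval_at_qinv_eq0 p : (eval_at q^-1 p == 0) = (p == 0).
Proof.
apply/eqP/eqP => [h|->]; last by rewrite rmorph0.
have := @eval_at_qinv_rev p (size p) (leqnSn _).
rewrite h mulr0 => /esym/eqP; rewrite tofrac_eq0 => /eqP/polyP hc.
apply/polyP => i; rewrite coef0; case: (ltnP i (size p)) => hi; last first.
  by rewrite nth_default.
have := hc (size p - i)%N; rewrite coef_poly coef0 ltnS leq_subr.
by rewrite subKn // ltnW.
Qed.

Lemma fractionE (c : Qq) :
  c = tofrac (\n_(repr (c : {fraction {poly rat}})))
      / tofrac (\d_(repr (c : {fraction {poly rat}}))).
Proof.
apply: canRL (mulfK _) _; first by rewrite tofrac_eq0 denom_ratioP.
set r := repr _; rewrite -[c](reprK (c : {fraction {poly rat}})) -/r.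
unlock FracField.tofrac; rewrite -[LHS]FracField.pi_mul; apply/eqmodP.
rewrite /= FracField.equivfE /FracField.mulf.
rewrite !numden_Ratio ?oner_neq0 ?mulf_neq0 ?denom_ratioP ?oner_neq0 //.
by rewrite !mulr1 mulrC.
Qed.

Lemma eval_at_q_eq0 p : (eval_at q p == 0) = (p == 0).
Proof. by rewrite eval_at_q tofrac_eq0. Qed.

Lemma eval_at_q_inj : injective (eval_at q).
Proof.
by move=> p r /eqP; rewrite -subr_eq0 -rmorphB eval_at_q_eq0 subr_eq0 => /eqP.
Qed.

Lemma num_denE (c : Qq) :
  c = eval_at q (\n_(repr (c : {fraction {poly rat}})))
      / eval_at q (\d_(repr (c : {fraction {poly rat}}))).
Proof. by rewrite !eval_at_q; exact: fractionE. Qed.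

(** By cross multiplication an equality of fractions in q is an equality of polynomials, which may
    be evaluated at q^-1 instead. This makes [qinv] independent of the representative. *)
Lemma eval_at_frac_eq (a b x y : {poly rat}) : b != 0 -> y != 0 ->
  eval_at q a / eval_at q b = eval_at q x / eval_at q y ->
  eval_at q^-1 x / eval_at q^-1 y = eval_at q^-1 a / eval_at q^-1 b.
Proof.
move=> b0 y0 /eqP; rewrite eqr_div ?eval_at_q_eq0 //.
rewrite -!(rmorphM (eval_at _)) => /eqP/eval_at_q_inj h.
by apply/eqP; rewrite eqr_div ?eval_at_qinv_eq0 // -!(rmorphM (eval_at _)) /= h.
Qed.

Lemma qinv_frac (a b : {poly rat}) : b != 0 ->
  qinv (eval_at q a / eval_at q b) = eval_at q^-1 a / eval_at q^-1 b.
Proof.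
by move=> b0; apply: eval_at_frac_eq => //; [exact: denom_ratioP|exact: num_denE].
Qed.

Lemma fractionP (c : Qq) : exists a b : {poly rat},
  b != 0 /\ c = eval_at q a / eval_at q b.
Proof.
exists (\n_(repr (c : {fraction {poly rat}}))).
exists (\d_(repr (c : {fraction {poly rat}}))).
by split; [exact: denom_ratioP|exact: num_denE].
Qed.

Lemma qinv_eval_at_q p : qinv (eval_at q p) = eval_at q^-1 p.
Proof.
by have := qinv_frac p (oner_neq0 _); rewrite !rmorph1 !divr1.
Qed.

Lemma qinv_is_zmod_morphism : zmod_morphism qinv.
Proof.
move=> c d; have [a [b [b0 ->]]] := fractionP c.
have [a' [b' [b'0 ->]]] := fractionP d.
rewrite -[in LHS]mulNr -(rmorphN (eval_at q)) addf_div ?eval_at_q_eq0 // -!(rmorphM (eval_at q)) -(rmorphD (eval_at q)).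
rewrite !qinv_frac ?mulf_neq0 // rmorphD !rmorphM rmorphN /=.
by rewrite -addf_div ?eval_at_qinv_eq0 // mulNr.
Qed.

HB.instance Definition _ :=
  GRing.isZmodMorphism.Build Qq Qq qinv qinv_is_zmod_morphism.

Lemma qinv_is_monoid_morphism : monoid_morphism qinv.
Proof.
split=> [|c d].
  by rewrite -(rmorph1 (eval_at q)) qinv_eval_at_q !rmorph1.
have [a [b [b0 ->]]] := fractionP c; have [a' [b' [b'0 ->]]] := fractionP d.
rewrite mulf_div -!(rmorphM (eval_at q)) !qinv_frac ?mulf_neq0 // !rmorphM /=.
by rewrite mulf_div.
Qed.

HB.instance Definition _ :=
  GRing.isMonoidMorphism.Build Qq Qq qinv qinv_is_monoid_morphism.

Lemma qinv_q : qinv q = q^-1.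
Proof. by rewrite -[in LHS](eval_atX q) qinv_eval_at_q eval_atX. Qed.

Lemma qinv_qV : qinv q^-1 = q.
Proof. by rewrite fmorphV /= qinv_q invrK. Qed.

Lemma qinv_eval_at_qinv p : qinv (eval_at q^-1 p) = eval_at q p.
Proof.
rewrite !eval_at_sum rmorph_sum; apply: eq_bigr => i _ /=.
rewrite rmorphM rmorphXn /= qinv_qV; congr (_ * _).
by rewrite -(eval_atC q) qinv_eval_at_q !eval_atC.
Qed.

Lemma qinvK : involutive qinv.
Proof.
move=> c; have [a [b [b0 ->]]] := fractionP c.
by rewrite qinv_frac // rmorphM fmorphV /= !qinv_eval_at_qinv.
Qed.

Lemma qinv_exprz (z : int) : qinv (q ^ z) = q ^ (- z).
Proof. by rewrite rmorphXz /= ?unitfE ?q_neq0 // qinv_q exprz_inv. Qed.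

(** The ring Q[q, q^-1], which contains the coefficients of the rules and of the bar map, and in
    which anti-invariant scalars split into a positive and a negative part. *)
Definition laurent : set Qq :=
  [set c | exists (N : nat) (p : {poly rat}), c = q ^- N * eval_at q p].

Lemma laurent_eval_at p : laurent (eval_at q p).
Proof. by exists 0%N, p; rewrite expr0 invr1 mul1r. Qed.

Lemma laurent_add c d : laurent c -> laurent d -> laurent (c + d).
Proof.
move=> [N [p ->]] [M [r ->]]; exists (N + M)%N, ('X^M * p + 'X^N * r).
rewrite rmorphD !rmorphM !rmorphXn /= eval_atX.
have qN := expf_neq0 N q_neq0; have qM := expf_neq0 M q_neq0.
have e (F : fieldType) (x y u v : F) : x != 0 -> y != 0 ->
    x^-1 * u + y^-1 * v = (x * y)^-1 * (y * u + x * v).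
  by move=> x0 y0; field; rewrite x0 y0.
rewrite (exprD q N M).
exact: (e _ _ _ (eval_at q p) (eval_at q r) qN qM).
Qed.

Lemma laurent_mul c d : laurent c -> laurent d -> laurent (c * d).
Proof.
move=> [N [p ->]] [M [r ->]]; exists (N + M)%N, (p * r).
by rewrite exprD invfM rmorphM /= mulrACA.
Qed.

Lemma laurent_int (z : int) : laurent z%:~R.
Proof. by rewrite -(rmorph_int (eval_at q)); exact: laurent_eval_at. Qed.

Lemma laurent1 : laurent 1. Proof. exact: (laurent_int 1). Qed.
Lemma laurent0 : laurent 0. Proof. exact: (laurent_int 0). Qed.

Lemma laurent_opp c : laurent c -> laurent (- c).
Proof. by rewrite -mulN1r; exact/laurent_mul/(laurent_int (- 1)). Qed.

Lemma laurent_sub c d : laurent c -> laurent d -> laurent (c - d).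
Proof. by move=> hc hd; apply/laurent_add/laurent_opp. Qed.

Lemma laurent_exp c n : laurent c -> laurent (c ^+ n).
Proof.
by move=> h; elim: n => [|n IH]; [exact: laurent1|rewrite exprS; exact: laurent_mul].
Qed.

Lemma laurent_q : laurent q.
Proof. by rewrite -(eval_atX q); exact: laurent_eval_at. Qed.

Lemma laurent_qV : laurent q^-1.
Proof. by exists 1%N, 1; rewrite rmorph1 mulr1. Qed.

Lemma laurent_exprz (z : int) : laurent (q ^ z).
Proof.
by case: z => n; [exact/laurent_exp/laurent_q|rewrite NegzE -exprnN -exprVn;
  exact/laurent_exp/laurent_qV].
Qed.

Lemma laurent_eval_at_qV p : laurent (eval_at q^-1 p).
Proof.
exists (size p), (\poly_(i < (size p).+1) p`_(size p - i)).
rewrite eval_at_q -eval_at_qinv_rev //.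
by rewrite mulKf // expf_neq0 ?q_neq0.
Qed.

Lemma laurent_qinv c : laurent c -> laurent (qinv c).
Proof.
move=> [N [p ->]]; rewrite rmorphM -exprVn rmorphXn /= qinv_qV qinv_eval_at_q.
exact/laurent_mul/laurent_eval_at_qV/laurent_exp/laurent_q.
Qed.

(** After multiplication by q^(size r) the left side is divisible by q^(size r + 1), while the right
    side has degree at most size r. *)
Lemma eval_at_q_qV_disjoint (p r : {poly rat}) :
  q * eval_at q p = eval_at q^-1 r -> p = 0.
Proof.
move=> h; have := @eval_at_qinv_rev r (size r) (leqnSn _).
rewrite -h -{1 2}(eval_atX q) -rmorphXn -!rmorphM -eval_at_q.
move/eval_at_q_inj; rewrite mulrA -exprSr => h2.
apply/eqP; case: eqP => // /eqP p0.
have := size_poly (size r).+1 (fun i => r`_(size r - i)).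
by rewrite -h2 mulrC size_mulXn // -{2}[(size r).+1]addn0 leq_add2l leqn0
  size_poly_eq0 (negPf p0).
Qed.

Lemma laurent_split c : laurent c ->
  exists a b (k : rat), c = q * eval_at q a + rat_emb k + q^-1 * eval_at q^-1 b.
Proof.
have polyP (p : {poly rat}) : exists p' k, p = p' * 'X + k%:P.
  by elim/poly_ind: p => [|p k _]; [exists 0, 0; rewrite mul0r add0r|exists p, k].
move=> [N [p ->]]; elim: N p => [|N IH] p; have [p' [k ->]] := polyP p.
  exists p', 0, k; rewrite rmorph0 mulr0 addr0 expr0 invr1 mul1r.
  by rewrite rmorphD rmorphM /= eval_atX eval_atC mulrC.
rewrite rmorphD rmorphM /= eval_atX eval_atC.
have [a [b [j h]]] := IH p'.
have -> : q ^- N.+1 * (eval_at q p' * q + rat_emb k) =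
  q ^- N * eval_at q p' + q^-1 ^+ N.+1 * rat_emb k.
  rewrite mulrDr exprVn; congr (_ + _).
  by rewrite exprSr invfM mulrACA mulVf ?mulr1 ?q_neq0.
exists a, (b + k%:P * 'X^N), j; rewrite h rmorphD rmorphM rmorphXn /= eval_atX.
by rewrite eval_atC exprS; ring.
Qed.

(** In the splitting c = q a(q) + k + q^-1 b(q^-1), anti-invariance forces b = - a and k = 0. This
    is the scalar step of the Kazhdan-Lusztig argument. *)
Lemma antiinvariant_split c : laurent c -> qinv c = - c ->
  exists p, c = q * eval_at q p - q^-1 * eval_at q^-1 p.
Proof.
move=> /laurent_split[a [b [k ->]]].
have qk : qinv (rat_emb k) = rat_emb k.
  by rewrite -(eval_atC q) qinv_eval_at_q !eval_atC.
rewrite !rmorphD !rmorphM /= qinv_q qinv_qV qinv_eval_at_q qinv_eval_at_qinv qk.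
move=> h; have {}h : q * eval_at q b = - (q * eval_at q a + rat_emb k + q^-1 * eval_at q^-1 b) - q^-1 * eval_at q^-1 a - rat_emb k.
  by rewrite -h; ring.
(* Only positive powers of q on the left and none on the right, so a + b = 0; what remains is k =
   0. *)
have {h} h1 : q * eval_at q (a + b) =
    eval_at q^-1 (- (k *+ 2)%:P - 'X * (a + b)).
  rewrite rmorphB rmorphN /= eval_atC rmorphMn rmorphM /= eval_atX !rmorphD /=.
  by rewrite mulrDr h; ring.
have ab := eval_at_q_qV_disjoint h1.
move: h1; rewrite ab rmorph0 !mulr0 subr0 => /esym/eqP.
rewrite eval_at_qinv_eq0 oppr_eq0 polyC_eq0 mulrn_eq0 /= => /eqP ->.
by exists a; have /eqP := ab; rewrite addr_eq0 => /eqP ->; rewrite !rmorphN rmorph0 /=; ring.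
Qed.

(** * Finite linear combinations and spans *)

Section Lincomb.
Variables (I : choiceType) (V : lmodType Qq) (b : I -> V).

Lemma lincombEw (d : {fset I}) (c : {malg Qq[I]}) : (msupp c `<=` d)%fset ->
  lincomb b c = \sum_(i <- d) c@_i *: b i.
Proof.
move=> cd; rewrite /lincomb; apply: big_fset_incl => // i _ /mcoeff_outdom ->.
by rewrite scale0r.
Qed.

Lemma lincombD c d : lincomb b (c + d) = lincomb b c + lincomb b d.
Proof.
rewrite (@lincombEw (msupp c `|` msupp d)%fset) ?msuppD_le //.
rewrite (@lincombEw (msupp c `|` msupp d)%fset c) ?fsubsetUl //.
rewrite (@lincombEw (msupp c `|` msupp d)%fset d) ?fsubsetUr //.
by rewrite -big_split; apply: eq_bigr => i _ /=; rewrite mcoeffD scalerDl.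
Qed.

Lemma lincombZ a c : lincomb b (a *: c) = a *: lincomb b c.
Proof.
rewrite (@lincombEw (msupp c)) ?msuppZ_le // scaler_sumr.
by apply: eq_bigr => i _; rewrite mcoeffZ scalerA.
Qed.

Lemma lincombB c d : lincomb b (c - d) = lincomb b c - lincomb b d.
Proof. by rewrite lincombD -[- d]scaleN1r lincombZ scaleN1r. Qed.

Lemma lincombU i a : lincomb b << a *g i >> = a *: b i.
Proof.
by rewrite (@lincombEw [fset i]%fset) ?msuppU_le // big_seq_fset1 mcoeffUU.
Qed.

Lemma lincomb0 : lincomb b 0 = 0.
Proof. by rewrite -(scale0r (0 : {malg Qq[I]})) lincombZ scale0r. Qed.

Lemma lincomb_sum (J : Type) (r : seq J) (F : J -> {malg Qq[I]}) :
  lincomb b (\sum_(j <- r) F j) = \sum_(j <- r) lincomb b (F j).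
Proof.
by elim: r => [|j r IH]; rewrite ?big_nil ?lincomb0 // !big_cons lincombD IH.
Qed.

End Lincomb.

Section Lspan.
Variables (V : lmodType Qq) (A : set Qq) (P : set V).

Lemma lspan0 : lspan A P 0.
Proof. by exists [::] => //; rewrite big_nil. Qed.

Lemma lspanD u v : lspan A P u -> lspan A P v -> lspan A P (u + v).
Proof.
move=> [t ht ->] [r hr ->]; exists (t ++ r); last by rewrite big_cat.
by move=> x; rewrite mem_cat => /orP[/ht|/hr].
Qed.

Lemma lspan_in a v : A a -> P v -> lspan A P (a *: v).
Proof.
move=> Aa Pv; exists [:: (a, v)]; last by rewrite big_seq1.
by move=> x; rewrite inE => /eqP ->.
Qed.

Lemma lspanZ a v : (forall c d, A c -> A d -> A (c * d)) -> A a ->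
  lspan A P v -> lspan A P (a *: v).
Proof.
move=> AM Aa [t ht ->]; exists [seq (a * x.1, x.2) | x <- t].
  by move=> x /mapP[y /ht[? ?] ->]; split=> //; exact: AM.
by rewrite scaler_sumr big_map; apply: eq_bigr => x _; rewrite scalerA.
Qed.

Lemma lspan_sum (J : eqType) (r : seq J) (F : J -> V) :
  (forall j, j \in r -> lspan A P (F j)) -> lspan A P (\sum_(j <- r) F j).
Proof.
elim: r => [|j r IH] h; first by rewrite big_nil; exact: lspan0.
rewrite big_cons; apply: lspanD; first by apply: h; rewrite mem_head.
by apply: IH => i ir; apply: h; rewrite inE ir orbT.
Qed.

End Lspan.

Lemma lspan_sub (V : lmodType Qq) (A : set Qq) (P Q : set V) v :
  (forall c d, A c -> A d -> A (c * d)) ->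
  (forall u, P u -> lspan A Q u) -> lspan A P v -> lspan A Q v.
Proof.
move=> AM PQ [t ht ->]; apply: lspan_sum => x /ht[Ax Px].
exact/lspanZ/PQ.
Qed.

(** * Canonical bases *)

Section CanonicalBasis.
Variables (I : choiceType) (V : lmodType Qq) (b : I -> V) (ht : I -> nat).
Variables (br : V -> V) (x : Qq).
Hypothesis bB : is_basis b.
Hypothesis brD : forall u v, br (u + v) = br u + br v.
Hypothesis brZ : forall a v, br (a *: v) = qinv a *: br v.
Hypothesis brK : forall v, br (br v) = v.
Hypothesis br_tri : forall i,
  lspan laurent (fun v => exists2 j, (ht j < ht i)%N & v = b j) (br (b i) - b i).
Hypothesis xE : x = q \/ x = q^-1.

Let co (v : V) : {malg Qq[I]} := xget 0 [set c | v = lincomb b c].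

Let coK v : lincomb b (co v) = v.
Proof.
have [c hc] := bB.1 v; rewrite /co; case: xgetP => [d _ <- //|/(_ c)].
by case.
Qed.

Let coE v c : v = lincomb b c -> co v = c.
Proof.
move=> h; apply/eqP; rewrite -subr_eq0; apply/eqP/(bB.2).
by rewrite lincombB coK h subrr.
Qed.

Let coD u v : co (u + v) = co u + co v.
Proof. by apply: coE; rewrite lincombD !coK. Qed.

Let coZ a v : co (a *: v) = a *: co v.
Proof. by apply: coE; rewrite lincombZ !coK. Qed.

Let coB u v : co (u - v) = co u - co v.
Proof. by apply: coE; rewrite lincombB !coK. Qed.

Let co0 : co 0 = 0.
Proof. by apply: coE; rewrite lincomb0. Qed.

Let cob i : co (b i) = << 1 *g i >>.
Proof. by apply: coE; rewrite lincombU scale1r. Qed.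

Let br0 : br 0 = 0.
Proof. by have := brZ 0 0; rewrite rmorph0 !scale0r. Qed.

Let brN v : br (- v) = - br v.
Proof. by rewrite -[- v]scaleN1r brZ rmorphN rmorph1 scaleN1r. Qed.

(** The filtration for the descent: coefficients in A, support below height N. Here A is the Laurent
    ring, x Q[x] or the whole field. Every vector has finite support, so infinitely many indices of
    equal height do no harm. *)
Let Lc (A : set Qq) N v :=
  forall i, A (co v)@_i /\ ((N <= ht i)%N -> (co v)@_i = 0).

Let LcD A N u v : (forall c d, A c -> A d -> A (c + d)) ->
  Lc A N u -> Lc A N v -> Lc A N (u + v).
Proof.
move=> AD hu hv i; have [u1 u2] := hu i; have [v1 v2] := hv i.
rewrite coD mcoeffD; split; first exact: AD.
by move=> hi; rewrite u2 ?v2 ?addr0.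
Qed.

Let LcZ A N a v : (forall c, A c -> A (a * c)) -> Lc A N v -> Lc A N (a *: v).
Proof.
move=> AM hv i; have [v1 v2] := hv i; rewrite coZ mcoeffZ; split; first exact: AM.
by move=> hi; rewrite v2 ?mulr0.
Qed.

Let Lc0 (A : set Qq) N : A 0 -> Lc A N 0.
Proof. by move=> A0 i; rewrite co0 mcoeff0. Qed.

Let Lc_sum (A : set Qq) N (J : eqType) (r : seq J) (F : J -> V) :
  A 0 -> (forall c d, A c -> A d -> A (c + d)) ->
  (forall j, j \in r -> Lc A N (F j)) -> Lc A N (\sum_(j <- r) F j).
Proof.
move=> A0 AD; elim: r => [|j r IH] h; first by rewrite big_nil; exact: Lc0.
rewrite big_cons; apply: LcD => //; first by apply: h; rewrite mem_head.
by apply: IH => i ir; apply: h; rewrite inE ir orbT.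
Qed.

Let Lc_b N i : (ht i < N)%N -> Lc laurent N (b i).
Proof.
move=> hi j; rewrite cob mcoeffU; split.
  by case: eqP => _; [exact: laurent1|exact: laurent0].
by case: eqP => // <-; rewrite leqNgt hi.
Qed.

Let Lc_leq A N M v : (N <= M)%N -> Lc A N v -> Lc A M v.
Proof.
move=> NM hv i; have [h1 h2] := hv i; split=> // Mi.
exact/h2/(leq_trans NM).
Qed.

Let Lc_tri i : Lc laurent (ht i) (br (b i) - b i).
Proof.
have [t tP ->] := br_tri i; apply: Lc_sum laurent0 laurent_add _ => y /tP[la].
move=> [j ji ->]; apply: LcZ; last exact: Lc_b.
by move=> c; exact: laurent_mul.
Qed.

(** The semilinear map that fixes the basis [b]. By triangularity [br] agrees with it up to lower
    height, which determines the top coefficients of [br v]. *)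
Let conj (v : V) : V := \sum_(i <- msupp (co v)) qinv (co v)@_i *: b i.

Let co_sumb (F : I -> Qq) (r : {fset I}) i :
  (co (\sum_(j <- r) F j *: b j))@_i = if i \in r then F i else 0.
Proof.
have -> : co (\sum_(j <- r) F j *: b j) = \sum_(j <- r) << F j *g j >>.
  by apply: coE; rewrite lincomb_sum; apply: eq_bigr => j _; rewrite lincombU.
rewrite raddf_sum /=; case: ifP => ir.
  rewrite (big_fsetD1 i) //= mcoeffUU big_seq big1 ?addr0 // => j.
  by rewrite !inE mcoeffU => /andP[/negPf ->].
rewrite big_seq big1 // => j jr; rewrite mcoeffU; case: eqP => // ji.
by rewrite -ji jr in ir.
Qed.

Let co_conj v i : (co (conj v))@_i = qinv (co v)@_i.
Proof.
rewrite co_sumb; case: ifPn => // /mcoeff_outdom ->; by rewrite rmorph0.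
Qed.

Let br_sum (J : Type) (r : seq J) (F : J -> V) :
  br (\sum_(j <- r) F j) = \sum_(j <- r) br (F j).
Proof. by elim: r => [|j r IH]; rewrite ?big_nil ?br0 // !big_cons brD IH. Qed.

Let br_conj N v : Lc laurent N.+1 v -> Lc laurent N (br v - conj v).
Proof.
move=> hv; rewrite -{1}(coK v) /lincomb br_sum /conj -sumrB.
apply: Lc_sum laurent0 laurent_add _ => i.
rewrite -mcoeff_neq0 brZ -scalerBr => iv; have [li hi] := hv i.
apply: LcZ => [c|]; first exact/laurent_mul/laurent_qinv.
apply: (@Lc_leq _ (ht i)); last exact: Lc_tri.
by rewrite leqNgt; apply: contra iv => /hi ->.
Qed.

Let br_top N v i : Lc laurent N.+1 v -> (N <= ht i)%N ->
  (co (br v))@_i = qinv (co v)@_i.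
Proof.
move=> hv hi; have [_ /(_ hi)/eqP] := br_conj hv i.
by rewrite coB mcoeffB subr_eq0 co_conj => /eqP.
Qed.

Let Lc_br N v : Lc laurent N v -> Lc laurent N (br v).
Proof.
move=> hv i.
have hv' : Lc laurent N.+1 v by apply: Lc_leq hv.
rewrite -(subrK (conj v) (br v)) coD mcoeffD co_conj; have [h1 h2] := br_conj hv' i.
have [h3 h4] := hv i; split; first exact/laurent_add/laurent_qinv.
by move=> hi; rewrite h2 ?h4 // rmorph0 addr0.
Qed.

Let xL : set Qq := [set c | exists p, c = x * eval_at x p].

Let xL0 : xL 0. Proof. by exists 0; rewrite rmorph0 mulr0. Qed.

Let xLD c d : xL c -> xL d -> xL (c + d).
Proof. by move=> [p ->] [r ->]; exists (p + r); rewrite rmorphD mulrDr. Qed.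

Let xLN c : xL c -> xL (- c).
Proof. by move=> [p ->]; exists (- p); rewrite rmorphN mulrN. Qed.

Let xL_laurent c : xL c -> laurent c.
Proof.
move=> [p ->]; case: xE => ->; apply: laurent_mul.
- exact: laurent_q.
- exact: laurent_eval_at.
- exact: laurent_qV.
- exact: laurent_eval_at_qV.
Qed.

(** An invariant element of x Q[x] also lies in x^-1 Q[x^-1], and these two meet in 0. *)
Let xL_inv c : xL c -> qinv c = c -> c = 0.
Proof.
move=> [p ->]; case: xE => ->; rewrite rmorphM /=.
  rewrite qinv_q qinv_eval_at_q => h; suff -> : p = 0 by rewrite rmorph0 mulr0.
  apply: (@eval_at_q_qV_disjoint _ ('X * p)).
  by rewrite rmorphM /= eval_atX h.
rewrite qinv_qV qinv_eval_at_qinv => h.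
suff -> : p = 0 by rewrite rmorph0 mulr0.
apply: (@eval_at_q_qV_disjoint _ ('X * p)).
by rewrite rmorphM /= eval_atX h.
Qed.

Let xL_anti c : laurent c -> qinv c = - c -> exists2 u, xL u & c = u - qinv u.
Proof.
move=> lc /(antiinvariant_split lc)[p ->]; case: xE => xx; rewrite /xL /= xx.
  exists (q * eval_at q p); first by exists p.
  by rewrite rmorphM /= qinv_q qinv_eval_at_q.
exists (- (q^-1 * eval_at q^-1 p)); first by exists (- p); rewrite rmorphN mulrN.
by rewrite rmorphN rmorphM /= qinv_qV qinv_eval_at_qinv opprK addrC.
Qed.

Let Lc_sub (A B : set Qq) N v : (forall c, A c -> B c) -> Lc A N v -> Lc B N v.
Proof. by move=> AB hv i; have [h1 h2] := hv i; split=> //; exact: AB. Qed.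

(* Kill the coefficients in the top height, which are anti-invariant, and
   descend. *)
Let solve N v : Lc laurent N v -> br v = - v ->
  exists2 w, Lc xL N w & v = w - br w.
Proof.
elim: N v => [|N IH] v hv brv.
  exists 0; first exact: Lc0.
  rewrite br0 subr0 -(coK v); suff -> : co v = 0 by rewrite lincomb0.
  by apply/malgP => i; rewrite mcoeff0; apply: (hv i).2.
have : forall i, exists u, (N <= ht i)%N -> xL u /\ (co v)@_i = u - qinv u.
  move=> i; case: (leqP N (ht i)) => hi; last by exists 0.
  have := br_top hv hi; rewrite brv -scaleN1r coZ mcoeffZ mulN1r => h.
  by have [u ? ?] := xL_anti (hv i).1 (esym h); exists u.
move=> /choice[u uP].
pose d := [fset i in msupp (co v) | (N <= ht i)%N]%fset.
pose w0 := \sum_(i <- d) u i *: b i.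
have w0co i : (co w0)@_i = if i \in d then u i else 0 by exact: co_sumb.
have w0L : Lc xL N.+1 w0.
  move=> i; rewrite w0co !inE; case: (boolP (i \in msupp (co v))) => hi /=.
    case: (leqP N (ht i)) => Ni /=.
      split; first by have [] := uP i Ni.
      by move/(hv i).2/eqP; rewrite mcoeff_eq0 hi.
    by split=> // /(ltn_trans Ni); rewrite ltnn.
  by split.
have w0l : Lc laurent N.+1 w0 by apply: Lc_sub w0L.
pose v' := v - w0 + br w0.
have v'L : Lc laurent N v'.
  have h : Lc laurent N.+1 v'.
    apply: LcD laurent_add _ _; last exact: Lc_br.
    apply: LcD laurent_add _ _ => //; rewrite -scaleN1r; apply: LcZ => // c.
    by rewrite mulN1r; exact: laurent_opp.
  move=> i; split=> [|hi]; first by have [] := h i.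
  rewrite coD coB mcoeffD mcoeffB (br_top w0l hi) w0co !inE hi andbT.
  case: ifPn => iv; last by rewrite (mcoeff_outdom iv) rmorph0 subr0 addr0.
  by rewrite (uP i hi).2; ring.
have [|w' w'L v'E] := IH v' v'L.
  by rewrite /v' !brD brK brN brv !opprD !opprK addrAC.
exists (w0 + w').
  by apply: LcD xLD w0L _; apply: Lc_leq w'L.
rewrite brD opprD addrACA -v'E /v' addrACA addrC.
by rewrite [_ + br w0]addrC -!addrA [w0 + _]addrC !addrA subrK subrr add0r.
Qed.

(** The coefficients at the top height are invariant and lie in x Q[x], hence vanish, and the height
    bound drops. *)
Let canon_uniq N v : Lc xL N v -> br v = v -> v = 0.
Proof.
elim: N v => [|N IH] v hv brv.
  rewrite -(coK v); suff -> : co v = 0 by rewrite lincomb0.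
  by apply/malgP => i; rewrite mcoeff0; apply: (hv i).2.
apply: IH => // i; split=> [|hi]; first exact: (hv i).1.
apply: xL_inv; first exact: (hv i).1.
have hl : Lc laurent N.+1 v by apply: Lc_sub hv.
by rewrite -(br_top hl hi) brv.
Qed.

Let bounded v : exists N, forall i, (N <= ht i)%N -> (co v)@_i = 0.
Proof.
exists (\max_(i <- msupp (co v)) (ht i).+1)%N => i; apply: contraTeq.
rewrite mcoeff_neq0 -ltnNge => iv.
by rewrite (big_fsetD1 i iv) /= leq_max ltnSn.
Qed.

(** As [br] is an involution, [br (b i) - b i] is anti-invariant, so [solve] writes it as w - br w,
    and b i + w is invariant. Uniqueness is [canon_uniq] for the difference of two solutions. *)
Theorem canonical_basis : exists! G : I -> V,
  is_basis G /\ forall i,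
    br (G i) = G i /\ eq_mod x (lspan (range (eval_at x)) (range b)) (G i) (b i).
Proof.
have x0 : x != 0 by case: xE => ->; rewrite ?invr_eq0 q_neq0.
have : forall i, exists w, Lc xL (ht i) w /\ br (b i) - b i = w - br w.
  move=> i; have [|w] := solve (Lc_tri i); last by exists w.
  by rewrite brD brN brK opprB.
move=> /choice[w wP]; pose G i := b i + w i.
(* Membership in x L is read off from the coordinates in the basis [b]. *)
have modP v : (exists2 u, lspan (range (eval_at x)) (range b) u & v = x *: u)
    <-> forall i, xL (co v)@_i.
  split=> [[u [t tP ->] ->] i|hv].
    rewrite coZ mcoeffZ.
    have : range (eval_at x) (co (\sum_(y <- t) y.1 *: y.2))@_i.
      elim: t tP => [|y t IH] tP.
        by rewrite big_nil co0 mcoeff0; exists 0 => //; rewrite rmorph0.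
      rewrite big_cons coD mcoeffD coZ mcoeffZ.
      have [|[p _ hp] [j _ <-]] := tP y; first by rewrite mem_head.
      have [|p' _ <-] := IH; first by move=> z hz; apply: tP; rewrite inE hz orbT.
      rewrite cob mcoeffU -hp; exists (p *+ (j == i) + p') => //.
      by rewrite rmorphD rmorphMn /= mulr_natr.
    by move=> [p _ <-]; exists p.
  exists (x^-1 *: v); last by rewrite scalerA divff // scale1r.
  rewrite -{1}(coK v) /lincomb scaler_sumr; apply: lspan_sum => i _.
  rewrite scalerA; apply: lspan_in; last by exists i.
  by have [p ->] := hv i; exists p => //; rewrite mulKf.
have lincG c : lincomb G c = lincomb b c + lincomb w c.
  by rewrite /lincomb -big_split; apply: eq_bigr => i _ /=; rewrite scalerDr.
(* Each correction [w i] lies strictly below [ht i], so replacing [b] by G keeps the top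
   coefficients. Generation and independence of G both descend on the height bound with this. *)
have low N c : (forall i, (N < ht i)%N -> c@_i = 0) ->
    forall i, (N <= ht i)%N -> (co (lincomb w c))@_i = 0.
  move=> hc; suff : Lc (fun=> True) N (lincomb w c) by move=> h i; apply: (h i).2.
  apply: Lc_sum => // i; rewrite -mcoeff_neq0 => ic; apply: LcZ => //.
  apply: (@Lc_leq _ (ht i)); last by apply: Lc_sub (wP i).1.
  by rewrite leqNgt; apply: contra ic => /hc ->.
exists G; split.
  split; last first.
    move=> i; have [wL wE] := wP i; split.
      by rewrite /G brD; move/eqP: wE; rewrite subr_eq addrAC eq_sym subr_eq eq_sym addrC [b i + _]addrC => /eqP.
    have [_ /(_ (fun j => (wL j).1))] := modP (w i).
    by move=> [u hu uE]; exists u => //; rewrite /G addrAC subrr add0r.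
  split=> [v|c].
    have [N] := bounded v; elim: N v => [|N IH] v hv.
      exists 0; rewrite lincomb0 -(coK v).
      suff -> : co v = 0 by rewrite lincomb0.
      by apply/malgP => i; rewrite mcoeff0; apply: hv.
    have [|c cE] := IH (v - lincomb G (co v)).
      move=> i hi; rewrite lincG coK opprD addrA subrr add0r.
      by rewrite -scaleN1r coZ mcoeffZ (@low N) ?mulr0.
    by exists (c + co v); rewrite lincombD -cE subrK.
  have [N] : exists N, forall i, (N <= ht i)%N -> c@_i = 0.
    by have := bounded (lincomb b c); rewrite (coE (erefl _)).
  elim: N => [|N IH] hc h0.
    by apply/malgP => i; rewrite mcoeff0; apply: hc.
  apply: IH => // i hi; have : (co (lincomb G c))@_i = 0 by rewrite h0 co0 mcoeff0.
  by rewrite lincG coD (coE (erefl _)) mcoeffD (@low N) ?addr0.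
move=> H [_ HP]; apply/funext => i.
have [brH [u hu uE]] := HP i.
have [brG [u' hu' uE']] : br (G i) = G i /\
    eq_mod x (lspan (range (eval_at x)) (range b)) (G i) (b i).
  have [wL wE] := wP i; split.
    by rewrite /G brD; move/eqP: wE; rewrite subr_eq addrAC eq_sym subr_eq eq_sym addrC [b i + _]addrC => /eqP.
  have [_ /(_ (fun j => (wL j).1))] := modP (w i).
  by move=> [v hv vE]; exists v => //; rewrite /G addrAC subrr add0r.
apply/eqP; rewrite -subr_eq0; apply/eqP.
have [N hN] := bounded (G i - H i).
apply: (@canon_uniq N); last by rewrite brD brN brG brH.
move=> j; split; last exact: hN.
have -> : G i - H i = (G i - b i) - (H i - b i) by rewrite opprB addrA subrK.
rewrite coB mcoeffB; apply: xLD; last apply: xLN.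
  by apply: (modP _).1; exists u'.
by apply: (modP _).1; exists u.
Qed.

End CanonicalBasis.

(** * Residues and the straightening rules *)

Section Residues.
Variables (n l : nat).
Hypotheses (n0 : (0 < n)%N) (l0 : (0 < l)%N).
Local Notation L := (n * l)%:Z.

Lemma abm_uniq (k a b m : int) :
  k = a + n%:Z * (b - 1) - L * m -> 1 <= a <= n%:Z -> 1 <= b <= l%:Z ->
  [/\ ares n k = a, bres n l k = b & mres n l k = m].
Proof.
move=> kE /andP[a1 an] /andP[b1 bl].
have kn : k - 1 = (b - 1 - l%:Z * m) * n%:Z + (a - 1) by rewrite kE PoszM; ring.
have n00 : n%:Z != 0 by rewrite eqz_nat -lt0n.
have l00 : l%:Z != 0 by rewrite eqz_nat -lt0n.
have kd : ((k - 1) %/ n%:Z)%Z = b - 1 - l%:Z * m.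
  rewrite kn divzMDl // divz_small ?addr0 //.
  by rewrite subr_ge0 a1 /= ltrBlDr ltzD1.
have bm : b - 1 - l%:Z * m = (- m) * l%:Z + (b - 1) by ring.
rewrite /ares /bres /mres kd; split.
- rewrite kn modzMDl modz_small ?subrK //.
  by rewrite subr_ge0 a1 /= ltrBlDr ltzD1.
- rewrite bm modzMDl modz_small ?subrK //.
  by rewrite subr_ge0 b1 /= ltrBlDr ltzD1.
- rewrite bm divzMDl // divz_small ?addr0 ?opprK //.
  by rewrite subr_ge0 b1 /= ltrBlDr ltzD1.
Qed.

Lemma abm_shift (k i : int) :
  [/\ ares n (k + L * i) = ares n k, bres n l (k + L * i) = bres n l k &
      mres n l (k + L * i) = mres n l k - i].
Proof.
apply: abm_uniq; [|exact: ares_itv|exact: bres_itv].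
by rewrite {1}(abm_eq n l k); ring.
Qed.

Lemma ares_shift k i : ares n (k + L * i) = ares n k.
Proof. by have [] := abm_shift k i. Qed.

Lemma bres_shift k i : bres n l (k + L * i) = bres n l k.
Proof. by have [] := abm_shift k i. Qed.

Definition alpha (k1 k2 : int) : int := ((ares n k2 - ares n k1) %% L)%Z.
Definition beta (k1 k2 : int) : int :=
  ((n%:Z * (bres n l k2 - bres n l k1)) %% L)%Z.

Lemma alphaE k1 k2 : alpha k1 k2 =
  ares n k2 - ares n k1 + (if ares n k1 <= ares n k2 then 0 else L).
Proof.
rewrite /alpha; have := ares_itv k1 n0; have := ares_itv k2 n0.
move: (ares n k1) (ares n k2) => a1 a2 h2 h1.
have nL : n%:Z <= L by rewrite PoszM ler_peMr //; lia.
case: ifP => h; first by rewrite addr0 modz_small //; lia.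
by rewrite -modzDr modz_small; lia.
Qed.

Lemma betaE k1 k2 : beta k1 k2 =
  n%:Z * (bres n l k2 - bres n l k1)
  + (if bres n l k1 <= bres n l k2 then 0 else L).
Proof.
rewrite /beta; have := bres_itv n k1 l0; have := bres_itv n k2 l0.
move: (bres n l k1) (bres n l k2) => b1 b2 h2 h1; rewrite PoszM.
case: ifP => h; first by rewrite addr0 modz_small //; nia.
by rewrite -modzDr modz_small; nia.
Qed.

Lemma res_alpha k1 k2 :
  ares n (k1 + alpha k1 k2) = ares n k2 /\ bres n l (k1 + alpha k1 k2) = bres n l k1.
Proof.
have [//|||-> ->] := @abm_uniq (k1 + alpha k1 k2) (ares n k2) (bres n l k1)
  (mres n l k1 - (if ares n k1 <= ares n k2 then 0 else 1)) => //.
- by rewrite alphaE {1}(abm_eq n l k1); case: ifP => _; ring.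
- exact: ares_itv.
- exact: bres_itv.
Qed.

Lemma res_beta k1 k2 :
  ares n (k1 + beta k1 k2) = ares n k1 /\ bres n l (k1 + beta k1 k2) = bres n l k2.
Proof.
have [//|||-> ->] := @abm_uniq (k1 + beta k1 k2) (ares n k1) (bres n l k2)
  (mres n l k1 - (if bres n l k1 <= bres n l k2 then 0 else 1)) => //.
- by rewrite betaE {1}(abm_eq n l k1); case: ifP => _; ring.
- exact: ares_itv.
- exact: bres_itv.
Qed.

Lemma diffE k1 k2 : exists j, k2 = k1 + alpha k1 k2 + beta k1 k2 + L * j.
Proof.
rewrite alphaE betaE {1}(abm_eq n l k2) {1}(abm_eq n l k1).
exists (mres n l k1 - mres n l k2 - (if ares n k1 <= ares n k2 then 0 else 1)
  - (if bres n l k1 <= bres n l k2 then 0 else 1)).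
by case: ifP => _; case: ifP => _; ring.
Qed.

Lemma alpha_rev k1 k2 :
  alpha k2 k1 = if alpha k1 k2 == 0 then 0 else L - alpha k1 k2.
Proof.
rewrite !alphaE; have := ares_itv k1 n0; have := ares_itv k2 n0.
have nL : n%:Z <= L by rewrite PoszM ler_peMr //; lia.
by move: (ares n k1) (ares n k2) => a1 a2 h2 h1; case: (lerP a1 a2) => ?; case: (lerP a2 a1) => ?; case: ifP => ?; lia.
Qed.

Lemma beta_rev k1 k2 :
  beta k2 k1 = if beta k1 k2 == 0 then 0 else L - beta k1 k2.
Proof.
rewrite !betaE; have := bres_itv n k1 l0; have := bres_itv n k2 l0.
move: (bres n l k1) (bres n l k2) => b1 b2 h2 h1; rewrite PoszM.
by case: (lerP b1 b2) => ?; case: (lerP b2 b1) => ?; case: ifP => ?; nia.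
Qed.

Lemma alpha_itv k1 k2 : 0 <= alpha k1 k2 < L.
Proof. by rewrite modz_ge0 ?ltz_pmod //; lia. Qed.

Lemma beta_itv k1 k2 : 0 <= beta k1 k2 < L.
Proof. by rewrite modz_ge0 ?ltz_pmod //; lia. Qed.

(** A nonzero beta is a multiple of n between n and nl - n, whereas a nonzero alpha is either below
    n or above nl - n; so one of the two patterns holds, without ties. *)
Lemma alpha_beta k1 k2 : alpha k1 k2 != 0 -> beta k1 k2 != 0 ->
  (alpha k1 k2 < beta k1 k2 /\ alpha k1 k2 + beta k1 k2 < L) \/
  (beta k1 k2 < alpha k1 k2 /\ L < alpha k1 k2 + beta k1 k2).
Proof.
have := alphaE k1 k2; have := betaE k1 k2.
have := ares_itv k1 n0; have := ares_itv k2 n0.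
have := bres_itv n k1 l0; have := bres_itv n k2 l0.
move: (bres n l k1) (bres n l k2) (ares n k1) (ares n k2) => b1 b2 a1 a2 ? ? ? ?.
move: (alpha k1 k2) (beta k1 k2) => x y; rewrite PoszM.
move=> hy hx x0 y0; have hn : 1 <= n%:Z by lia.
have h1 : n%:Z * (b2 - b1) <= n%:Z * (l%:Z - 1) by nia.
have h2 : n%:Z * (1 - l%:Z) <= n%:Z * (b2 - b1) by nia.
have h3 : b1 < b2 -> n%:Z <= n%:Z * (b2 - b1) by nia.
have h4 : b2 < b1 -> n%:Z * (b2 - b1) <= - n%:Z by nia.
have h5 : b1 == b2 -> n%:Z * (b2 - b1) = 0 by nia.
have e1 : n%:Z * (l%:Z - 1) = n%:Z * l%:Z - n%:Z by ring.
have e2 : n%:Z * (1 - l%:Z) = n%:Z - n%:Z * l%:Z by ring.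
move: h1 h2 h3 h4 h5 hx hy; rewrite e1 e2.
move: (n%:Z * (b2 - b1)) (n%:Z * l%:Z) => d N.
by case: (lerP b1 b2) => ?; case: (lerP a1 a2) => ?; [left|right|left|right]; lia.
Qed.

Lemma alpha_res k1 k2 k1' k2' : ares n k1 = ares n k1' -> ares n k2 = ares n k2' ->
  alpha k1 k2 = alpha k1' k2'.
Proof. by rewrite /alpha => -> ->. Qed.

Lemma beta_res k1 k2 k1' k2' : bres n l k1 = bres n l k1' ->
  bres n l k2 = bres n l k2' -> beta k1 k2 = beta k1' k2'.
Proof. by rewrite /beta => -> ->. Qed.

End Residues.

(** * The coefficients of the rule with alpha, beta > 0 *)

Section OddEven.
Variables (F : fieldType) (x : F).
Hypotheses (x0 : x != 0) (x2 : x + x^-1 != 0).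

Let fo m := (x ^+ (2 * m).+1 + x ^- (2 * m).+1) / (x + x^-1).
Let fe m := (x ^+ (2 * m) - x ^- (2 * m)) / (x + x^-1).

(** The two coefficient families are coupled by first-order recurrences; these make the boundary
    terms of the shift recurrence cancel. *)
Lemma odd_even_step m : fe m.+1 - fe m = (x - x^-1) * fo m.
Proof.
rewrite /fo /fe -mulrBl mulrA; congr (_ / _).
have -> : (2 * m.+1 = (2 * m).+2)%N by rewrite mulnS.
rewrite -!exprVn !exprS; set y := x ^+ _; set z := x^-1 ^+ _.
have xx : x * x^-1 = 1 by rewrite mulfV.
move: xx; set t := x^-1 => xx; apply/eqP; rewrite -subr_eq0; apply/eqP.
have -> : x * (x * y) - t * (t * z) - (y - z) - (x - t) * (x * y + t * z) =
  (x * t - 1) * (y - z) by ring.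
by rewrite xx subrr mul0r.
Qed.

Lemma even_odd_step m : fo m.+1 - fo m = (x - x^-1) * fe m.+1.
Proof.
rewrite /fo /fe -mulrBl mulrA; congr (_ / _).
have -> : (2 * m.+1 = (2 * m).+2)%N by rewrite mulnS.
rewrite -!exprVn !exprS; set y := x ^+ _; set z := x^-1 ^+ _.
have xx : x * x^-1 = 1 by rewrite mulfV.
move: xx; set t := x^-1 => xx; apply/eqP; rewrite -subr_eq0; apply/eqP.
have -> : x * (x * (x * y)) + t * (t * (t * z)) - (x * y + t * z)
  - (x - t) * (x * (x * y) - t * (t * z)) = (x * t - 1) * (x * y + t * z) by ring.
by rewrite xx subrr mul0r.
Qed.

Lemma odd0 : fo 0 = 1.
Proof. by rewrite /fo muln0 expr1 divff. Qed.

Lemma even0 : fe 0 = 0.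
Proof. by rewrite /fe muln0 expr0 invr1 subrr mul0r. Qed.

End OddEven.

Lemma q_qV_neq0 : q + q^-1 != 0.
Proof.
have h : 'X ^+ 2 + 1 != 0 :> {poly rat}.
  apply/eqP => /polyP/(_ 0%N)/eqP.
  by rewrite coefD coefXn coef1 coef0.
have : eval_at q ('X ^+ 2 + 1) != 0 by rewrite eval_at_q_eq0.
apply: contra => /eqP h2; rewrite rmorphD rmorphXn rmorph1 /= eval_atX.
by rewrite -(mulfV q_neq0) expr2 -mulrDr h2 mulr0.
Qed.

Definition fodd m : Qq := (q ^+ (2 * m).+1 + q ^- (2 * m).+1) / (q + q^-1).
Definition feven m : Qq := (q ^+ (2 * m) - q ^- (2 * m)) / (q + q^-1).

Lemma feven_step m : feven m.+1 = feven m + (q - q^-1) * fodd m.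
Proof. by rewrite -(odd_even_step q_neq0) addrC subrK. Qed.

Lemma fodd_step m : fodd m.+1 = fodd m + (q - q^-1) * feven m.+1.
Proof. by rewrite -(even_odd_step q_neq0) addrC subrK. Qed.

Lemma fodd0 : fodd 0 = 1. Proof. exact: odd0 q_qV_neq0. Qed.
Lemma feven0 : feven 0 = 0. Proof. exact: even0. Qed.

(** The recurrences stay inside Q[q, q^-1], which the quotient by q + q^-1 hides. *)
Lemma laurent_fodd_feven m : laurent (fodd m) /\ laurent (feven m).
Proof.
have lk : laurent (q - q^-1) by apply: laurent_sub laurent_q laurent_qV.
elim: m => [|m [h1 h2]]; first by rewrite fodd0 feven0; split; [exact: laurent1|exact: laurent0].
have h3 : laurent (feven m.+1) by rewrite feven_step; apply/laurent_add/laurent_mul.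
by split=> //; rewrite fodd_step; apply/laurent_add/laurent_mul.
Qed.

(** The terms of a rule as data, independent of the module in which monomials are interpreted: one
    list serves the wedge space, its twist and the functionals. *)
Definition wterm : Type := (Qq * (int * int))%type.

Definition wsum (V : lmodType Qq) (w : int -> int -> V) (t : seq wterm) : V :=
  \sum_(x <- t) x.1 *: w x.2.1 x.2.2.

Definition wscale (a : Qq) (t : seq wterm) : seq wterm :=
  [seq (a * x.1, x.2) | x <- t].

Lemma wsum_scale (V : lmodType Qq) (w : int -> int -> V) a t :
  wsum w (wscale a t) = a *: wsum w t.
Proof.
by rewrite /wsum big_map scaler_sumr; apply: eq_bigr => x _; rewrite scalerA.
Qed.

Lemma wsum_cat (V : lmodType Qq) (w : int -> int -> V) t r :
  wsum w (t ++ r) = wsum w t + wsum w r.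
Proof. exact: big_cat. Qed.

(** * Leading and inner terms of a rule *)

Section Form.
Variables (n l : nat).
Hypotheses (n0 : (0 < n)%N) (l0 : (0 < l)%N).
Local Notation L := (n * l)%:Z.
Local Notation alpha := (alpha n l).
Local Notation beta := (beta n l).

Definition ordered_terms (k1 k2 : int) (m0 : nat) (e : int) (f : nat -> Qq) :
    seq wterm :=
  [seq (f m, (k2 - e - (n * l * m)%:Z, k1 + e + (n * l * m)%:Z)) |
    m <- index_iota m0 `|k2 - k1|%N.+2 &
         k1 + e + (n * l * m)%:Z < k2 - e - (n * l * m)%:Z].

Lemma ordered_sumE (V : lmodType Qq) (w : int -> int -> V) k1 k2 m0 e f :
  ordered_sum n l w k1 k2 m0 e f = wsum w (ordered_terms k1 k2 m0 e f).
Proof. by rewrite /wsum big_map big_filter. Qed.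

(** All that later arguments use of a correction term: the pair lies strictly inside the old one
    with the same sum, which lowers the sum of squares, and it has the same residues, which keeps
    the exponent [Cw]. *)
Definition inner_term (k1 k2 : int) (x : wterm) : Prop :=
  [/\ laurent x.1, k1 < x.2.2, x.2.2 < x.2.1 & x.2.1 < k2] /\
  [/\ x.2.1 + x.2.2 = k1 + k2,
      perm_eq [:: ares n x.2.1; ares n x.2.2] [:: ares n k1; ares n k2] &
      perm_eq [:: bres n l x.2.1; bres n l x.2.2] [:: bres n l k1; bres n l k2]].

(** One formula for the four leading coefficients. Its exponent is opposite to the contribution of
    the pair to [Cexp], which is why the bar map has diagonal entries 1. *)
Definition lead (k1 k2 : int) : Qq :=
  - q ^ ((ares n k1 == ares n k2)%:Z - (bres n l k1 == bres n l k2)%:Z).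

Lemma leadC k1 k2 : lead k1 k2 = lead k2 k1.
Proof. by rewrite /lead eq_sym [bres n l k1 == _]eq_sym. Qed.

Lemma alpha_eq0 k1 k2 : (alpha k1 k2 == 0) = (ares n k1 == ares n k2).
Proof.
rewrite (alphaE n0 l0); have := ares_itv k1 n0; have := ares_itv k2 n0.
have nL : n%:Z <= L by rewrite PoszM ler_peMr //; lia.
by move: (ares n k1) (ares n k2) => a1 a2 h2 h1; case: (lerP a1 a2) => ?; lia.
Qed.

Lemma beta_eq0 k1 k2 : (beta k1 k2 == 0) = (bres n l k1 == bres n l k2).
Proof.
rewrite (betaE n0 l0); have := bres_itv n k1 l0; have := bres_itv n k2 l0.
move: (bres n l k1) (bres n l k2) => b1 b2 h2 h1; rewrite PoszM.
by case: (lerP b1 b2) => ?; nia.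
Qed.

Lemma inner_scale k1 k2 a t : laurent a ->
  (forall x, x \in t -> inner_term k1 k2 x) ->
  forall x, x \in wscale a t -> inner_term k1 k2 x.
Proof.
move=> la tP x /mapP[y /tP[[h1 h2 h3 h4] h5] ->]; split=> //; split=> //.
exact: laurent_mul.
Qed.

Lemma inner_cat k1 k2 t r :
  (forall x, x \in t -> inner_term k1 k2 x) ->
  (forall x, x \in r -> inner_term k1 k2 x) ->
  forall x, x \in t ++ r -> inner_term k1 k2 x.
Proof. by move=> tP rP x; rewrite mem_cat => /orP[/tP|/rP]. Qed.

Lemma inner_ordered k1 k2 (m0 : nat) e f : (forall m, laurent (f m)) ->
  0 < e + L * m0%:Z ->
  perm_eq [:: ares n (k2 - e); ares n (k1 + e)] [:: ares n k1; ares n k2] ->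
  perm_eq [:: bres n l (k2 - e); bres n l (k1 + e)] [:: bres n l k1; bres n l k2] ->
  forall x, x \in ordered_terms k1 k2 m0 e f -> inner_term k1 k2 x.
Proof.
move=> lf e0 pa pb x /mapP[m]; rewrite mem_filter mem_index_iota.
move=> /andP[dc /andP[m0m _]] ->; rewrite /inner_term /=.
have -> : k2 - e - (n * l * m)%:Z = k2 - e + L * (- m%:Z) by lia.
have -> : k1 + e + (n * l * m)%:Z = k1 + e + L * m%:Z by lia.
have Lm : L * m0%:Z <= L * m%:Z by rewrite ler_wpM2l // lez_nat.
by rewrite !ares_shift // !bres_shift //; split; split=> //; lia.
Qed.

Lemma perm2 (T : eqType) (x y : T) : perm_eq [:: x; y] [:: y; x].
Proof. by rewrite (perm_catC [:: x] [:: y]). Qed.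

Lemma straighten_form k1 k2 : k1 <= k2 -> exists t : seq wterm,
  (forall x, x \in t -> inner_term k1 k2 x) /\
  forall (V : lmodType Qq) (w : int -> int -> V),
    straighten n l w k1 k2 = lead k1 k2 *: w k2 k1 + wsum w t.
Proof.
move=> k12; have [aa ab] := res_alpha n0 l0 k1 k2.
have [ba bb] := res_beta n0 l0 k1 k2; have [j jE] := diffE n0 l0 k1 k2.
(* Modulo nl, subtracting beta from k2 amounts to adding alpha to k1, so the pairs in the sums only
   exchange residues between the two letters. *)
have [ar br] : ares n (k2 - beta k1 k2) = ares n k2 /\
    bres n l (k2 - beta k1 k2) = bres n l k1.
  have -> : k2 - beta k1 k2 = k1 + alpha k1 k2 + L * j.
    by rewrite [X in X - _]jE; ring.
  by rewrite ares_shift // bres_shift.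
have [ar' br'] : ares n (k2 - alpha k1 k2) = ares n k1 /\
    bres n l (k2 - alpha k1 k2) = bres n l k2.
  have -> : k2 - alpha k1 k2 = k1 + beta k1 k2 + L * j.
    by rewrite [X in X - _]jE; ring.
  by rewrite ares_shift // bres_shift.
have L0 : 0 < L by rewrite ltz_nat muln_gt0 n0 l0.
have /andP[a0 aL] := alpha_itv n0 l0 k1 k2.
have /andP[b0 bL] := beta_itv n0 l0 k1 k2.
have lq2 (y : Qq) : laurent y -> laurent (y ^+ 2 - 1).
  by move=> ly; apply: laurent_sub laurent1; exact: laurent_exp.
rewrite /straighten -/(alpha k1 k2) -/(beta k1 k2) /lead -alpha_eq0 -beta_eq0.
have i0 f : (forall m, laurent (f m)) ->
    forall x, x \in ordered_terms k1 k2 1 0 f -> inner_term k1 k2 x.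
  by move=> lf; apply: inner_ordered => //; rewrite ?subr0 ?addr0 ?perm2 //; lia.
have ia f : (forall m, laurent (f m)) -> alpha k1 k2 != 0 ->
    forall x, x \in ordered_terms k1 k2 0 (alpha k1 k2) f -> inner_term k1 k2 x.
  by move=> lf hh; apply: inner_ordered => //; rewrite ?aa ?ab ?ar' ?br' ?perm2 //; lia.
have ib f : (forall m, laurent (f m)) -> beta k1 k2 != 0 ->
    forall x, x \in ordered_terms k1 k2 0 (beta k1 k2) f -> inner_term k1 k2 x.
  by move=> lf hh; apply: inner_ordered => //; rewrite ?ba ?bb ?ar ?br ?perm2 //; lia.
case: (boolP (alpha k1 k2 == 0)) => al; case: (boolP (beta k1 k2 == 0)) => be.
- exists [::]; split=> // V w; rewrite /wsum big_nil addr0 subrr expr0z.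
  by rewrite scaleN1r.
- exists (wscale (q ^+ 2 - 1) (ordered_terms k1 k2 0 (beta k1 k2) (fun m => q ^+ (2 * m))
    ++ wscale (-1) (ordered_terms k1 k2 1 0 (fun m => q ^ (2 * m%:Z - 1))))).
  split=> [|V w]; last first.
    by rewrite subr0 expr1z wsum_scale wsum_cat wsum_scale scaleN1r !ordered_sumE.
  apply: inner_scale; first exact/lq2/laurent_q.
  apply: inner_cat; first by apply: ib => // m; exact/laurent_exp/laurent_q.
  apply: inner_scale; first exact: (laurent_int (-1)).
  by apply: i0 => m; exact: laurent_exprz.
- exists (wscale (q ^- 2 - 1) (ordered_terms k1 k2 0 (alpha k1 k2) (fun m => q ^- (2 * m))
    ++ wscale (-1) (ordered_terms k1 k2 1 0 (fun m => q ^ (1 - 2 * m%:Z))))).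
  split=> [|V w]; last first.
    by rewrite sub0r wsum_scale wsum_cat wsum_scale scaleN1r !ordered_sumE exprN1.
  apply: inner_scale; first by rewrite -exprVn; exact/lq2/laurent_qV.
  apply: inner_cat.
    by apply: ia => // m; rewrite -exprVn; exact/laurent_exp/laurent_qV.
  apply: inner_scale; first exact: (laurent_int (-1)).
  by apply: i0 => m; exact: laurent_exprz.
have lk : laurent (q - q^-1) by apply: laurent_sub laurent_q laurent_qV.
exists (wscale (q - q^-1) (ordered_terms k1 k2 0 (beta k1 k2) fodd
  ++ wscale (-1) (ordered_terms k1 k2 0 (alpha k1 k2) fodd)
  ++ ordered_terms k1 k2 1 (alpha k1 k2 + beta k1 k2 - L) feven
  ++ wscale (-1) (ordered_terms k1 k2 1 0 feven))).
split=> [|V w]; last first.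
  rewrite subrr expr0z scaleN1r wsum_scale !wsum_cat !wsum_scale !scaleN1r.
  rewrite !ordered_sumE !scalerDr !scalerN !addrA.
  by [].
apply: inner_scale => //; apply: inner_cat.
  by apply: ib => // m; have [] := laurent_fodd_feven m.
apply: inner_cat.
  apply: inner_scale; first exact: (laurent_int (-1)).
  by apply: ia => // m; have [] := laurent_fodd_feven m.
apply: inner_cat; last first.
  apply: inner_scale; first exact: (laurent_int (-1)).
  by apply: i0 => // m; have [] := laurent_fodd_feven m.
(* The offset alpha + beta - nl can be negative, but the sum starts at m = 1, where the lower letter
   is already k1 + alpha + beta. *)
apply: inner_ordered => [m|||].
- by have [] := laurent_fodd_feven m.
- lia.
- have -> : k2 - (alpha k1 k2 + beta k1 k2 - L) = k1 + L * (j + 1).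
    by rewrite [X in X - _]jE; ring.
  have -> : k1 + (alpha k1 k2 + beta k1 k2 - L) = k2 + L * (- j - 1).
    by rewrite [in RHS]jE; ring.
  by rewrite !ares_shift.
- have -> : k2 - (alpha k1 k2 + beta k1 k2 - L) = k1 + L * (j + 1).
    by rewrite [X in X - _]jE; ring.
  have -> : k1 + (alpha k1 k2 + beta k1 k2 - L) = k2 + L * (- j - 1).
    by rewrite [in RHS]jE; ring.
  by rewrite !bres_shift.
Qed.

End Form.

(** * Straightening rules along arithmetic progressions *)

Section Defect.
Variable V : lmodType Qq.
Implicit Types (phi psi F : int -> int -> V) (P Q : nat -> int -> int -> V).

(** The action of z_1 + z_2, where z_i lowers the i-th argument; being symmetric, it is compatible
    with exchanging the arguments. *)
Definition sigma2 F (i j : int) : V := F (i - 1) j + F i (j - 1).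

Definition tower P (M : nat) (d i : int) : V :=
  \sum_(0 <= m < M) P m (i + d - m%:Z) (i + m%:Z).

(* With phi i j = h (x + nl i) (y + nl j) and similarly for psi, P and Q, the
   straightening rule of h for the pair x + nl i, y + nl (i + p) reads
   defect p i = 0. *)
Definition defect phi psi P Q (p : nat) (i : int) : V :=
  phi i (i + p%:Z) + psi (i + p%:Z) i - tower P (uphalf p) p%:Z i
  + tower Q p./2.+1 p%:Z i.

Lemma tower_sigma P M d i :
  tower (fun m => sigma2 (P m)) M d i = tower P M (d - 1) i + tower P M (d + 1) (i - 1).
Proof.
rewrite /tower -big_split; apply: eq_bigr => m _ /=.
by rewrite /sigma2; congr (P _ _ _ + P _ _ _); ring.
Qed.

Lemma towerS P M d i :
  tower P M.+1 d i = tower P M d i + P M (i + d - M%:Z) (i + M%:Z).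
Proof. by rewrite /tower big_nat_recr. Qed.

Let sdefect phi psi P Q p i :=
  defect (sigma2 phi) (sigma2 psi) (fun m => sigma2 (P m)) (fun m => sigma2 (Q m)) p i.

(** Shifting turns the distance p into p + 1 and p - 1, but the lengths of the towers depend on the
    parity. One term of P and one of Q are left over, at arguments j and j - 1, and the hypothesis
    cancels them. In the odd case the arguments are equal. *)
Lemma defect_sigma_even phi psi P Q k i :
  (forall j, P k.+1 j (j - 1) + Q k.+1 (j - 1) j = 0) ->
  sdefect phi psi P Q k.+1.*2 i =
  defect phi psi P Q k.+1.*2.+1 (i - 1) + defect phi psi P Q k.*2.+1 i.
Proof.
move=> PQ; rewrite /sdefect /defect !tower_sigma !uphalf_double !doubleK /=.
rewrite !uphalf_double !doubleK /= /sigma2.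
rewrite (towerS P k.+1) (towerS Q k.+1 _ i).
have -> : k.+1.*2.+1%:Z = k.+1.*2%:Z + 1 by lia.
have -> : k.*2.+1%:Z = k.+1.*2%:Z - 1 by lia.
have -> : i - 1 + (k.+1.*2%:Z + 1) = i + k.+1.*2%:Z by ring.
have -> : i + (k.+1.*2%:Z - 1) = i + k.+1.*2%:Z - 1 by ring.
have := PQ (i + k.+1%:Z).
have -> : i + k.+1.*2%:Z - k.+1%:Z = i + k.+1%:Z by lia.
have -> : i + k.+1.*2%:Z - 1 - k.+1%:Z = i + k.+1%:Z - 1 by lia.
have -> : i - 1 + k.+1%:Z = i + k.+1%:Z - 1 by ring.
move/eqP; rewrite addr_eq0 => /eqP ->; move: (tower _ _ _ _) => x.
move: (tower _ _ _ _) (tower _ _ _ _) (tower _ _ _ _) => y z t.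
by lmod.
Qed.

Lemma defect_sigma_odd phi psi P Q k i :
  (forall j, P k j j + Q k.+1 j j = 0) ->
  sdefect phi psi P Q k.*2.+1 i =
  defect phi psi P Q k.+1.*2 (i - 1) + defect phi psi P Q k.*2 i.
Proof.
move=> PQ; rewrite /sdefect /defect !tower_sigma !uphalf_double !doubleK /=.
rewrite !uphalf_double !doubleK /= /sigma2.
rewrite (towerS P k _ i) (towerS Q k.+1 _ (i - 1)).
have -> : k.+1.*2%:Z = k.*2.+1%:Z + 1 by lia.
have -> : k.*2%:Z = k.*2.+1%:Z - 1 by lia.
have -> : i - 1 + (k.*2.+1%:Z + 1) = i + k.*2.+1%:Z by ring.
have -> : i + (k.*2.+1%:Z - 1) = i + k.*2.+1%:Z - 1 by ring.
have := PQ (i + k%:Z).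
have -> : i + k.*2.+1%:Z - 1 - k%:Z = i + k%:Z by lia.
have -> : i + k.*2.+1%:Z - k.+1%:Z = i + k%:Z by lia.
have -> : i - 1 + k.+1%:Z = i + k%:Z by lia.
move/eqP; rewrite addr_eq0 => /eqP ->; move: (tower _ _ _ _) => x.
move: (tower _ _ _ _) (tower _ _ _ _) (tower _ _ _ _) => y z t.
by lmod.
Qed.

(** Distance - 1 does not occur, so the terms it would contribute must cancel among themselves; for
    the rules this is the relation of the pair read across one period. *)
Lemma defect_sigma0 phi psi P Q i :
  (forall j, phi j (j - 1) + psi (j - 1) j + Q 0%N (j - 1) j + P 0%N j (j - 1) = 0) ->
  sdefect phi psi P Q 0 i = defect phi psi P Q 1 (i - 1).
Proof.
move=> /(_ i) h; rewrite /sdefect /defect !tower_sigma /= !towerS /tower !big_nil.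
rewrite /sigma2 !subr0 !addr0 !add0r !subrK /=.
move/eqP: h; rewrite -!addrA addr_eq0 => /eqP ->; rewrite -?addrA; lmod.
Qed.

End Defect.

Section DefectClosure.
Variables (V : lmodType Qq) (T : Type) (s : T -> T).
Variables (phi psi : T -> int -> int -> V) (P Q : T -> nat -> int -> int -> V).
Hypothesis phiS : forall t, phi (s t) = sigma2 (phi t).
Hypothesis psiS : forall t, psi (s t) = sigma2 (psi t).
Hypothesis PS : forall t m, P (s t) m = sigma2 (P t m).
Hypothesis QS : forall t m, Q (s t) m = sigma2 (Q t m).

Let D t := defect (phi t) (psi t) (P t) (Q t).

Definition defect_compatible t : Prop :=
  (forall k j, P t k.+1 j (j - 1) + Q t k.+1 (j - 1) j = 0) /\
  (forall k j, P t k j j + Q t k.+1 j j = 0).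

Let DS t : D (s t) = defect (sigma2 (phi t)) (sigma2 (psi t))
  (fun m => sigma2 (P t m)) (fun m => sigma2 (Q t m)).
Proof.
rewrite /D phiS psiS; congr (defect _ _ _ _); apply/funext => m.
  exact: PS.
exact: QS.
Qed.

Lemma defect_step t p i : defect_compatible t ->
  D (s t) p.+1 i = D t p.+2 (i - 1) + D t p i.
Proof.
move=> [h1 h2]; rewrite DS -(odd_double_half p).
case: (odd p); rewrite /= ?add0n ?add1n.
  exact: (@defect_sigma_even _ _ _ _ _ p./2).
exact: (@defect_sigma_odd _ _ _ _ _ p./2).
Qed.

Variables (base : T -> Prop) (c : Qq).
Hypothesis c0 : c != 0.
Hypothesis base_compatible : forall t, base t -> defect_compatible t.
Hypothesis base_defect0 : forall t i, base t -> D t 0 i = 0.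
Hypothesis base_sigma0 : forall t i, base t -> D (s t) 0 i = c *: D t 1 (i - 1).

(** The recurrence is solved for D t p.+2; the other two terms are D (s t) p.+1 and D t p. So the
    induction treats all t in H at once and needs H stable under s. The start D t 1 comes from D (s
    t) at distance 0. *)
Lemma defect_vanish (H : T -> Prop) :
  (forall t, H t -> H (s t)) -> (forall t, H t -> base t) ->
  forall p t i, H t -> D t p i = 0.
Proof.
move=> Hs Hb p; suff h t i : H t -> D t p i = 0 /\ D t p.+1 i = 0.
  by move=> t i Ht; have [] := h t i Ht.
elim: p t i => [|p IH] t i Ht.
  split; first exact/base_defect0/Hb.
  have := base_sigma0 (i + 1) (Hb t Ht); rewrite base_defect0; last exact/Hb/Hs.
  by rewrite addrK => /esym/eqP; rewrite scaler_eq0 (negPf c0) => /eqP.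
split; first by have [] := IH t i Ht.
have := @defect_step t p (i + 1) (base_compatible (Hb t Ht)).
have [_ ->] := IH (s t) (i + 1) (Hs t Ht); have [-> _] := IH t (i + 1) Ht.
by rewrite addrK addr0 => <-.
Qed.

(** The same recurrence read forwards; it later shows that alternating functions are stable under
    the shift. *)
Lemma defect_sigma_vanish t : base t -> (forall p i, D t p i = 0) ->
  forall p i, D (s t) p i = 0.
Proof.
move=> bt h0 [|p] i; first by rewrite base_sigma0 // h0 scaler0.
by rewrite defect_step ?h0 ?addr0 //; exact: base_compatible.
Qed.

End DefectClosure.

(** * The rules for fixed residues as two-step recurrences *)

Section Systems.
Variables (n l : nat).
Hypotheses (n0 : (0 < n)%N) (l0 : (0 < l)%N).
Variable V : lmodType Qq.
Local Notation L := (n * l)%:Z.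
Local Notation alpha := (alpha n l).
Local Notation beta := (beta n l).
Local Notation kap := (q - q^-1).
Implicit Types h : int -> int -> V.

Definition sigmaL h (c d : int) : V := h (c - L) d + h c (d - L).

Definition fam (x y : int) h (i j : int) : V := h (x + L * i) (y + L * j).

Lemma fam_sigma x y h : fam x y (sigmaL h) = sigma2 (fam x y h).
Proof.
apply/funext => i; apply/funext => j; rewrite /fam /sigmaL /sigma2.
by congr (h _ _ + h _ _); ring.
Qed.

Lemma sigma2Z (a : Qq) (F : int -> int -> V) :
  (fun i j => a *: sigma2 F i j) = sigma2 (fun i j => a *: F i j).
Proof. by apply/funext => i; apply/funext => j; rewrite /sigma2 scalerDr. Qed.

Section TwoTerm.
Variables (t : Qq) (x y : int).
Hypothesis t0 : t != 0.

Definition two_psi h i j := t *: fam y x h i j.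
Definition two_P h (m : nat) i j := ((t ^+ 2 - 1) * t ^+ (2 * m)) *: fam x y h i j.
(** The second sum of the rule starts at m = 1; the zero term at m = 0 lets both towers start at 0.
    The parameter t is q when alpha = 0 and q^-1 when beta = 0. *)
Definition two_Q h (m : nat) i j :=
  (if m is m'.+1 then (t ^+ 2 - 1) * t ^+ (2 * m').+1 else 0) *: fam y x h i j.

(** The rule for the two kinds of pairs at distance below nl: inside one period, and wrapping into
    the next. *)
Definition two_base h :=
  (forall j, fam x y h j j + t *: fam y x h j j = 0) /\
  (forall j, fam y x h (j - 1) j + t *: fam x y h j (j - 1) = 0).

Lemma two_compatible h : two_base h -> defect_compatible two_P two_Q h.
Proof.
move=> [b1 b2]; split=> k j; rewrite /two_P /two_Q.
  have /eqP := b2 j; rewrite addr_eq0 => /eqP ->.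
  rewrite mulnS; have -> : (t ^+ (2 + 2 * k)) = t * t ^+ (2 * k).+1 by rewrite -exprS.
  by move: (t ^+ _.+1) => z; lmod.
have /eqP := b1 j; rewrite addr_eq0 => /eqP ->.
by rewrite [t ^+ (2 * k).+1]exprS; move: (t ^+ (2 * k)) => z; lmod.
Qed.

Lemma two_defect0 h i : two_base h ->
  defect (fam x y h) (two_psi h) (two_P h) (two_Q h) 0 i = 0.
Proof.
move=> [b1 b2]; rewrite /defect /= towerS /tower !big_nil /two_psi /two_Q.
by rewrite scale0r !addr0 subr0.
Qed.

Let two_sigma h : [/\ fam x y (sigmaL h) = sigma2 (fam x y h),
  two_psi (sigmaL h) = sigma2 (two_psi h),
  (forall m, two_P (sigmaL h) m = sigma2 (two_P h m)) &
  (forall m, two_Q (sigmaL h) m = sigma2 (two_Q h m))].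
Proof.
by split; rewrite /two_psi /two_P /two_Q -?sigma2Z ?fam_sigma // => m;
  rewrite -?sigma2Z ?fam_sigma.
Qed.

Lemma two_sigma0 h i : two_base h ->
  defect (fam x y (sigmaL h)) (two_psi (sigmaL h)) (two_P (sigmaL h))
     (two_Q (sigmaL h)) 0 i
  = defect (fam x y h) (two_psi h) (two_P h) (two_Q h) 1 (i - 1).
Proof.
move=> [b1 b2]; have [-> -> s3 s4] := two_sigma h.
rewrite (funext s3) (funext s4) defect_sigma0 // => j.
rewrite /two_psi /two_P /two_Q muln0 expr0 scale0r addr0.
have /eqP := b2 j; rewrite addr_eq0 => /eqP ->; lmod.
Qed.

Lemma two_vanish (H : (int -> int -> V) -> Prop) :
  (forall h, H h -> H (sigmaL h)) -> (forall h, H h -> two_base h) ->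
  forall p h i, H h -> defect (fam x y h) (two_psi h) (two_P h) (two_Q h) p i = 0.
Proof.
apply: (@defect_vanish _ _ sigmaL _ _ _ _ _ _ _ _ two_base 1 (oner_neq0 _)).
- by move=> h; have [] := two_sigma h.
- by move=> h; have [] := two_sigma h.
- by move=> h; have [] := two_sigma h.
- by move=> h; have [] := two_sigma h.
- exact: two_compatible.
- exact: two_defect0.
- by move=> h i hb; rewrite two_sigma0 ?scale1r.
Qed.

Lemma two_sigma_vanish h : two_base h ->
  (forall p i, defect (fam x y h) (two_psi h) (two_P h) (two_Q h) p i = 0) ->
  forall p i, defect (fam x y (sigmaL h)) (two_psi (sigmaL h)) (two_P (sigmaL h))
     (two_Q (sigmaL h)) p i = 0.
Proof.
apply: (@defect_sigma_vanish _ _ sigmaL _ _ _ _ _ _ _ _ two_base 1).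
- by move=> g; have [] := two_sigma g.
- by move=> g; have [] := two_sigma g.
- by move=> g; have [] := two_sigma g.
- by move=> g; have [] := two_sigma g.
- exact: two_compatible.
- by move=> g i hb; rewrite two_sigma0 ?scale1r.
Qed.

End TwoTerm.

Section OneTerm.
Variable x : int.

Definition one_base h := forall j, fam x x h j j = 0.

Let zeroQ (_ : int -> int -> V) (_ : nat) (_ _ : int) : V := 0.

Lemma one_defectE h p i : defect (fam x x h) (fam x x h) (zeroQ h) (zeroQ h) p i =
  fam x x h i (i + p%:Z) + fam x x h (i + p%:Z) i.
Proof. by rewrite /defect /tower !big1 // subr0 addr0. Qed.

Let zero_sigma m h : zeroQ (sigmaL h) m = sigma2 (zeroQ h m).
Proof. by apply/funext => i; apply/funext => j; rewrite /sigma2 addr0. Qed.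

Let one_compatible h : one_base h -> defect_compatible zeroQ zeroQ h.
Proof. by split=> *; rewrite addr0. Qed.

(** Here phi and psi coincide, so the shift yields the same defect twice; this is the origin of the
    constant 2. *)
Let one_sigma0 h i : defect (fam x x (sigmaL h)) (fam x x (sigmaL h))
   (zeroQ (sigmaL h)) (zeroQ (sigmaL h)) 0 i
  = 2 *: defect (fam x x h) (fam x x h) (zeroQ h) (zeroQ h) 1 (i - 1).
Proof.
rewrite !one_defectE !fam_sigma /sigma2 !addr0 subrK scaler_nat mulr2n.
by [].
Qed.

Lemma one_vanish (H : (int -> int -> V) -> Prop) :
  (forall h, H h -> H (sigmaL h)) -> (forall h, H h -> one_base h) ->
  forall p h i, H h -> fam x x h i (i + p%:Z) + fam x x h (i + p%:Z) i = 0.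
Proof.
move=> Hs Hb p h i Hh; rewrite -one_defectE; move: p h i Hh.
apply: (@defect_vanish _ _ sigmaL _ _ _ _ _ _ _ _ one_base 2) => //.
- by move=> h; exact: fam_sigma.
- by move=> h; exact: fam_sigma.
- by rewrite -(rmorph_nat (eval_at q)) eval_at_q_eq0 -polyC_natr polyC_eq0.
- by move=> h i hb; rewrite one_defectE addr0 hb addr0.
Qed.

Lemma one_sigma_vanish h : one_base h ->
  (forall p i, fam x x h i (i + p%:Z) + fam x x h (i + p%:Z) i = 0) ->
  forall p i, fam x x (sigmaL h) i (i + p%:Z) + fam x x (sigmaL h) (i + p%:Z) i = 0.
Proof.
move=> hb h0 p i; rewrite -one_defectE; move: p i.
apply: (@defect_sigma_vanish _ _ sigmaL _ _ _ _ _ _ _ _ one_base 2) => //.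
- by move=> g; exact: fam_sigma.
- by move=> g; exact: fam_sigma.
- by move=> p i; rewrite one_defectE.
Qed.

End OneTerm.

Section FourTerm.
Variables (x y w v : int).

(** Think of y = x + alpha, w = x + beta, v = x + alpha + beta, the corners of a rectangle of
    residues. A is the rule for the pairs (x, v), B the rule for (y, w). Each contains monomials of
    the other, so the boundary terms cancel only by the short rules of both. *)
Definition fourA_P h (m : nat) i j :=
  kap *: (fodd m *: fam y w h i j + feven m.+1 *: fam x v h i j).
Definition fourA_Q h (m : nat) i j :=
  kap *: (fodd m *: fam w y h i j + feven m *: fam v x h i j).
Definition fourB_P h (m : nat) i j :=
  kap *: (fodd m *: fam x v h i j + feven m *: fam y w h i j).
Definition fourB_Q h (m : nat) i j :=
  kap *: ((if m is m'.+1 then fodd m' else 0) *: fam v x h i j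
          + feven m *: fam w y h i j).

(** For each of the pairs x, v and y, w: the short rule inside a period and the one that wraps
    around, one of them of type A and the other of type B. *)
Definition four_base h :=
  [/\ forall j, fam x v h j j = - fam v x h j j - kap *: fam w y h j j,
      forall j, fam v x h (j - 1) j = - fam x v h j (j - 1),
      forall j, fam y w h j j = - fam w y h j j &
      forall j, fam w y h (j - 1) j =
        - fam y w h j (j - 1) - kap *: fam x v h j (j - 1)].

Local Notation DA h := (defect (fam x v h) (fam v x h) (fourA_P h) (fourA_Q h)).
Local Notation DB h := (defect (fam y w h) (fam w y h) (fourB_P h) (fourB_Q h)).

Let four_sigma h : [/\ forall m, fourA_P (sigmaL h) m = sigma2 (fourA_P h m),
  forall m, fourA_Q (sigmaL h) m = sigma2 (fourA_Q h m),
  forall m, fourB_P (sigmaL h) m = sigma2 (fourB_P h m) &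
  forall m, fourB_Q (sigmaL h) m = sigma2 (fourB_Q h m)].
Proof.
by split=> m; apply/funext => i; apply/funext => j;
  rewrite /fourA_P /fourA_Q /fourB_P /fourB_Q !fam_sigma /sigma2; lmod.
Qed.

Lemma fourA_compatible h : four_base h -> defect_compatible fourA_P fourA_Q h.
Proof.
move=> [b1 b2 b3 b4]; split=> k j; rewrite /fourA_P /fourA_Q.
  by rewrite b2 b4 (feven_step k.+1); lmod.
by rewrite b3 b1 fodd_step; lmod.
Qed.

Lemma fourB_compatible h : four_base h -> defect_compatible fourB_P fourB_Q h.
Proof.
move=> [b1 b2 b3 b4]; split=> k j; rewrite /fourB_P /fourB_Q.
  by rewrite b2 b4 fodd_step; lmod.
by rewrite b3 b1 feven_step; lmod.
Qed.

Lemma fourA_defect0 h i : four_base h -> DA h 0 i = 0.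
Proof.
move=> [b1 b2 b3 b4]; rewrite /defect /= towerS /tower !big_nil /fourA_Q.
by rewrite fodd0 feven0 !addr0 b1; lmod.
Qed.

Lemma fourB_defect0 h i : four_base h -> DB h 0 i = 0.
Proof.
move=> [b1 b2 b3 b4]; rewrite /defect /= towerS /tower !big_nil /fourB_Q.
by rewrite feven0 !addr0 b3; lmod.
Qed.

Lemma fourA_sigma0 h i : four_base h -> DA (sigmaL h) 0 i = 1 *: DA h 1 (i - 1).
Proof.
move=> [b1 b2 b3 b4]; have [s1 s2 s3 s4] := four_sigma h.
rewrite !fam_sigma (funext s1) (funext s2) scale1r; apply: defect_sigma0 => j.
by rewrite /fourA_P /fourA_Q b2 b4 fodd0 feven_step feven0 fodd0; lmod.
Qed.

Lemma fourB_sigma0 h i : four_base h -> DB (sigmaL h) 0 i = 1 *: DB h 1 (i - 1).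
Proof.
move=> [b1 b2 b3 b4]; have [s1 s2 s3 s4] := four_sigma h.
rewrite !fam_sigma (funext s3) (funext s4) scale1r; apply: defect_sigma0 => j.
by rewrite /fourB_P /fourB_Q b4 fodd0 feven0; lmod.
Qed.

Lemma four_vanish (H : (int -> int -> V) -> Prop) :
  (forall h, H h -> H (sigmaL h)) -> (forall h, H h -> four_base h) ->
  forall p h i, H h -> DA h p i = 0 /\ DB h p i = 0.
Proof.
move=> Hs Hb p h i Hh; have [s1 s2 s3 s4] := four_sigma h; split; move: p h i Hh {s1 s2 s3 s4}.
  apply: (@defect_vanish _ _ sigmaL _ _ _ _ _ _ _ _ four_base 1 (oner_neq0 _)) => //.
  - by move=> h; exact: fam_sigma.
  - by move=> h; exact: fam_sigma.
  - by move=> h; have [] := four_sigma h.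
  - by move=> h; have [] := four_sigma h.
  - exact: fourA_compatible.
  - exact: fourA_defect0.
  - exact: fourA_sigma0.
apply: (@defect_vanish _ _ sigmaL _ _ _ _ _ _ _ _ four_base 1 (oner_neq0 _)) => //.
- by move=> h; exact: fam_sigma.
- by move=> h; exact: fam_sigma.
- by move=> h; have [] := four_sigma h.
- by move=> h; have [] := four_sigma h.
- exact: fourB_compatible.
- exact: fourB_defect0.
- exact: fourB_sigma0.
Qed.

Lemma fourA_sigma_vanish h : four_base h -> (forall p i, DA h p i = 0) ->
  forall p i, DA (sigmaL h) p i = 0.
Proof.
apply: (@defect_sigma_vanish _ _ sigmaL _ _ _ _ _ _ _ _ four_base 1).
- by move=> g; exact: fam_sigma.
- by move=> g; exact: fam_sigma.
- by move=> g; have [] := four_sigma g.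
- by move=> g; have [] := four_sigma g.
- exact: fourA_compatible.
- exact: fourA_sigma0.
Qed.

Lemma fourB_sigma_vanish h : four_base h -> (forall p i, DB h p i = 0) ->
  forall p i, DB (sigmaL h) p i = 0.
Proof.
apply: (@defect_sigma_vanish _ _ sigmaL _ _ _ _ _ _ _ _ four_base 1).
- by move=> g; exact: fam_sigma.
- by move=> g; exact: fam_sigma.
- by move=> g; have [] := four_sigma g.
- by move=> g; have [] := four_sigma g.
- exact: fourB_compatible.
- exact: fourB_sigma0.
Qed.

End FourTerm.

End Systems.

Lemma half_cases (p : nat) : exists k : nat,
  (p%:Z = 2 * k%:Z /\ uphalf p = k /\ p./2 = k) \/
  (p%:Z = 2 * k%:Z + 1 /\ uphalf p = k.+1 /\ p./2 = k).
Proof.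
exists p./2; rewrite uphalf_half; have := odd_double_half p.
by case: (odd p) => h; [right|left]; split=> //; lia.
Qed.

(** * Matching the sums in the rules with towers *)

Section Links.
Variables (n l : nat).
Hypotheses (n0 : (0 < n)%N) (l0 : (0 < l)%N).
Variable V : lmodType Qq.
Local Notation L := (n * l)%:Z.
Local Notation alpha := (alpha n l).
Local Notation beta := (beta n l).
Local Notation kap := (q - q^-1).
Implicit Types h : int -> int -> V.
Local Notation osum := (ordered_sum n l).
Local Notation fam := (fam n l).

Let L0 : 0 < L. Proof. by rewrite ltz_nat muln_gt0 n0 l0. Qed.

(** The ordering condition reads 2 nl m < k2 - k1 - 2e, so it selects an initial segment. M is the
    end of that segment, and e >= - nl keeps it within the bound built into [ordered_sum]. *)
Lemma ordered_sum_trunc h k1 k2 (m0 : nat) e f (M : nat) :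
  - L <= e -> k2 - k1 - 2 * e <= 2 * (L * M%:Z) ->
  (M = 0%N) \/ (2 * (L * (M%:Z - 1)) < k2 - k1 - 2 * e) ->
  osum h k1 k2 m0 e f =
  \sum_(m0 <= m < M) f m *: h (k2 - e - L * m%:Z) (k1 + e + L * m%:Z).
Proof.
move=> eL hM1 hM2; rewrite /ordered_sum.
have MN : (M <= `|k2 - k1|.+2)%N.
  case: hM2 => [->//|hM2]; rewrite leqNgt; apply/negP => hh.
  have : L * (1 + `|k2 - k1|%:Z) <= L * (M%:Z - 2) by rewrite ler_wpM2l; lia.
  by nia.
rewrite (big_nat_widen _ _ _ _ _ MN); apply: eq_big => [m|m _].
  apply/idP/idP => hm; last first.
    case: hM2 => [M0|hM2]; first by rewrite M0 in hm.
    have : L * m%:Z <= L * (M%:Z - 1) by rewrite ler_wpM2l; lia.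
    by rewrite PoszM; lia.
  rewrite /= ltnNge; apply/negP => Mm.
  have : L * M%:Z <= L * m%:Z by rewrite ler_wpM2l; lia.
  by move: hm; rewrite PoszM; lia.
by rewrite PoszM.
Qed.


Lemma two_term_link (t : Qq) (gam k1 k2 : int) (p : nat) h f1 f2 :
  0 < gam < L -> (forall m, f1 m = t ^+ (2 * m)) ->
  (forall m, f2 m.+1 = t ^+ (2 * m).+1) -> k2 = k1 + gam + L * p%:Z ->
  (t ^+ 2 - 1) *: (osum h k1 k2 0 gam f1 - osum h k1 k2 1 0 f2) =
  tower (two_P n l t k1 (k1 + gam) h) (uphalf p) p%:Z 0
  - tower (two_Q n l t k1 (k1 + gam) h) p./2.+1 p%:Z 0.
Proof.
move=> /andP[g0 gL] f1E f2E k2E.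
have [k hk] := half_cases p.
(* Here k2 - k1 - 2 gam = nl p - gam, which leaves uphalf p ordered terms; the other sum, starting
   at m = 1, has p./2 of them. *)
rewrite (@ordered_sum_trunc _ _ _ _ _ _ (uphalf p)); first last.
- by case: hk => -[pk [-> hp]]; [case: k pk {hp} => [|k] pk; [left|right]|right]; rewrite // k2E pk; nia.
- by case: hk => -[pk [-> hp]]; rewrite k2E pk; nia.
- by lia.
rewrite (@ordered_sum_trunc _ _ _ _ _ _ p./2.+1); first last.
- by right; case: hk => -[pk [_ ->]]; rewrite k2E pk; nia.
- by case: hk => -[pk [_ ->]]; rewrite k2E pk; nia.
- by lia.
rewrite scalerBr {hk}; congr (_ - _).
  rewrite scaler_sumr; apply: eq_bigr => m _; rewrite scalerA f1E /two_P /fam.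
  by congr (_ *: h _ _); rewrite ?k2E; ring.
rewrite /tower [RHS]big_nat_recl // {1}/two_Q scale0r add0r big_add1 /= scaler_sumr.
apply: eq_bigr => m _; rewrite scalerA f2E /two_Q /fam.
by congr (_ *: h _ _); rewrite ?k2E -?natr1; lia.
Qed.

Lemma fourA_link (al be k1 k2 : int) (p : nat) h :
  0 < al -> al < be -> al + be < L -> k2 = k1 + al + be + L * p%:Z ->
  kap *: osum h k1 k2 0 be fodd - kap *: osum h k1 k2 0 al fodd
  + kap *: osum h k1 k2 1 (al + be - L) feven - kap *: osum h k1 k2 1 0 feven =
  tower (fourA_P n l k1 (k1 + al) (k1 + be) (k1 + al + be) h) (uphalf p) p%:Z 0
  - tower (fourA_Q n l k1 (k1 + al) (k1 + be) (k1 + al + be) h) p./2.+1 p%:Z 0.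
Proof.
move=> a0 ab abL k2E; have [k hk] := half_cases p.
rewrite (@ordered_sum_trunc _ _ _ _ be _ (uphalf p)); first last.
- by case: hk => -[pk [-> hp]]; [case: k pk {hp} => [|k] pk; [left|right]|right]; rewrite // k2E pk; nia.
- by case: hk => -[pk [-> hp]]; rewrite k2E pk; nia.
- by lia.
rewrite (@ordered_sum_trunc _ _ _ _ al _ p./2.+1); first last.
- by right; case: hk => -[pk [_ ->]]; rewrite k2E pk; nia.
- by case: hk => -[pk [_ ->]]; rewrite k2E pk; nia.
- by lia.
rewrite (@ordered_sum_trunc _ _ _ _ (al + be - L) _ (uphalf p).+1); first last.
- by right; case: hk => -[pk [-> _]]; rewrite k2E pk; nia.
- by case: hk => -[pk [-> _]]; rewrite k2E pk; nia.
- by lia.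
rewrite (@ordered_sum_trunc _ _ _ _ 0 _ p./2.+1); first last.
- by right; case: hk => -[pk [_ ->]]; rewrite k2E pk; nia.
- by case: hk => -[pk [_ ->]]; rewrite k2E pk; nia.
- by lia.
have e0 (F : nat -> V) M : \sum_(1 <= m < M.+1) feven m *: F m =
    \sum_(0 <= m < M.+1) feven m *: F m.
  by rewrite [RHS]big_nat_recl // feven0 scale0r add0r big_add1.
rewrite (e0 (fun m => h (k2 - 0 - L * m%:Z) (k1 + 0 + L * m%:Z))) big_add1 /=.
rewrite addrAC -!addrA [- _ + (- _ + _)]addrA [_ + (kap *: _)]addrC !addrA -scalerDr.
rewrite -addrA -opprD -scalerDr -!big_split !scaler_sumr.
congr (_ - _); apply: eq_bigr => m _ /=.
  rewrite /fourA_P /fam; congr (_ *: (_ *: h _ _ + _ *: h _ _)); rewrite ?k2E; lia.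
rewrite /fourA_Q /fam; congr (_ *: (_ *: h _ _ + _ *: h _ _)); rewrite ?k2E; lia.
Qed.

Lemma fourB_link (al be k1 k2 : int) (p : nat) h :
  0 < be -> be < al -> al < L -> L < al + be -> k2 = k1 + al + be - L + L * p%:Z ->
  kap *: osum h k1 k2 0 be fodd - kap *: osum h k1 k2 0 al fodd
  + kap *: osum h k1 k2 1 (al + be - L) feven - kap *: osum h k1 k2 1 0 feven =
  tower (fourB_P n l (k1 + al - L) k1 (k1 + al + be - L) (k1 + be) h) (uphalf p) p%:Z 0
  - tower (fourB_Q n l (k1 + al - L) k1 (k1 + al + be - L) (k1 + be) h) p./2.+1 p%:Z 0.
Proof.
move=> b0 ba aL abL k2E; have [k hk] := half_cases p.
rewrite (@ordered_sum_trunc _ _ _ _ be _ (uphalf p)); first last.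
- by case: hk => -[pk [-> hp]]; [case: k pk {hp} => [|k] pk; [left|right]|right]; rewrite // k2E pk; nia.
- by case: hk => -[pk [-> hp]]; rewrite k2E pk; nia.
- by lia.
rewrite (@ordered_sum_trunc _ _ _ _ al _ p./2); first last.
- by case: hk => -[pk [_ ->]]; case: k pk => [|k] pk; [left|right|left|right]; rewrite // k2E pk; nia.
- by case: hk => -[pk [_ ->]]; rewrite k2E pk; nia.
- by lia.
rewrite (@ordered_sum_trunc _ _ _ _ (al + be - L) _ (uphalf p)); first last.
- by case: hk => -[pk [-> hp]]; [case: k pk {hp} => [|k] pk; [left|right]|right]; rewrite // k2E pk; nia.
- by case: hk => -[pk [-> _]]; rewrite k2E pk; nia.
- by lia.
rewrite (@ordered_sum_trunc _ _ _ _ 0 _ p./2.+1); first last.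
- by right; case: hk => -[pk [_ ->]]; rewrite k2E pk; nia.
- by case: hk => -[pk [_ ->]]; rewrite k2E pk; nia.
- by lia.
have e0 (F : nat -> V) M : \sum_(1 <= m < M) feven m *: F m =
    \sum_(0 <= m < M) feven m *: F m.
  case: M => [|M]; first by rewrite !big_nil.
  by rewrite [RHS]big_nat_recl // feven0 scale0r add0r big_add1.
rewrite (e0 (fun m => h (k2 - 0 - L * m%:Z) (k1 + 0 + L * m%:Z))).
rewrite (e0 (fun m => h (k2 - (al + be - L) - L * m%:Z) (k1 + (al + be - L) + L * m%:Z))).
(* The alpha sum is one term shorter than the tower of [fourB_Q]; a zero term in front aligns the
   indices. *)
have -> : \sum_(0 <= m < p./2) fodd m *: h (k2 - al - L * m%:Z) (k1 + al + L * m%:Z) =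
    \sum_(0 <= m < p./2.+1) (if m is m'.+1 then fodd m' else 0) *:
       fam (k1 + be) (k1 + al - L) h (0 + p%:Z - m%:Z) (0 + m%:Z).
  rewrite big_nat_recl // scale0r add0r; apply: eq_bigr => m _; rewrite /fam.
  by congr (_ *: h _ _); rewrite ?k2E; lia.
rewrite addrAC -!addrA [- _ + (- _ + _)]addrA [_ + (kap *: _)]addrC !addrA -scalerDr.
rewrite -addrA -opprD -scalerDr -!big_split !scaler_sumr.
congr (_ - _); apply: eq_bigr => m _ /=.
  rewrite /fourB_P /fam; congr (_ *: (_ *: h _ _ + _ *: h _ _)); rewrite ?k2E; lia.
rewrite /fourB_Q; congr (_ *: (_ + _ *: _)).
by rewrite /fam; congr (h _ _); rewrite ?k2E; lia.
Qed.

End Links.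

(** * From pairs at distance below nl to all pairs *)

Section Alternating.
Variables (n l : nat).
Hypotheses (n0 : (0 < n)%N) (l0 : (0 < l)%N).
Local Notation L := (n * l)%:Z.
Local Notation alpha := (alpha n l).
Local Notation beta := (beta n l).
Local Notation kap := (q - q^-1).

Section Fixed.
Variable V : lmodType Qq.
Implicit Types h : int -> int -> V.
Local Notation fam := (fam n l).
Local Notation sigmaL := (@sigmaL n l V).

Definition straightens h k1 k2 : Prop := h k1 k2 = straighten n l h k1 k2.
Definition alternating h : Prop := forall k1 k2, k1 <= k2 -> straightens h k1 k2.
Definition base_alternating h : Prop :=
  forall k1 k2, k1 <= k2 < k1 + L -> straightens h k1 k2.

Let L0 : 0 < L. Proof. by rewrite ltz_nat muln_gt0 n0 l0. Qed.


(** Here p counts the full periods between the letters. When alpha + beta > nl, one period is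
    already contained in alpha + beta, hence the - nl of the last case. *)
Variant pair_spec k1 k2 : Prop :=
| PairOne p of alpha k1 k2 = 0 & beta k1 k2 = 0 & k2 = k1 + L * p%:Z
| PairAlpha p of 0 < alpha k1 k2 < L & beta k1 k2 = 0 &
    k2 = k1 + alpha k1 k2 + L * p%:Z
| PairBeta p of alpha k1 k2 = 0 & 0 < beta k1 k2 < L &
    k2 = k1 + beta k1 k2 + L * p%:Z
| PairA p of [/\ 0 < alpha k1 k2, alpha k1 k2 < beta k1 k2 &
    alpha k1 k2 + beta k1 k2 < L] &
    k2 = k1 + alpha k1 k2 + beta k1 k2 + L * p%:Z
| PairB p of [/\ 0 < beta k1 k2, beta k1 k2 < alpha k1 k2, alpha k1 k2 < L &
    L < alpha k1 k2 + beta k1 k2] &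
    k2 = k1 + alpha k1 k2 + beta k1 k2 - L + L * p%:Z.

Lemma pairP k1 k2 : k1 <= k2 -> pair_spec k1 k2.
Proof.
have [j jE] := diffE n0 l0 k1 k2 => k12.
have /andP[a0 aL] := alpha_itv n0 l0 k1 k2.
have /andP[b0 bL] := beta_itv n0 l0 k1 k2.
have jp : - L < L * j -> 0 <= L * j /\ exists p : nat, j = p%:Z.
  move=> h; have j1 : -1 < j.
    by rewrite ltNge; apply/negP => j1; have : L * j <= L * (-1) by [rewrite ler_wpM2l]; lia.
  by case: j h jE j1 => // p _ _ _; split=> //; exists p.
have jp' : - (2 * L) < L * j -> exists p : nat, j = p%:Z - 1.
  move=> h; have j1 : -2 < j.
    by rewrite ltNge; apply/negP => j1; have : L * j <= L * (-2) by [rewrite ler_wpM2l]; lia.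
  by exists (absz (j + 1)); lia.
case: (eqVneq (alpha k1 k2) 0) => [az|an]; case: (eqVneq (beta k1 k2) 0) => [bz|bn].
- have [|_ [p pE]] := jp; first by lia.
  by apply: (PairOne (p := p)) => //; rewrite {1}jE az bz pE; ring.
- have [|_ [p pE]] := jp; first by lia.
  by apply: (PairBeta (p := p)) => //; [lia|rewrite {1}jE az pE; ring].
- have [|_ [p pE]] := jp; first by lia.
  by apply: (PairAlpha (p := p)) => //; [lia|rewrite {1}jE bz pE; ring].
have [[h1 h2]|[h1 h2]] := alpha_beta n0 l0 an bn.
  have [|_ [p pE]] := jp; first by lia.
  by apply: (PairA (p := p)); [split=> //; lia|rewrite {1}jE pE].
have [|p pE] := jp'; first by lia.
apply: (PairB (p := p)); first by split=> //; lia.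
by rewrite {1}jE pE; ring.
Qed.

Lemma straightens_one k1 k2 h (p : nat) : alpha k1 k2 = 0 -> beta k1 k2 = 0 ->
  k2 = k1 + L * p%:Z ->
  straightens h k1 k2 <-> fam k1 k1 h 0 (0 + p%:Z) + fam k1 k1 h (0 + p%:Z) 0 = 0.
Proof.
move=> az bz k2E; rewrite /straightens /straighten -/(alpha k1 k2) -/(beta k1 k2).
rewrite az bz eqxx /fam mulr0 addr0 add0r -k2E.
by split=> [->|/eqP]; rewrite ?addNr // addr_eq0 => /eqP.
Qed.

Lemma straightens_alpha k1 k2 h (p : nat) : 0 < alpha k1 k2 < L -> beta k1 k2 = 0 ->
  k2 = k1 + alpha k1 k2 + L * p%:Z ->
  let y := k1 + alpha k1 k2 in
  straightens h k1 k2 <-> defect (fam k1 y h) (two_psi n l q^-1 k1 y h)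
    (two_P n l q^-1 k1 y h) (two_Q n l q^-1 k1 y h) p 0 = 0.
Proof.
move=> az bz k2E y; rewrite /straightens /straighten -/(alpha k1 k2) -/(beta k1 k2).
have -> : (alpha k1 k2 == 0) = false by lia.
rewrite bz eqxx -exprVn (two_term_link n0 l0 (t := q^-1) (gam := alpha k1 k2) (p := p)) //.
- rewrite /defect -/y {1}/fam /two_psi {1}/fam mulr0 !addr0 add0r -k2E.
  have e0 : fam y k1 h p 0 = h k2 k1 by rewrite /fam mulr0 addr0 -k2E.
  rewrite ?e0; set A := tower _ _ _ _; set B := tower _ _ _ _.
  have -> : h k1 k2 + q^-1 *: h k2 k1 - A + B =
    h k1 k2 - (- q^-1 *: h k2 k1 + (A - B)) by lmod.
  by split=> [->|/eqP]; rewrite ?subrr // subr_eq0 => /eqP.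
- by move=> m; rewrite exprVn.
- move=> m; have -> : 1 - 2 * m.+1%:Z = - (2 * m).+1%:Z by lia.
  by rewrite -exprnN exprVn.
Qed.

Lemma straightens_beta k1 k2 h (p : nat) : alpha k1 k2 = 0 -> 0 < beta k1 k2 < L ->
  k2 = k1 + beta k1 k2 + L * p%:Z ->
  let y := k1 + beta k1 k2 in
  straightens h k1 k2 <-> defect (fam k1 y h) (two_psi n l q k1 y h)
    (two_P n l q k1 y h) (two_Q n l q k1 y h) p 0 = 0.
Proof.
move=> az bz k2E y; rewrite /straightens /straighten -/(alpha k1 k2) -/(beta k1 k2).
have -> : (beta k1 k2 == 0) = false by lia.
rewrite az eqxx (two_term_link n0 l0 (t := q) (gam := beta k1 k2) (p := p)) //.
- rewrite /defect -/y {1}/fam /two_psi {1}/fam mulr0 !addr0 add0r -k2E.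
  have e0 : fam y k1 h p 0 = h k2 k1 by rewrite /fam mulr0 addr0 -k2E.
  rewrite ?e0; set A := tower _ _ _ _; set B := tower _ _ _ _.
  have -> : h k1 k2 + q *: h k2 k1 - A + B =
    h k1 k2 - (- q *: h k2 k1 + (A - B)) by lmod.
  by split=> [->|/eqP]; rewrite ?subrr // subr_eq0 => /eqP.
- by move=> m; have -> : 2 * m.+1%:Z - 1 = (2 * m).+1%:Z by lia.
Qed.

Lemma straightens_A k1 k2 h (p : nat) :
  [/\ 0 < alpha k1 k2, alpha k1 k2 < beta k1 k2 & alpha k1 k2 + beta k1 k2 < L] ->
  k2 = k1 + alpha k1 k2 + beta k1 k2 + L * p%:Z ->
  let y := k1 + alpha k1 k2 in let w := k1 + beta k1 k2 in
  let v := k1 + alpha k1 k2 + beta k1 k2 in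
  straightens h k1 k2 <-> defect (fam k1 v h) (fam v k1 h)
    (fourA_P n l k1 y w v h) (fourA_Q n l k1 y w v h) p 0 = 0.
Proof.
move=> [a0 ab abL] k2E y w v.
rewrite /straightens /straighten -/(alpha k1 k2) -/(beta k1 k2).
have -> : (beta k1 k2 == 0) = false by lia.
have -> : (alpha k1 k2 == 0) = false by lia.
have := fourA_link n0 l0 h a0 ab abL k2E; rewrite -/y -/w -/v => /esym hE.
rewrite /defect {1}/fam {1}/fam mulr0 !addr0 add0r -k2E.
have e0 : fam v k1 h p 0 = h k2 k1 by rewrite /fam mulr0 addr0 -k2E.
rewrite ?e0; move: hE; rewrite -/fodd -/feven.
set A := tower _ _ _ _; set B := tower _ _ _ _ => hE.
have -> : h k1 k2 + h k2 k1 - A + B = h k1 k2 - (- h k2 k1 + (A - B)) by lmod.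
rewrite hE; split=> [->|/eqP]; first by apply/eqP; rewrite subr_eq0 !addrA.
by rewrite subr_eq0 !addrA => /eqP.
Qed.

Lemma straightens_B k1 k2 h (p : nat) :
  [/\ 0 < beta k1 k2, beta k1 k2 < alpha k1 k2, alpha k1 k2 < L &
      L < alpha k1 k2 + beta k1 k2] ->
  k2 = k1 + alpha k1 k2 + beta k1 k2 - L + L * p%:Z ->
  let x := k1 + alpha k1 k2 - L in let v := k1 + beta k1 k2 in
  let w := k1 + alpha k1 k2 + beta k1 k2 - L in
  straightens h k1 k2 <-> defect (fam k1 w h) (fam w k1 h)
    (fourB_P n l x k1 w v h) (fourB_Q n l x k1 w v h) p 0 = 0.
Proof.
move=> [b0 ba aL abL] k2E x v w.
rewrite /straightens /straighten -/(alpha k1 k2) -/(beta k1 k2).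
have -> : (beta k1 k2 == 0) = false by lia.
have -> : (alpha k1 k2 == 0) = false by lia.
have := fourB_link n0 l0 h b0 ba aL abL k2E; rewrite -/x -/w -/v => /esym hE.
rewrite /defect {1}/fam {1}/fam mulr0 !addr0 add0r -k2E.
have e0 : fam w k1 h p 0 = h k2 k1 by rewrite /fam mulr0 addr0 -k2E.
rewrite ?e0; move: hE; rewrite -/fodd -/feven.
set A := tower _ _ _ _; set B := tower _ _ _ _ => hE.
have -> : h k1 k2 + h k2 k1 - A + B = h k1 k2 - (- h k2 k1 + (A - B)) by lmod.
rewrite hE; split=> [->|/eqP]; first by apply/eqP; rewrite subr_eq0 !addrA.
by rewrite subr_eq0 !addrA => /eqP.
Qed.

Lemma alpha_shift k1 k2 i j : alpha (k1 + L * i) (k2 + L * j) = alpha k1 k2.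
Proof. by apply: alpha_res; rewrite ares_shift. Qed.

Lemma beta_shift k1 k2 i j : beta (k1 + L * i) (k2 + L * j) = beta k1 k2.
Proof. by apply: beta_res; rewrite bres_shift. Qed.

Lemma res_alpha_beta k1 k2 : ares n (k1 + alpha k1 k2 + beta k1 k2) = ares n k2 /\
  bres n l (k1 + alpha k1 k2 + beta k1 k2) = bres n l k2.
Proof.
have [j jE] := diffE n0 l0 k1 k2.
have -> : k1 + alpha k1 k2 + beta k1 k2 = k2 + L * (- j) by rewrite [in RHS]jE; ring.
by rewrite ares_shift // bres_shift.
Qed.

Lemma straightens_alpha0 h k1 k2 : 0 < alpha k1 k2 < L -> beta k1 k2 = 0 ->
  k2 = k1 + alpha k1 k2 ->
  straightens h k1 k2 <-> h k1 k2 = - (q^-1 *: h k2 k1).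
Proof.
move=> az bz k2E; have := @straightens_alpha k1 k2 h 0 az bz.
rewrite mulr0 addr0 => /(_ k2E) ->; rewrite -k2E.
rewrite /defect /= towerS /tower !big_nil /two_psi /two_Q scale0r /fam.
rewrite !mulr0 !addr0 subr0.
by split=> [/eqP|->]; rewrite ?addNr // addr_eq0 => /eqP.
Qed.

Lemma straightens_beta0 h k1 k2 : alpha k1 k2 = 0 -> 0 < beta k1 k2 < L ->
  k2 = k1 + beta k1 k2 ->
  straightens h k1 k2 <-> h k1 k2 = - (q *: h k2 k1).
Proof.
move=> az bz k2E; have := @straightens_beta k1 k2 h 0 az bz.
rewrite mulr0 addr0 => /(_ k2E) ->; rewrite -k2E.
rewrite /defect /= towerS /tower !big_nil /two_psi /two_Q scale0r /fam.
rewrite !mulr0 !addr0 subr0.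
by split=> [/eqP|->]; rewrite ?addNr // addr_eq0 => /eqP.
Qed.

Lemma straightens_A0 h k1 k2 :
  [/\ 0 < alpha k1 k2, alpha k1 k2 < beta k1 k2 & alpha k1 k2 + beta k1 k2 < L] ->
  k2 = k1 + alpha k1 k2 + beta k1 k2 ->
  straightens h k1 k2 <->
  h k1 k2 = - h k2 k1 - kap *: h (k1 + beta k1 k2) (k1 + alpha k1 k2).
Proof.
move=> az k2E; have := @straightens_A k1 k2 h 0 az.
rewrite mulr0 addr0 => /(_ k2E) ->; rewrite -k2E.
rewrite /defect /= towerS /tower !big_nil /fourA_Q fodd0 feven0 /fam.
rewrite !mulr0 !addr0 subr0 add0r scale1r scale0r addr0 -opprD.
split=> [/eqP|->]; first by rewrite -addrA addr_eq0 => /eqP.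
by rewrite -addrA addNr.
Qed.

Lemma straightens_B0 h k1 k2 :
  [/\ 0 < beta k1 k2, beta k1 k2 < alpha k1 k2, alpha k1 k2 < L &
      L < alpha k1 k2 + beta k1 k2] ->
  k2 = k1 + alpha k1 k2 + beta k1 k2 - L ->
  straightens h k1 k2 <-> h k1 k2 = - h k2 k1.
Proof.
move=> az k2E; have := @straightens_B k1 k2 h 0 az.
rewrite mulr0 addr0 => /(_ k2E) ->; rewrite -k2E.
rewrite /defect /= towerS /tower !big_nil /fourB_Q feven0 /fam.
rewrite !mulr0 !addr0 subr0 add0r !scale0r addr0 scaler0 addr0.
by split=> [/eqP|->]; rewrite ?addNr // addr_eq0 => /eqP.
Qed.

Lemma straightens_same h k : straightens h k k <-> h k k = 0.
Proof.
have az : alpha k k = 0 by rewrite /(alpha _ _) subrr mod0z.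
have bz : beta k k = 0 by rewrite /(beta _ _) subrr mulr0 mod0z.
have kE : k = k + L * 0%N%:Z by rewrite mulr0 addr0.
rewrite (straightens_one h az bz kE) /fam !addr0 mulr0 addr0.
split=> [|->]; last by rewrite addr0.
rewrite -mulr2n -scaler_nat => /eqP; rewrite scaler_eq0 => /orP[|/eqP //].
by rewrite -(rmorph_nat (eval_at q)) eval_at_q_eq0 -polyC_natr polyC_eq0.
Qed.

Lemma base_alpha h k1 k2 : base_alternating h -> 0 < alpha k1 k2 < L ->
  beta k1 k2 = 0 -> k2 = k1 + alpha k1 k2 -> h k1 k2 + q^-1 *: h k2 k1 = 0.
Proof.
move=> hb az bz k2E; have h12 : straightens h k1 k2 by apply: hb; lia.
by rewrite ((straightens_alpha0 h az bz k2E).1 h12) addNr.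
Qed.

Lemma base_beta h k1 k2 : base_alternating h -> alpha k1 k2 = 0 ->
  0 < beta k1 k2 < L -> k2 = k1 + beta k1 k2 -> h k1 k2 + q *: h k2 k1 = 0.
Proof.
move=> hb az bz k2E; have h12 : straightens h k1 k2 by apply: hb; lia.
by rewrite ((straightens_beta0 h az bz k2E).1 h12) addNr.
Qed.

Lemma base_A h k1 k2 : base_alternating h ->
  [/\ 0 < alpha k1 k2, alpha k1 k2 < beta k1 k2 & alpha k1 k2 + beta k1 k2 < L] ->
  k2 = k1 + alpha k1 k2 + beta k1 k2 ->
  h k1 k2 = - h k2 k1 - kap *: h (k1 + beta k1 k2) (k1 + alpha k1 k2).
Proof.
move=> hb az k2E; apply/(straightens_A0 h az k2E).
by apply: hb; case: az => *; lia.
Qed.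

Lemma base_B h k1 k2 : base_alternating h ->
  [/\ 0 < beta k1 k2, beta k1 k2 < alpha k1 k2, alpha k1 k2 < L &
      L < alpha k1 k2 + beta k1 k2] ->
  k2 = k1 + alpha k1 k2 + beta k1 k2 - L -> h k1 k2 = - h k2 k1.
Proof.
move=> hb az k2E; apply/(straightens_B0 h az k2E).
by apply: hb; case: az => *; lia.
Qed.

Lemma base_one h k : base_alternating h -> h k k = 0.
Proof. by move=> hb; apply/straightens_same/hb; lia. Qed.

Variant base_pair_spec k1 k2 : Prop :=
| BaseSame of k1 = k2
| BaseAlpha of 0 < alpha k1 k2 < L & beta k1 k2 = 0 & k2 = k1 + alpha k1 k2
| BaseBeta of alpha k1 k2 = 0 & 0 < beta k1 k2 < L & k2 = k1 + beta k1 k2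
| BaseA of [/\ 0 < alpha k1 k2, alpha k1 k2 < beta k1 k2 &
    alpha k1 k2 + beta k1 k2 < L] & k2 = k1 + alpha k1 k2 + beta k1 k2
| BaseB of [/\ 0 < beta k1 k2, beta k1 k2 < alpha k1 k2, alpha k1 k2 < L &
    L < alpha k1 k2 + beta k1 k2] & k2 = k1 + alpha k1 k2 + beta k1 k2 - L.

Lemma base_pairP k1 k2 : k1 <= k2 < k1 + L -> base_pair_spec k1 k2.
Proof.
move=> /andP[k12 kL]; have Lp (p : nat) : L * p%:Z < L -> p = 0%N.
  by case: p => // p h; have : L * 1 <= L * p.+1%:Z by [rewrite ler_wpM2l]; lia.
case: (pairP k12) => p.
- move=> _ _ h; apply: BaseSame; rewrite h (Lp p) ?mulr0 ?addr0 //; lia.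
- move=> az bz h; apply: BaseAlpha => //.
  by rewrite {1}h (Lp p) ?mulr0 ?addr0 //; lia.
- move=> az bz h; apply: BaseBeta => //.
  by rewrite {1}h (Lp p) ?mulr0 ?addr0 //; lia.
- move=> az h; apply: BaseA => //; case: az => *.
  by rewrite {1}h (Lp p) ?mulr0 ?addr0 //; lia.
- move=> az h; apply: BaseB => //; case: az => *.
  by rewrite {1}h (Lp p) ?mulr0 ?addr0 //; lia.
Qed.

Lemma two_base_alpha h k1 k2 : base_alternating h -> 0 < alpha k1 k2 < L ->
  beta k1 k2 = 0 -> two_base n l q^-1 k1 (k1 + alpha k1 k2) h.
Proof.
move=> hb az bz; have [ra rb] := res_alpha n0 l0 k1 k2.
set y := k1 + alpha k1 k2 in ra rb *.
have a1 : alpha k1 y = alpha k1 k2 by exact: alpha_res.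
have b1 : beta k1 y = 0 by rewrite /(beta _ _) rb subrr mulr0 mod0z.
have b2 : beta y k1 = 0 by rewrite /(beta _ _) rb subrr mulr0 mod0z.
have a2 : alpha y k1 = L - alpha k1 k2.
  by rewrite alpha_rev // a1; case: eqP => // az0; rewrite az0 ltxx in az.
split=> j; rewrite /fam.
  by apply: base_alpha; rewrite // ?alpha_shift ?beta_shift ?a1 ?b1 // /y; ring.
by apply: base_alpha; rewrite // ?alpha_shift ?beta_shift ?a2 ?b2 //; [lia|rewrite /y; ring].
Qed.

Lemma two_base_beta h k1 k2 : base_alternating h -> alpha k1 k2 = 0 ->
  0 < beta k1 k2 < L -> two_base n l q k1 (k1 + beta k1 k2) h.
Proof.
move=> hb az bz; have [ra rb] := res_beta n0 l0 k1 k2.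
set y := k1 + beta k1 k2 in ra rb *.
have a1 : beta k1 y = beta k1 k2 by exact: beta_res.
have b1 : alpha k1 y = 0 by rewrite /(alpha _ _) ra subrr mod0z.
have b2 : alpha y k1 = 0 by rewrite /(alpha _ _) ra subrr mod0z.
have a2 : beta y k1 = L - beta k1 k2.
  by rewrite beta_rev // a1; case: eqP => // az0; rewrite az0 ltxx in bz.
split=> j; rewrite /fam.
  by apply: base_beta; rewrite // ?alpha_shift ?beta_shift ?a1 ?b1 // /y; ring.
by apply: base_beta; rewrite // ?alpha_shift ?beta_shift ?a2 ?b2 //; [lia|rewrite /y; ring].
Qed.

Lemma four_base_A h k1 k2 : base_alternating h ->
  [/\ 0 < alpha k1 k2, alpha k1 k2 < beta k1 k2 & alpha k1 k2 + beta k1 k2 < L] ->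
  four_base n l k1 (k1 + alpha k1 k2) (k1 + beta k1 k2)
    (k1 + alpha k1 k2 + beta k1 k2) h.
Proof.
move=> hb [a0 ab abL]; have [ya yb] := res_alpha n0 l0 k1 k2.
have [wa wb] := res_beta n0 l0 k1 k2; have [va vb] := res_alpha_beta k1 k2.
have ar : alpha k2 k1 = L - alpha k1 k2 by rewrite alpha_rev //; case: eqP => //; lia.
have br : beta k2 k1 = L - beta k1 k2 by rewrite beta_rev //; case: eqP => //; lia.
set y := k1 + alpha k1 k2 in ya yb *; set w := k1 + beta k1 k2 in wa wb *.
set v := _ + beta k1 k2 in va vb *.
have xva : alpha k1 v = alpha k1 k2 by exact: alpha_res.
have xvb : beta k1 v = beta k1 k2 by exact: beta_res.
have vxa : alpha v k1 = L - alpha k1 k2 by rewrite -ar; exact: alpha_res.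
have vxb : beta v k1 = L - beta k1 k2 by rewrite -br; exact: beta_res.
have ywa : alpha y w = L - alpha k1 k2 by rewrite -ar; exact: alpha_res.
have ywb : beta y w = beta k1 k2 by exact: beta_res.
have wya : alpha w y = alpha k1 k2 by exact: alpha_res.
have wyb : beta w y = L - beta k1 k2 by rewrite -br; exact: beta_res.
split=> j; rewrite /fam.
- rewrite base_A ?alpha_shift ?beta_shift ?xva ?xvb //; last by rewrite /v; ring.
  by congr (_ - _ *: h _ _); rewrite /y /w; ring.
- rewrite base_B ?alpha_shift ?beta_shift ?vxa ?vxb //; first by split; lia.
  by rewrite /v; ring.
- rewrite base_B ?alpha_shift ?beta_shift ?ywa ?ywb //; first by split; lia.
  by rewrite /y /w; ring.
- rewrite base_A ?alpha_shift ?beta_shift ?wya ?wyb //.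
  + by congr (_ - _ *: h _ _); rewrite /v /w; ring.
  + by split; lia.
  + by rewrite /y /w; ring.
Qed.

(** The pair plays the part of (y, w) in the rectangle with corner x = k1 + alpha - nl, whose outer
    pair (x, v) is of type A. *)
Lemma four_base_B h k1 k2 : base_alternating h ->
  [/\ 0 < beta k1 k2, beta k1 k2 < alpha k1 k2, alpha k1 k2 < L &
      L < alpha k1 k2 + beta k1 k2] ->
  four_base n l (k1 + alpha k1 k2 - L) k1 (k1 + alpha k1 k2 + beta k1 k2 - L)
    (k1 + beta k1 k2) h.
Proof.
move=> hb [b0 ba aL abL]; have [ya yb] := res_alpha n0 l0 k1 k2.
have [wa wb] := res_beta n0 l0 k1 k2.
have ar : alpha k2 k1 = L - alpha k1 k2 by rewrite alpha_rev //; case: eqP => //; lia.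
pose x := k1 + alpha k1 k2 + L * (-1).
have xa : alpha x (k1 + beta k1 k2) = L - alpha k1 k2.
  by rewrite -ar; apply: alpha_res; rewrite /x ?ares_shift.
have xb : beta x (k1 + beta k1 k2) = beta k1 k2.
  by apply: beta_res; rewrite /x ?bres_shift.
have := @four_base_A h x (k1 + beta k1 k2) hb; rewrite xa xb.
have -> : x = k1 + alpha k1 k2 - L by rewrite /x; ring.
have -> : k1 + alpha k1 k2 - L + (L - alpha k1 k2) = k1 by ring.
have -> : k1 + alpha k1 k2 - L + beta k1 k2 = k1 + alpha k1 k2 + beta k1 k2 - L by ring.
by apply; split; lia.
Qed.

Lemma one_base_base h k : base_alternating h -> one_base n l k h.
Proof. by move=> hb j; rewrite /fam; exact: base_one. Qed.

(** For each type of residues the defects of the members of H obey the two-step recurrence. The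
    reversal and the Hecke functionals both enter here, with only distances below nl left to
    check. *)
Theorem alternating_of_base (H : (int -> int -> V) -> Prop) :
  (forall h, H h -> H (sigmaL h)) -> (forall h, H h -> base_alternating h) ->
  forall h, H h -> alternating h.
Proof.
move=> Hs Hb h Hh k1 k2 k12; case: (pairP k12) => p.
- move=> az bz k2E; apply/(straightens_one h az bz k2E).
  exact: (one_vanish Hs (fun g Hg => one_base_base k1 (Hb g Hg))).
- move=> az bz k2E; apply/(straightens_alpha h az bz k2E).
  exact: (two_vanish Hs (fun g Hg => two_base_alpha (Hb g Hg) az bz)).
- move=> az bz k2E; apply/(straightens_beta h az bz k2E).
  exact: (two_vanish Hs (fun g Hg => two_base_beta (Hb g Hg) az bz)).
- move=> ab k2E; apply/(straightens_A h ab k2E).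
  by have [] := four_vanish Hs (fun g Hg => four_base_A (Hb g Hg) ab) p 0 Hh.
move=> ab k2E; apply/(straightens_B h ab k2E).
by have [] := four_vanish Hs (fun g Hg => four_base_B (Hb g Hg) ab) p 0 Hh.
Qed.

Lemma defect_shift (phi psi : int -> int -> V) (P Q : nat -> int -> int -> V) p i :
  defect phi psi P Q p i =
  defect (fun a b => phi (a + i) (b + i)) (fun a b => psi (a + i) (b + i))
    (fun m a b => P m (a + i) (b + i)) (fun m a b => Q m (a + i) (b + i)) p 0.
Proof.
rewrite /defect !add0r [p%:Z + i]addrC; congr (_ - _ + _); apply: eq_bigr => m _.
  by congr (P m _ _); ring.
by congr (Q m _ _); ring.
Qed.

Lemma fam_shift x y h i : (fun a b => fam x y h (a + i) (b + i)) =
  fam (x + L * i) (y + L * i) h.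
Proof.
by apply/funext => a; apply/funext => b; congr (h _ _); rewrite mulrDr; ring.
Qed.

Lemma alternating_base h : alternating h -> base_alternating h.
Proof. by move=> ha k1 k2 /andP[k12 _]; exact: ha. Qed.

(** The recurrence read forwards, for each type of residues. It provides the stability under the
    shift needed for the class of reversed functions. *)
Theorem alternating_sigma h : alternating h -> alternating (sigmaL h).
Proof.
move=> ha k1 k2 k12; have hb := alternating_base ha.
have Lp (p : nat) : 0 <= L * p%:Z by rewrite mulr_ge0.
case: (pairP k12) => p.
- move=> az bz k2E; apply/(straightens_one _ az bz k2E).
  apply: one_sigma_vanish; first exact: one_base_base.
  (* The defect at distance r and base point i is the rule for a translated pair with the same
     residues as k1, k2. The other types use the same translate. *)
  move=> r i; have := @straightens_one (k1 + L * i) (k2 + L * (i + r%:Z - p%:Z)) h r.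
  rewrite alpha_shift beta_shift => /(_ az bz) []; first by rewrite k2E; ring.
  rewrite -!fam_shift !add0r addrC [r%:Z + i]addrC => + _; rewrite addrC; apply; apply: ha.
  by have := Lp r; rewrite k2E; lia.
- move=> az bz k2E; apply/(straightens_alpha _ az bz k2E).
  apply: two_sigma_vanish; first exact: two_base_alpha.
  move=> r i; have := @straightens_alpha (k1 + L * i) (k2 + L * (i + r%:Z - p%:Z)) h r.
  rewrite alpha_shift beta_shift => /(_ az bz) []; first by rewrite {1}k2E; ring.
  move=> hh _; rewrite defect_shift; move: hh; rewrite /two_psi /two_P /two_Q /=.
  have -> : k1 + L * i + alpha k1 k2 = k1 + alpha k1 k2 + L * i by ring.
  rewrite -!fam_shift; apply; apply: ha.
  by have := Lp r; rewrite [in k2 + _]k2E; lia.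
- move=> az bz k2E; apply/(straightens_beta _ az bz k2E).
  apply: two_sigma_vanish; first exact: two_base_beta.
  move=> r i; have := @straightens_beta (k1 + L * i) (k2 + L * (i + r%:Z - p%:Z)) h r.
  rewrite alpha_shift beta_shift => /(_ az bz) []; first by rewrite {1}k2E; ring.
  move=> hh _; rewrite defect_shift; move: hh; rewrite /two_psi /two_P /two_Q /=.
  have -> : k1 + L * i + beta k1 k2 = k1 + beta k1 k2 + L * i by ring.
  rewrite -!fam_shift; apply; apply: ha.
  by have := Lp r; rewrite [in k2 + _]k2E; lia.
- move=> ab k2E; apply/(straightens_A _ ab k2E).
  apply: fourA_sigma_vanish; first exact: four_base_A.
  move=> r i; have := @straightens_A (k1 + L * i) (k2 + L * (i + r%:Z - p%:Z)) h r.
  rewrite alpha_shift beta_shift => /(_ ab) []; first by rewrite {1}k2E; ring.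
  move=> hh _; rewrite defect_shift; move: hh; rewrite /fourA_P /fourA_Q /=.
  have -> : k1 + L * i + alpha k1 k2 = k1 + alpha k1 k2 + L * i by ring.
  have -> : k1 + alpha k1 k2 + L * i + beta k1 k2 =
    k1 + alpha k1 k2 + beta k1 k2 + L * i by ring.
  have -> : k1 + L * i + beta k1 k2 = k1 + beta k1 k2 + L * i by ring.
  rewrite -!fam_shift; apply; apply: ha.
  by have := Lp r; case: ab => *; rewrite [in k2 + _]k2E; lia.
move=> ab k2E; apply/(straightens_B _ ab k2E).
apply: fourB_sigma_vanish; first exact: four_base_B.
move=> r i; have := @straightens_B (k1 + L * i) (k2 + L * (i + r%:Z - p%:Z)) h r.
rewrite alpha_shift beta_shift => /(_ ab) []; first by rewrite {1}k2E; ring.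
move=> hh _; rewrite defect_shift; move: hh; rewrite /fourB_P /fourB_Q /=.
have -> : k1 + L * i + alpha k1 k2 - L = k1 + alpha k1 k2 - L + L * i by ring.
have -> : k1 + L * i + alpha k1 k2 + beta k1 k2 - L =
  k1 + alpha k1 k2 + beta k1 k2 - L + L * i by ring.
have -> : k1 + L * i + beta k1 k2 = k1 + beta k1 k2 + L * i by ring.
rewrite -!fam_shift; apply; apply: ha.
by have := Lp r; case: ab => *; rewrite [in k2 + _]k2E; lia.
Qed.

End Fixed.
End Alternating.

(* V with the scalar c acting as c(q^-1): semilinear maps to V are the linear
   maps to [twist V]. *)
Definition twist (V : lmodType Qq) : Type := V.

Section Twist.
Variable V : lmodType Qq.

HB.instance Definition _ := GRing.Zmodule.on (twist V).

Definition twist_scale (a : Qq) (v : twist V) : twist V := qinv a *: (v : V).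

Fact twist_scaleA a b v : twist_scale a (twist_scale b v) = twist_scale (a * b) v.
Proof. by rewrite /twist_scale scalerA rmorphM. Qed.

Fact twist_scale1 : left_id 1 twist_scale.
Proof. by move=> v; rewrite /twist_scale rmorph1 scale1r. Qed.

Fact twist_scaleDr : right_distributive twist_scale +%R.
Proof. by move=> a u v; rewrite /twist_scale scalerDr. Qed.

Fact twist_scaleDl v : {morph twist_scale^~ v : a b / a + b}.
Proof. by move=> a b; rewrite /twist_scale rmorphD scalerDl. Qed.

HB.instance Definition _ := GRing.Zmodule_isLmodule.Build Qq (twist V)
  twist_scaleA twist_scale1 twist_scaleDr twist_scaleDl.

Lemma twist_scaleE (a : Qq) (v : twist V) : a *: v = qinv a *: (v : V) :> V.
Proof. by []. Qed.

End Twist.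

(** * Reversing the rules *)

Section Flip.
Variables (n l : nat).
Hypotheses (n0 : (0 < n)%N) (l0 : (0 < l)%N).
Variable V : lmodType Qq.
Local Notation alpha := (alpha n l).
Local Notation beta := (beta n l).
Local Notation L := (n * l)%:Z.

Definition flip (h : int -> int -> V) : int -> int -> twist V := fun c d => h d c.

(** The shift is symmetric in its arguments, so it commutes with [flip] and the class H is stable.
    For short pairs, [qinv] inverts the leading coefficient, which is what solving the rule for the
    reversed monomial requires. *)
Theorem alternating_flip (h : int -> int -> V) :
  alternating n l h -> alternating n l (flip h).
Proof.
move=> ha; pose H (g : int -> int -> twist V) :=
  exists2 f : int -> int -> V, alternating n l f & g = flip f.
apply: (@alternating_of_base n l n0 l0 (twist V) H); last by exists h.
  move=> g [f fa ->]; exists (sigmaL n l f); first exact: alternating_sigma.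
  by apply/funext => i; apply/funext => j; rewrite /flip /sigmaL addrC.
move=> g [f fa ->] k1 k2 k12; have fb := alternating_base fa.
case: (base_pairP n0 l0 k12).
- by move=> <-; apply/straightens_same => //; exact: (base_one n0 l0 k1 fb).
- move=> az bz k2E; apply/(straightens_alpha0 n0 l0 _ az bz k2E).
  have := base_alpha n0 l0 fb az bz k2E.
  rewrite /flip twist_scaleE qinv_qV => /eqP; rewrite addr_eq0 => /eqP ->.
  by rewrite scalerN opprK scalerA mulfV ?scale1r ?q_neq0.
- move=> az bz k2E; apply/(straightens_beta0 n0 l0 _ az bz k2E).
  have := base_beta n0 l0 fb az bz k2E.
  rewrite /flip twist_scaleE qinv_q => /eqP; rewrite addr_eq0 => /eqP ->.
  by rewrite scalerN opprK scalerA mulVf ?scale1r ?q_neq0.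
- move=> az k2E; apply/(straightens_A0 n0 l0 _ az k2E).
  have h1 := base_A n0 l0 fb az k2E.
  (* The monomial in the correction term is reversed too; its pair is of type B, so it only changes
     sign. *)
  have h2 : f (k1 + alpha k1 k2) (k1 + beta k1 k2) = - f (k1 + beta k1 k2) (k1 + alpha k1 k2).
    have [b1 b2 b3 b4] := four_base_A n0 l0 fb az.
    by have := b3 0; rewrite /fam mulr0 !addr0.
  have h3 : f k2 k1 = - f k1 k2
      - (q^-1 - q) *: f (k1 + alpha k1 k2) (k1 + beta k1 k2).
    by rewrite h1 h2; lmod.
  by rewrite /flip twist_scaleE rmorphB /= qinv_q qinv_qV; exact: h3.
move=> az k2E; apply/(straightens_B0 n0 l0 _ az k2E).
by rewrite /flip (base_B n0 l0 fb az k2E) opprK.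
Qed.

End Flip.

(** * Hecke operators on words *)

Section Kernels.
Variable T : Type.

(** A kernel sends a pair of letters to a finite combination of pairs. [app] and [opi] act on
    functions by precomposition, which makes sense on infinite words as well. *)
Definition kernel : Type := T -> T -> seq (Qq * (T * T)).

Definition app (K : kernel) (h : T -> T -> Qq) (c d : T) : Qq :=
  \sum_(u <- K c d) u.1 * h u.2.1 u.2.2.

Definition upd2 (x : nat -> T) (i : nat) (c d : T) : nat -> T :=
  fun j => if j == i then c else if j == i.+1 then d else x j.

Definition opi (K : kernel) (i : nat) (g : (nat -> T) -> Qq) (x : nat -> T) : Qq :=
  app K (fun c d => g (upd2 x i c d)) (x i) (x i.+1).

Lemma upd2_same x i c d c' d' : upd2 (upd2 x i c d) i c' d' = upd2 x i c' d'.
Proof. by apply/funext => j; rewrite /upd2; case: eqP => //; case: eqP. Qed.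

Lemma upd2l x i c d : upd2 x i c d i = c.
Proof. by rewrite /upd2 eqxx. Qed.

Lemma upd2r x i c d : upd2 x i c d i.+1 = d.
Proof. by rewrite /upd2 eqxx; case: eqP => //; lia. Qed.

Lemma upd2_id x i : upd2 x i (x i) (x i.+1) = x.
Proof.
by apply/funext => j; rewrite /upd2; case: eqP => [->//|]; case: eqP => [->|].
Qed.

Lemma eq_app K h h' c d : (forall c d, h c d = h' c d) -> app K h c d = app K h' c d.
Proof. by move=> hh; apply: eq_bigr => u _; rewrite hh. Qed.

Lemma app_sum K (I : Type) (r : seq I) (F : I -> Qq) (h : I -> T -> T -> Qq) c d :
  app K (fun c d => \sum_(i <- r) F i * h i c d) c d
  = \sum_(i <- r) F i * app K (h i) c d.
Proof.
rewrite /app; under eq_bigr => u _ do rewrite mulr_sumr.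
rewrite exchange_big /=; apply: eq_bigr => i _; rewrite mulr_sumr.
by apply: eq_bigr => u _; ring.
Qed.

Lemma app_lin K a h h' c d :
  app K (fun c d => a * h c d + h' c d) c d = a * app K h c d + app K h' c d.
Proof.
rewrite /app mulr_sumr -big_split; apply: eq_bigr => u _ /=; ring.
Qed.

Lemma opi_far K K' i j g x : (i.+1 < j)%N ->
  opi K i (opi K' j g) x = opi K' j (opi K i g) x.
Proof.
move=> ij; rewrite /opi.
have -> : (fun c d => app K' (fun c' d' => g (upd2 (upd2 x i c d) j c' d'))
    (upd2 x i c d j) (upd2 x i c d j.+1)) =
  (fun c d => app K' (fun c' d' => g (upd2 (upd2 x j c' d') i c d)) (x j) (x j.+1)).
  apply/funext => c; apply/funext => d.
  have -> : upd2 x i c d j = x j.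
    by rewrite /upd2; case: eqP => [?|_]; [lia|case: eqP => // ?; lia].
  have -> : upd2 x i c d j.+1 = x j.+1.
    by rewrite /upd2; case: eqP => [?|_]; [lia|case: eqP => // ?; lia].
  apply: eq_app => c' d'; congr g; apply/funext => m; rewrite /upd2.
  by do 2!(case: (m =P i) => [?|?]; case: (m =P i.+1) => [?|?]; case: (m =P j) => [?|?];
    case: (m =P j.+1) => [?|?]) => //; lia.
have -> : (fun c d => app K (fun c' d' => g (upd2 (upd2 x j c d) i c' d'))
    (upd2 x j c d i) (upd2 x j c d i.+1)) =
  (fun c d => app K (fun c' d' => g (upd2 (upd2 x j c d) i c' d')) (x i) (x i.+1)).
  apply/funext => c; apply/funext => d.
  have -> : upd2 x j c d i = x i.
    by rewrite /upd2; case: eqP => [?|_]; [lia|case: eqP => // ?; lia].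
  have -> // : upd2 x j c d i.+1 = x i.+1.
  by rewrite /upd2; case: eqP => [?|_]; [lia|case: eqP => // ?; lia].
exact: (app_sum K (K' (x j) (x j.+1)) (fun u => u.1)
  (fun u c d => g (upd2 (upd2 x j u.2.1 u.2.2) i c d))).
Qed.

Lemma opi_same K K' i g x : opi K i (opi K' i g) x =
  app K (app K' (fun c d => g (upd2 x i c d))) (x i) (x i.+1).
Proof.
rewrite /opi; apply: eq_app => c d; rewrite upd2l upd2r.
by apply: eq_app => c' d'; rewrite upd2_same.
Qed.

Definition upd3 (x : nat -> T) (i : nat) (c d e : T) : nat -> T :=
  upd2 (upd2 x i.+1 d e) i c d.

Definition app12 K (h : T -> T -> T -> Qq) c d e := app K (fun c d => h c d e) c d.
Definition app23 K (h : T -> T -> T -> Qq) c d e := app K (h c) d e.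

Lemma upd3E x i c d e j : upd3 x i c d e j =
  if j == i then c else if j == i.+1 then d else if j == i.+2 then e else x j.
Proof.
rewrite /upd3 /upd2; case: eqP => // _; case: eqP => // h.
Qed.

Lemma upd3_12 x i c d e c' d' : upd2 (upd3 x i c d e) i c' d' = upd3 x i c' d' e.
Proof.
apply/funext => j; rewrite upd3E /upd2 upd3E.
by case: eqP => // _; case: eqP.
Qed.

Lemma upd3_23 x i c d e c' d' : upd2 (upd3 x i c d e) i.+1 c' d' = upd3 x i c c' d'.
Proof.
apply/funext => j; rewrite upd3E /upd2 upd3E.
case: (j =P i) => [->|_].
  have -> : (i == i.+1) = false by lia.
  by have -> : (i == i.+2) = false by lia.
by case: (j =P i.+1) => // _; case: (j =P i.+2).
Qed.

Lemma opi_12 K i g x c d e : opi K i g (upd3 x i c d e) =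
  app12 K (fun c d e => g (upd3 x i c d e)) c d e.
Proof.
rewrite /opi !upd3E eqxx; have -> : (i.+1 == i) = false by lia.
by rewrite eqxx; apply: eq_app => c' d'; rewrite upd3_12.
Qed.

Lemma opi_23 K i g x c d e : opi K i.+1 g (upd3 x i c d e) =
  app23 K (fun c d e => g (upd3 x i c d e)) c d e.
Proof.
rewrite /opi !upd3E eqxx; have -> : (i.+1 == i) = false by lia.
have -> : (i.+2 == i) = false by lia.
have -> : (i.+2 == i.+1) = false by lia.
by rewrite eqxx; apply: eq_app => c' d'; rewrite upd3_23.
Qed.

Lemma upd3_id x i : upd3 x i (x i) (x i.+1) (x i.+2) = x.
Proof.
apply/funext => j; rewrite upd3E; case: eqP => [->//|_].
by case: eqP => [->//|_]; case: eqP => [->|].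
Qed.

Definition braided K := forall h c d e,
  app12 K (app23 K (app12 K h)) c d e = app23 K (app12 K (app23 K h)) c d e.

Lemma opi_braid K i g x : braided K ->
  opi K i (opi K i.+1 (opi K i g)) x = opi K i.+1 (opi K i (opi K i.+1 g)) x.
Proof.
move=> bK; rewrite -(upd3_id x i); move: (x i) (x i.+1) (x i.+2) => c d e.
have f12 f : (fun c d e => opi K i f (upd3 x i c d e)) =
    app12 K (fun c d e => f (upd3 x i c d e)).
  by do 3!apply/funext => ?; rewrite opi_12.
have f23 f : (fun c d e => opi K i.+1 f (upd3 x i c d e)) =
    app23 K (fun c d e => f (upd3 x i c d e)).
  by do 3!apply/funext => ?; rewrite opi_23.
by rewrite opi_12 f23 f12 opi_23 f12 f23; exact: bK.
Qed.

End Kernels.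

(** Opposite in sign to the local notation [kap] of the straightening sections. The roots of T^2 =
    kap T + 1 are q^-1 and - q. *)
Definition kap : Qq := q^-1 - q.

Section FiniteKernel.
Variables (ev sg : Qq).
Hypothesis evE : ev * ev = kap * ev + sg * sg.
Hypothesis sgE : sg * sg = 1.

(** The Hecke generator on the tensor square of a vector representation, with ev its eigenvalue on
    equal letters. The letters a take ev = q^-1, sg = 1, and the letters b take ev = - q, sg = -
    1. *)
Definition fin_kernel : kernel int := fun a b =>
  if a == b then [:: (ev, (a, b))]
  else if a < b then [:: (sg, (b, a))] else [:: (sg, (b, a)); (kap, (a, b))].

Lemma app_finE h a b : app fin_kernel h a b =
  if a == b then ev * h a b
  else if a < b then sg * h b a else sg * h b a + kap * h a b.
Proof.
rewrite /app /fin_kernel; case: eqP => _; first by rewrite big_seq1.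
by case: ifP => _; rewrite ?big_cons ?big_nil ?addr0.
Qed.

Let lt_facts (a b : int) : a < b ->
  ((a < b) = true) * ((b < a) = false) * ((a == b) = false) * ((b == a) = false).
Proof. by move=> ab; do ![split]; lia. Qed.

Lemma fin_quadratic h a b :
  app fin_kernel (app fin_kernel h) a b = kap * app fin_kernel h a b + h a b.
Proof.
case: (ltgtP a b) => [ab|ab|<-].
- by rewrite !(app_finE, lt_facts ab); ring: evE sgE.
- by rewrite !(app_finE, lt_facts ab); ring: evE sgE.
by rewrite !(app_finE, eqxx); ring: evE sgE.
Qed.

Lemma fin_braid : braided fin_kernel.
Proof.
move=> h a b c; rewrite /app12 /app23.
case: (ltgtP a b) => [ab|ab|<-]; [| |case: (ltgtP a c) => [ac|ac|<-]].
- case: (ltgtP b c) => [bc|bc|<-].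
  + have ac := lt_trans ab bc.
    rewrite !(app_finE, lt_facts ab, lt_facts bc, lt_facts ac, eqxx) /=.
    by ring: evE sgE.
  + case: (ltgtP a c) => [ac|ac|<-].
    * rewrite !(app_finE, lt_facts ab, lt_facts bc, lt_facts ac, eqxx) /=.
      by ring: evE sgE.
    * rewrite !(app_finE, lt_facts ab, lt_facts bc, lt_facts ac, eqxx) /=.
      by ring: evE sgE.
    * rewrite !(app_finE, lt_facts ab, eqxx) /=.
      by ring: evE sgE.
  + rewrite !(app_finE, lt_facts ab, eqxx) /=.
    by ring: evE sgE.
- case: (ltgtP b c) => [bc|bc|<-].
  + case: (ltgtP a c) => [ac|ac|<-].
    * rewrite !(app_finE, lt_facts ab, lt_facts bc, lt_facts ac, eqxx) /=.
      by ring: evE sgE.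
    * rewrite !(app_finE, lt_facts ab, lt_facts bc, lt_facts ac, eqxx) /=.
      by ring: evE sgE.
    * rewrite !(app_finE, lt_facts ab, eqxx) /=.
      by ring: evE sgE.
  + have ac := lt_trans bc ab.
    rewrite !(app_finE, lt_facts ab, lt_facts bc, lt_facts ac, eqxx) /=.
    by ring: evE sgE.
  + rewrite !(app_finE, lt_facts ab, eqxx) /=.
    by ring: evE sgE.
- rewrite !(app_finE, lt_facts ac, eqxx) /=.
  by ring: evE sgE.
- rewrite !(app_finE, lt_facts ac, eqxx) /=.
  by ring: evE sgE.
rewrite !(app_finE, eqxx) /=.
by ring: evE sgE.
Qed.

End FiniteKernel.

(* z_i translates the exponent of the i-th letter.  The relations below carry
   the quadratic and braid relations from the exponents 0 to all exponents. *)
Section ShiftRelations.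
Variable W : lmodType Qq.
Variables Y1 Y2 z1 z2 z3 : W -> W.
Hypothesis Y1L : forall a u v, Y1 (a *: u + v) = a *: Y1 u + Y1 v.
Hypothesis Y2L : forall a u v, Y2 (a *: u + v) = a *: Y2 u + Y2 v.
Hypothesis z1L : forall a u v, z1 (a *: u + v) = a *: z1 u + z1 v.
Hypothesis z2L : forall a u v, z2 (a *: u + v) = a *: z2 u + z2 v.
Hypothesis z3L : forall a u v, z3 (a *: u + v) = a *: z3 u + z3 v.
Hypothesis z1Y1 : forall h, z1 (Y1 h) = - kap *: z2 h + Y1 (z2 h).
Hypothesis z2Y1 : forall h, z2 (Y1 h) = kap *: z2 h + Y1 (z1 h).
Hypothesis z3Y1 : forall h, z3 (Y1 h) = Y1 (z3 h).
Hypothesis z1Y2 : forall h, z1 (Y2 h) = Y2 (z1 h).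
Hypothesis z2Y2 : forall h, z2 (Y2 h) = - kap *: z3 h + Y2 (z3 h).
Hypothesis z3Y2 : forall h, z3 (Y2 h) = kap *: z3 h + Y2 (z2 h).

Definition quad_defect (Y : W -> W) h := - kap *: Y h + (- 1 *: h + Y (Y h)).

Lemma quad_defect_z2 h : z2 (quad_defect Y1 h) = quad_defect Y1 (z2 h).
Proof. rewrite /quad_defect !(z2L, z2Y1, z1Y1, Y1L); lmod. Qed.

Lemma quad_defect_z1 h : z1 (quad_defect Y1 h) = quad_defect Y1 (z1 h).
Proof. rewrite /quad_defect !(z1L, z2Y1, z1Y1, Y1L); lmod. Qed.

Definition braid_defect h := - 1 *: Y2 (Y1 (Y2 h)) + Y1 (Y2 (Y1 h)).

Hypothesis Y1Q : forall h, Y1 (Y1 h) = kap *: Y1 h + h.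
Hypothesis Y2Q : forall h, Y2 (Y2 h) = kap *: Y2 h + h.

(** The braid words of length three reverse the positions, so they exchange the shifts z_1 and z_3;
    the kap corrections cancel by the quadratic relations. *)
Lemma braid_defect_z3 h : z3 (braid_defect h) = braid_defect (z1 h).
Proof.
rewrite /braid_defect !(z3L, z3Y1, z3Y2, z2Y1, z2Y2, z1Y1, z1Y2, Y1L, Y2L, Y1Q, Y2Q).
lmod.
Qed.

Lemma braid_defect_z1 h : z1 (braid_defect h) = braid_defect (z3 h).
Proof.
rewrite /braid_defect !(z1L, z3Y1, z3Y2, z2Y1, z2Y2, z1Y1, z1Y2, Y1L, Y2L, Y1Q, Y2Q).
lmod.
Qed.

Hypothesis z12 : forall h, z1 (z2 h) = z2 (z1 h).
Hypothesis z13 : forall h, z1 (z3 h) = z3 (z1 h).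
Hypothesis z23 : forall h, z2 (z3 h) = z3 (z2 h).

(** The product z_1 z_2 z_3 commutes with Y1 and Y2. It supplies the translations of the middle
    exponent, which z_1 and z_3 alone do not reach. *)
Lemma braid_defect_z123 h : z1 (z2 (z3 (braid_defect h))) = braid_defect (z1 (z2 (z3 h))).
Proof.
have e1 g : z1 (z2 (z3 (Y1 g))) = Y1 (z1 (z2 (z3 g))).
  by rewrite z3Y1 z2Y1 z1L z1Y1 (z12 (z3 g)); lmod.
have e2 g : z1 (z2 (z3 (Y2 g))) = Y2 (z1 (z2 (z3 g))).
  by rewrite z3Y2 z2L z2Y2 !z1L z1Y2 (z23 g); lmod.
by rewrite /braid_defect z3L z2L z1L !e1 !e2 !(e1, e2).
Qed.

End ShiftRelations.

(** * The affine Hecke generator on letters with exponents *)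

Lemma shift_ind (P : int -> Prop) : P 0 -> (forall m, P m <-> P (m + 1)) ->
  forall m, P m.
Proof.
move=> P0 PS [] n.
  elim: n => // n IH; have -> : n.+1%:Z = n%:Z + 1 by lia.
  exact: (PS n).1.
elim: n => [|n IH]; apply/PS => //.
by have -> : Negz n.+1 + 1 = Negz n by lia.
Qed.

Section Primitive.
Variable G : int -> Qq.

(* The primitive of G for the difference operator, zero at 0. *)
Definition prim_terms (z : int) : seq (Qq * int) :=
  match z with
  | Posz k => [seq (1, Posz t) | t <- iota 0 k]
  | Negz k => [seq (-1, - 1 - Posz t) | t <- iota 0 k.+1]
  end.

Definition prim (z : int) : Qq := \sum_(u <- prim_terms z) u.1 * G u.2.

Lemma prim0 : prim 0 = 0. Proof. by rewrite /prim big_nil. Qed.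

Lemma primS z : prim (z + 1) = prim z + G z.
Proof.
case: z => n.
  have -> : Posz n + 1 = Posz n.+1 by lia.
  by rewrite /prim /prim_terms -addn1 iotaD map_cat big_cat big_seq1 /= mul1r.
case: n => [|n].
  by rewrite prim0 /prim /= big_seq1 mulN1r /= subr0 addNr.
have -> : Negz n.+1 + 1 = Negz n by lia.
rewrite /prim /prim_terms -[n.+2]addn1 iotaD map_cat big_cat big_seq1 /= mulN1r.
have -> : - 1 - Posz (0 + n.+1) = Negz n.+1 by lia.
by rewrite subrK.
Qed.

End Primitive.

Lemma prim_shift (G : int -> Qq) a b :
  prim (fun u => G (u + 1)) b - prim (fun u => G (u + 1)) a =
  prim G (b + 1) - prim G (a + 1).
Proof.
have h z : prim G (z + 1) = prim (fun u => G (u + 1)) z + prim G 1.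
  elim/shift_ind: z => [|m]; first by rewrite prim0 !add0r.
  rewrite !primS; split=> [->|/eqP]; first by rewrite addrAC.
  by rewrite [_ + G _ + prim G 1]addrAC => /eqP/addIr.
rewrite !h; set x := prim _ b; set y := prim _ a; set z := prim _ _; ring.
Qed.

(* The action of the affine Hecke algebra generator on (b, m): the finite
   generator on the b's with the exponents exchanged, corrected by a divided
   difference in the exponents. *)
Definition aff_kernel : kernel (int * int) := fun c d =>
  [seq (u.1, ((u.2.1, d.2), (u.2.2, c.2))) | u <- fin_kernel (- q) (- 1) c.1 d.1] ++
  [seq (kap * u.1, ((c.1, u.2), (d.1, c.2 + d.2 - u.2))) | u <- prim_terms d.2] ++
  [seq (- kap * u.1, ((c.1, u.2), (d.1, c.2 + d.2 - u.2))) | u <- prim_terms c.2].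

Lemma app_affE h b1 m1 b2 m2 : app aff_kernel h (b1, m1) (b2, m2) =
  app (fin_kernel (- q) (- 1)) (fun c d => h (c, m2) (d, m1)) b1 b2
  + kap * (prim (fun u => h (b1, u) (b2, m1 + m2 - u)) m2
           - prim (fun u => h (b1, u) (b2, m1 + m2 - u)) m1).
Proof.
rewrite /app /aff_kernel !big_cat !big_map /=; congr (_ + _).
rewrite mulrBr /prim !mulr_sumr -sumrN; congr (_ + _); apply: eq_bigr => u _.
  by rewrite mulrA.
by rewrite mulrA mulNr mulNr.
Qed.

Definition shift1 (h : int * int -> int * int -> Qq) c d := h (c.1, c.2 + 1) d.
Definition shift2 (h : int * int -> int * int -> Qq) c d := h c (d.1, d.2 + 1).

(** A Bernstein relation: exchanging the exponents turns the second shift into the first, and the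
    two divided differences differ by the single term at u = m1. *)
Lemma aff_shift2 h c d : shift2 (app aff_kernel h) c d =
  kap * shift2 h c d + app aff_kernel (shift1 h) c d.
Proof.
case: c d => [b1 m1] [b2 m2]; rewrite /shift2 /= !app_affE /shift1 /=.
have -> : (fun u => h (b1, u + 1) (b2, m1 + m2 - u)) =
  (fun u => (fun v => h (b1, v) (b2, m1 + (m2 + 1) - v)) (u + 1)).
  by apply/funext => u; congr (h _ (_, _)); ring.
rewrite (prim_shift (fun v => h (b1, v) (b2, m1 + (m2 + 1) - v))) (primS _ m1).
have -> : m1 + (m2 + 1) - m1 = m2 + 1 by ring.
set x := app _ _ _ _; set y := prim _ _; set z := prim _ _; ring.
Qed.

Lemma aff_shift1 h c d : shift1 (app aff_kernel h) c d =
  - kap * shift2 h c d + app aff_kernel (shift2 h) c d.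
Proof.
case: c d => [b1 m1] [b2 m2]; rewrite /shift1 /= !app_affE /shift2 /=.
have -> : (fun u => h (b1, u) (b2, m1 + m2 - u + 1)) =
  (fun u => h (b1, u) (b2, m1 + 1 + m2 - u)).
  by apply/funext => u; congr (h _ (_, _)); ring.
rewrite (primS _ m1); have -> : m1 + 1 + m2 - m1 = m2 + 1 by ring.
set x := app _ _ _ _; set y := prim _ _; set z := prim _ _; ring.
Qed.

Lemma mulN1N1 : (- 1) * (- 1) = 1 :> Qq.
Proof. by ring. Qed.

Lemma fin_affE : (- q) * (- q) = kap * (- q) + (- 1) * (- 1).
Proof.
rewrite /kap; have qq := mulVf q_neq0.
have -> : (q^-1 - q) * - q = q * q - q^-1 * q by ring.
by rewrite qq; ring.
Qed.

Lemma aff_base h b1 b2 : app aff_kernel h (b1, 0) (b2, 0) =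
  app (fin_kernel (- q) (- 1)) (fun c d => h (c, 0) (d, 0)) b1 b2.
Proof. by rewrite app_affE subrr mulr0 addr0. Qed.

(** At exponents 0 the affine generator is the finite one. The shifts commute with the quadratic
    defect and are invertible, so its vanishing spreads to all exponents. *)
Lemma aff_quadratic h c d :
  app aff_kernel (app aff_kernel h) c d = kap * app aff_kernel h c d + h c d.
Proof.
pose W : lmodType Qq := (int * int -> int * int -> Qq^o).
pose Y : W -> W := fun h => app aff_kernel h.
have YL a (u v : W) : Y (a *: u + v) = a *: Y u + Y v.
  by apply/funext => x; apply/funext => y; exact: app_lin.
pose z1 : W -> W := shift1; pose z2 : W -> W := shift2.
have z1Y (g : W) : z1 (Y g) = - kap *: z2 g + Y (z2 g).
  by apply/funext => x; apply/funext => y; exact: aff_shift1.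
have z2Y (g : W) : z2 (Y g) = kap *: z2 g + Y (z1 g).
  by apply/funext => x; apply/funext => y; exact: aff_shift2.
suff : forall g : W, quad_defect Y g c d = 0.
  have lin (x y z : Qq) : - kap * x + (-1 * z + y) = 0 -> y = kap * x + z.
    move=> h0; have -> : y = (- kap * x + (-1 * z + y)) + (kap * x + z) by ring.
    by rewrite h0 add0r.
  by move=> /(_ h) h0; apply: lin; exact: h0.
have q1 (g : W) : z1 (quad_defect Y g) = quad_defect Y (z1 g).
  exact: (quad_defect_z1 YL).
have q2 (g : W) : z2 (quad_defect Y g) = quad_defect Y (z2 g).
  exact: (quad_defect_z2 YL).
case: c d => [b1 m1] [b2 m2].
elim/shift_ind: m1 => [|m1].
  elim/shift_ind: m2 => [g|m2].
    have lin (x y z : Qq) : y = kap * x + z -> - kap * x + (-1 * z + y) = 0.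
      by move=> ->; ring.
    apply: lin; rewrite /Y !aff_base.
    have -> : (fun c d => app aff_kernel g (c, 0) (d, 0)) =
       app (fin_kernel (- q) (- 1)) (fun c d => g (c, 0) (d, 0)).
      by apply/funext => x; apply/funext => y; rewrite aff_base.
    exact: (fin_quadratic fin_affE (mulN1N1)).
  split=> hm g; first by have := hm (z2 g); rewrite -q2.
  have gE : g = z2 (fun c d => g c (d.1, d.2 - 1)).
    by apply/funext => x; apply/funext => -[y1 y2]; rewrite /z2 /shift2 /= addrK.
  by rewrite gE -q2; exact: hm.
split=> hm g; first by have := hm (z1 g); rewrite -q1.
have gE : g = z1 (fun c d => g (c.1, c.2 - 1) d).
  by apply/funext => -[x1 x2]; apply/funext => y; rewrite /z1 /shift1 /= addrK.
by rewrite gE -q1; exact: hm.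
Qed.

Lemma aff_braid : braided aff_kernel.
Proof.
pose B := (int * int)%type.
pose W : lmodType Qq := (B -> B -> B -> Qq^o).
pose Y1 : W -> W := fun h => app12 aff_kernel h.
pose Y2 : W -> W := fun h => app23 aff_kernel h.
pose z1 : W -> W := fun h c d e => h (c.1, c.2 + 1) d e.
pose z2 : W -> W := fun h c d e => h c (d.1, d.2 + 1) e.
pose z3 : W -> W := fun h c d e => h c d (e.1, e.2 + 1).
have Y1L a (u v : W) : Y1 (a *: u + v) = a *: Y1 u + Y1 v.
  by do 3!apply/funext => ?; exact: app_lin.
have Y2L a (u v : W) : Y2 (a *: u + v) = a *: Y2 u + Y2 v.
  by do 3!apply/funext => ?; exact: app_lin.
have z1Y1 (g : W) : z1 (Y1 g) = - kap *: z2 g + Y1 (z2 g).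
  by do 2!apply/funext => ?; apply/funext => e; exact: (aff_shift1 (fun c d => g c d e)).
have z2Y1 (g : W) : z2 (Y1 g) = kap *: z2 g + Y1 (z1 g).
  by do 2!apply/funext => ?; apply/funext => e; exact: (aff_shift2 (fun c d => g c d e)).
have z2Y2 (g : W) : z2 (Y2 g) = - kap *: z3 g + Y2 (z3 g).
  by apply/funext => c; do 2!apply/funext => ?; exact: (aff_shift1 (g c)).
have z3Y2 (g : W) : z3 (Y2 g) = kap *: z3 g + Y2 (z2 g).
  by apply/funext => c; do 2!apply/funext => ?; exact: (aff_shift2 (g c)).
have Y1Q (g : W) : Y1 (Y1 g) = kap *: Y1 g + g.
  by do 2!apply/funext => ?; apply/funext => e; exact: (aff_quadratic (fun c d => g c d e)).
have Y2Q (g : W) : Y2 (Y2 g) = kap *: Y2 g + g.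
  by apply/funext => c; do 2!apply/funext => ?; exact: (aff_quadratic (g c)).
have q1 (g : W) : z1 (braid_defect Y1 Y2 g) = braid_defect Y1 Y2 (z3 g).
  exact: (braid_defect_z1 (z2 := z2) Y1L Y2L).
have q3 (g : W) : z3 (braid_defect Y1 Y2 g) = braid_defect Y1 Y2 (z1 g).
  exact: (braid_defect_z3 (z2 := z2) Y1L Y2L).
have q123 (g : W) : z1 (z2 (z3 (braid_defect Y1 Y2 g))) =
    braid_defect Y1 Y2 (z1 (z2 (z3 g))).
  by apply: (braid_defect_z123 (z1 := z1) (z2 := z2) (z3 := z3)).
pose s1 : W -> W := fun h c d e => h (c.1, c.2 - 1) d e.
pose s2 : W -> W := fun h c d e => h c (d.1, d.2 - 1) e.
pose s3 : W -> W := fun h c d e => h c d (e.1, e.2 - 1).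
have zs1 (g : W) : g = z1 (s1 g).
  by apply/funext => -[x1 x2]; do 2!apply/funext => ?; rewrite /z1 /s1 /= addrK.
have zs2 (g : W) : g = z2 (s2 g).
  by apply/funext => ?; apply/funext => -[x1 x2]; apply/funext => ?; rewrite /z2 /s2 /= addrK.
have zs3 (g : W) : g = z3 (s3 g).
  by do 2!apply/funext => ?; apply/funext => -[x1 x2]; rewrite /z3 /s3 /= addrK.
suff h0 : forall (c d e : B) (g : W), braid_defect Y1 Y2 g c d e = 0.
  move=> g c d e.
  have lin (x y : Qq) : -1 * y + x = 0 -> x = y.
    by move=> h; have -> : x = (-1 * y + x) + y by [ring]; rewrite h add0r.
  by apply: lin; exact: (h0 c d e g).
move=> [b1 m1] [b2 m2] [b3 m3].
have st1 k1 k2 k3 : (forall g : W, braid_defect Y1 Y2 g (b1, k1) (b2, k2) (b3, k3) = 0) <->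
    (forall g : W, braid_defect Y1 Y2 g (b1, k1 + 1) (b2, k2) (b3, k3) = 0).
  split=> hm g; first by have := hm (z3 g); rewrite -q1.
  by rewrite (zs3 g) -q1; exact: hm.
have st3 k1 k2 k3 : (forall g : W, braid_defect Y1 Y2 g (b1, k1) (b2, k2) (b3, k3) = 0) <->
    (forall g : W, braid_defect Y1 Y2 g (b1, k1) (b2, k2) (b3, k3 + 1) = 0).
  split=> hm g; first by have := hm (z1 g); rewrite -q3.
  by rewrite (zs1 g) -q3; exact: hm.
have st123 k1 k2 k3 :
    (forall g : W, braid_defect Y1 Y2 g (b1, k1) (b2, k2) (b3, k3) = 0) <->
    (forall g : W, braid_defect Y1 Y2 g (b1, k1 + 1) (b2, k2 + 1) (b3, k3 + 1) = 0).
  split=> hm g; first by have := hm (z1 (z2 (z3 g))); rewrite -q123.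
  have -> : g = z1 (z2 (z3 (s3 (s2 (s1 g))))) by rewrite -zs3 -zs2 -zs1.
  by rewrite -q123; exact: hm.
suff P0 : forall g : W, braid_defect Y1 Y2 g (b1, 0) (b2, 0) (b3, 0) = 0.
  (* Translating all three exponents together reaches every m2; at m2 = 0 the other two are moved
     separately. *)
  move: m1 m3; elim/shift_ind: m2 => [|m2].
    move=> m1; elim/shift_ind: m1 => [|m1]; last first.
      by split=> hm m3; [apply: (st1 _ _ _).1|apply: (st1 _ _ _).2]; exact: hm.
    by move=> m3; elim/shift_ind: m3 => // m3; exact: st3.
  split=> hm m1 m3.
    by rewrite -(subrK 1 m1) -(subrK 1 m3); apply: (st123 _ _ _).1.
  by apply: (st123 _ _ _).2; exact: hm.
move=> g.
have lin (x y : Qq) : x = y -> -1 * y + x = 0 by move=> ->; ring.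
apply: lin; pose g0 a b c := g (a, 0) (b, 0) (c, 0).
have e12 (f : W) : (fun a b c => Y1 f (a, 0) (b, 0) (c, 0)) =
    app12 (fin_kernel (- q) (- 1)) (fun a b c => f (a, 0) (b, 0) (c, 0)).
  by do 3!apply/funext => ?; rewrite /Y1 /app12 aff_base.
have e23 (f : W) : (fun a b c => Y2 f (a, 0) (b, 0) (c, 0)) =
    app23 (fin_kernel (- q) (- 1)) (fun a b c => f (a, 0) (b, 0) (c, 0)).
  by do 3!apply/funext => ?; rewrite /Y2 /app23 aff_base.
have := fin_braid fin_affE mulN1N1 g0 b1 b2 b3.
by rewrite /g0 -!(e12, e23).
Qed.

(** * The antisymmetrizer for two commuting Hecke actions *)

Section Antisymmetrizer.
Variables (W : lmodType Qq) (X Y : nat -> W -> W).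
Hypothesis XL : forall i a u v, X i (a *: u + v) = a *: X i u + X i v.
Hypothesis YL : forall i a u v, Y i (a *: u + v) = a *: Y i u + Y i v.
Hypothesis XY : forall i j w, X i (Y j w) = Y j (X i w).
Hypothesis XX : forall i j w, (i.+1 < j)%N -> X i (X j w) = X j (X i w).
Hypothesis YY : forall i j w, (i.+1 < j)%N -> Y i (Y j w) = Y j (Y i w).
Hypothesis XQ : forall i w, X i (X i w) = kap *: X i w + w.
Hypothesis YQ : forall i w, Y i (Y i w) = kap *: Y i w + w.
Hypothesis XB : forall i w, X i (X i.+1 (X i w)) = X i.+1 (X i (X i.+1 w)).
Hypothesis YB : forall i w, Y i (Y i.+1 (Y i w)) = Y i.+1 (Y i (Y i.+1 w)).

Definition zop i w := X i (Y i w).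
Definition uop i w := X i w - Y i w.

(* dop r = 1 + Z_{r-1} + Z_{r-2} Z_{r-1} + ... with Z_i = X_i Y_i; bop r plays
   the role of the antisymmetrizer of the first r + 1 letters. *)
Fixpoint dop (r : nat) (w : W) : W :=
  if r is r'.+1 then w + dop r' (zop r' w) else w.

Fixpoint bop (r : nat) (w : W) : W :=
  if r is r'.+1 then dop r (bop r' w) else w.

Let XD i u v : X i (u + v) = X i u + X i v.
Proof. by have := XL i 1 u v; rewrite !scale1r. Qed.
Let YD i u v : Y i (u + v) = Y i u + Y i v.
Proof. by have := YL i 1 u v; rewrite !scale1r. Qed.
Let X0 i : X i 0 = 0.
Proof. by apply: (@addrI _ (X i 0)); rewrite -XD !addr0. Qed.
Let Y0 i : Y i 0 = 0.
Proof. by apply: (@addrI _ (Y i 0)); rewrite -YD !addr0. Qed.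
Let XN i u : X i (- u) = - X i u.
Proof. by apply/eqP; rewrite -addr_eq0 -XD addNr X0. Qed.
Let YN i u : Y i (- u) = - Y i u.
Proof. by apply/eqP; rewrite -addr_eq0 -YD addNr Y0. Qed.

Let uopD i u v : uop i (u + v) = uop i u + uop i v.
Proof. by rewrite /uop XD YD; lmod. Qed.
Let zop0 i : zop i 0 = 0. Proof. by rewrite /zop Y0 X0. Qed.
Let dop0 r : dop r 0 = 0.
Proof. by elim: r => //= r IH; rewrite zop0 IH addr0. Qed.


(** (X - Y)(1 + XY) = (X^2 - 1) Y - X (Y^2 - 1) = kap XY - kap XY = 0. *)
Let uop_zop i w : uop i (w + zop i w) = 0.
Proof. by rewrite /uop /zop XD YD -XY YQ XQ XL; lmod. Qed.

Let uop_far i j w : (i.+1 < j)%N -> uop i (zop j w) = zop j (uop i w).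
Proof.
move=> ij; rewrite /uop /zop YD XD YN XN; congr (_ - _); first by rewrite XX // XY.
by rewrite -XY YY.
Qed.

Let uop_far' i j w : (i.+1 < j)%N -> uop j (zop i w) = zop i (uop j w).
Proof.
move=> ij; rewrite /uop /zop YD XD YN XN; congr (_ - _); first by rewrite -XX // XY.
by rewrite -XY -YY.
Qed.

(** The braid relation, for X and for Y separately: Z_i Z_{i+1} carries X_i - Y_i to X_{i+1} -
    Y_{i+1}. *)
Let uop_next i w : uop i.+1 (zop i (zop i.+1 w)) = zop i (zop i.+1 (uop i w)).
Proof.
rewrite /uop /zop !(XD, YD, XN, YN); congr (_ - _).
  by rewrite -!XY XB.
by rewrite -!XY YB.
Qed.

Let uop_dop r j w : (r < j)%N -> uop j (dop r w) = dop r (uop j w).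
Proof.
by elim: r w => //= r IH w rj; rewrite uopD IH ?uop_far' //; lia.
Qed.

(** For the largest i the operator kills the first two terms of the sum together, and in the others
    the braid relation moves it to index i - 1, where it kills w. For smaller i it commutes past the
    last Z, and induction applies. *)
Lemma uop_dop0 r w : (forall j, (j < r)%N -> uop j w = 0) ->
  forall i, (i <= r)%N -> uop i (dop r.+1 w) = 0.
Proof.
elim: r w => [|r IH] w hw i.
  by rewrite leqn0 => /eqP -> /=; exact: uop_zop.
rewrite leq_eqVlt => /orP[/eqP ->|ir].
  rewrite /= addrA uopD uop_zop add0r uop_dop // uop_next hw //.
  by rewrite !zop0 dop0.
rewrite [dop _ _]/= -/(dop r.+1 (zop r.+1 w)) uopD hw // add0r IH // => j jr.
by rewrite uop_far // hw ?zop0 //; lia.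
Qed.

Theorem uop_bop r w j : (j < r)%N -> uop j (bop r w) = 0.
Proof.
elim: r j => // r IH j jr; apply: uop_dop0 => // i ir; exact: IH.
Qed.

End Antisymmetrizer.

(** * Functionals that kill the rules *)

Section LocalHecke.
Variables (n l : nat).
Hypotheses (n0 : (0 < n)%N) (l0 : (0 < l)%N).
Local Notation L := (n * l)%:Z.
Local Notation alpha := (alpha n l).
Local Notation beta := (beta n l).
Local Notation KX := (fin_kernel q^-1 1).
Local Notation KY := aff_kernel.
Local Notation letter k := (bres n l k, mres n l k).

Let L0 : 0 < L. Proof. by rewrite ltz_nat muln_gt0 n0 l0. Qed.

(** These are functionals on a tensor product over the Hecke algebra, namely of the two spaces of
    letters; [letters] pulls them back along the encoding of k by a and (b, m). *)
Definition hecke_equal (H : int -> int -> int * int -> int * int -> Qq) : Prop :=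
  forall a a' p p', app KX (fun a a' => H a a' p p') a a' = app KY (H a a') p p'.

Definition letters (H : int -> int -> int * int -> int * int -> Qq) :
    int -> int -> Qq^o :=
  fun c d => H (ares n c) (ares n d) (letter c) (letter d).

Lemma aff_same h b1 b2 m : app KY h (b1, m) (b2, m) =
  app (fin_kernel (- q) (- 1)) (fun c d => h (c, m) (d, m)) b1 b2.
Proof. by rewrite app_affE subrr mulr0 addr0. Qed.

Lemma aff_succ h b1 b2 m : app KY h (b1, m + 1) (b2, m) =
  app (fin_kernel (- q) (- 1)) (fun c d => h (c, m) (d, m + 1)) b1 b2
  - kap * h (b1, m) (b2, m + 1).
Proof.
rewrite app_affE primS; have -> : m + 1 + m - m = m + 1 by ring.
by rewrite opprD addNKr mulrN.
Qed.

(** The positions of (b, m) used below for short pairs with different b. In both, the affine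
    generator is minus the exchange: the divided difference is either empty or cancels the kap
    term. *)
Variant close_letters (p1 p2 : int * int) : Prop :=
| CloseSame of p1.1 < p2.1 & p1.2 = p2.2
| CloseSucc of p2.1 < p1.1 & p1.2 = p2.2 + 1.

Lemma aff_close h p1 p2 : close_letters p1 p2 -> app KY h p1 p2 = - h p2 p1.
Proof.
case: p1 p2 => [b1 m1] [b2 m2] [] /= hb ->.
  by rewrite aff_same app_finE hb (lt_eqF hb) mulN1r.
rewrite aff_succ app_finE (gt_eqF hb) ltNge (ltW hb) /=.
by rewrite mulN1r addrK.
Qed.

Lemma mres_diff k1 k2 : k2 = k1 + alpha k1 k2 + beta k1 k2 +
  L * (mres n l k1 - mres n l k2 - (if ares n k1 <= ares n k2 then 0 else 1)
   - (if bres n l k1 <= bres n l k2 then 0 else 1)).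
Proof.
rewrite alphaE // betaE // {1}(abm_eq n l k2) {1}(abm_eq n l k1).
by case: ifP => _; case: ifP => _; ring.
Qed.

Lemma mres_beta k1 k2 : mres n l (k1 + beta k1 k2) =
  mres n l k1 - (if bres n l k1 <= bres n l k2 then 0 else 1).
Proof.
have [//|||_ _ ->] := @abm_uniq n l n0 l0 (k1 + beta k1 k2) (ares n k1) (bres n l k2)
  (mres n l k1 - (if bres n l k1 <= bres n l k2 then 0 else 1)) => //.
- by rewrite betaE // {1}(abm_eq n l k1); case: ifP => _; ring.
- exact: ares_itv.
- exact: bres_itv.
Qed.

Lemma mres_alpha k1 k2 : mres n l (k1 + alpha k1 k2) =
  mres n l k1 - (if ares n k1 <= ares n k2 then 0 else 1).
Proof.
have [//|||_ _ ->] := @abm_uniq n l n0 l0 (k1 + alpha k1 k2) (ares n k2) (bres n l k1)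
  (mres n l k1 - (if ares n k1 <= ares n k2 then 0 else 1)) => //.
- by rewrite alphaE // {1}(abm_eq n l k1); case: ifP => _; ring.
- exact: ares_itv.
- exact: bres_itv.
Qed.

Lemma alpha_lt_beta k1 k2 : alpha k1 k2 != 0 -> beta k1 k2 != 0 ->
  (alpha k1 k2 < beta k1 k2) = (ares n k1 < ares n k2).
Proof.
have := alphaE n0 l0 k1 k2; have := betaE n0 l0 k1 k2.
have := ares_itv k1 n0; have := ares_itv k2 n0.
have := bres_itv n k1 l0; have := bres_itv n k2 l0.
move: (bres n l k1) (bres n l k2) (ares n k1) (ares n k2) => b1 b2 a1 a2 ? ? ? ?.
move: (alpha k1 k2) (beta k1 k2) => x y; rewrite PoszM.
move=> hy hx x0 y0; have hn : 1 <= n%:Z by lia.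
have h1 : n%:Z * (b2 - b1) <= n%:Z * (l%:Z - 1) by nia.
have h2 : n%:Z * (1 - l%:Z) <= n%:Z * (b2 - b1) by nia.
have h3 : b1 < b2 -> n%:Z <= n%:Z * (b2 - b1) by nia.
have h4 : b2 < b1 -> n%:Z * (b2 - b1) <= - n%:Z by nia.
have h5 : b1 == b2 -> n%:Z * (b2 - b1) = 0 by nia.
have e1 : n%:Z * (l%:Z - 1) = n%:Z * l%:Z - n%:Z by ring.
have e2 : n%:Z * (1 - l%:Z) = n%:Z - n%:Z * l%:Z by ring.
move: h1 h2 h3 h4 h5 hx hy; rewrite e1 e2.
move: (n%:Z * (b2 - b1)) (n%:Z * l%:Z) => d N.
by case: (lerP b1 b2) => ?; case: (lerP a1 a2) => ?; lia.
Qed.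

Lemma hecke_base H : hecke_equal H -> base_alternating n l (letters H).
Proof.
move=> hH k1 k2 k12.
have qV := q_qV_neq0; have q0 := q_neq0.
have md := mres_diff k1 k2; have ma := mres_alpha k1 k2; have mb := mres_beta k1 k2.
have [aa ab] := res_alpha n0 l0 k1 k2; have [ba bb] := res_beta n0 l0 k1 k2.
have aE := alphaE n0 l0 k1 k2; have bE := betaE n0 l0 k1 k2.
have Lj0 (j : int) : L * j = 0 -> j = 0.
  by move/eqP; rewrite mulf_eq0 (gt_eqF L0) => /eqP.
case: (base_pairP n0 l0 k12).
- move=> <-; apply/straightens_same => //; rewrite /letters.
  have := hH (ares n k1) (ares n k1) (letter k1) (letter k1).
  rewrite aff_same !app_finE !eqxx; set x := H _ _ _ _ => hx.
  (* On a repeated letter the two generators act by q^-1 and - q. *)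
  apply/eqP; have : (q + q^-1) * x = 0 by rewrite mulrDl hx; ring.
  by move/eqP; rewrite mulf_eq0 (negPf qV).
- move=> /andP[az aL] bz k2E; apply/(straightens_alpha0 n0 l0) => //; first by rewrite az aL.
  (* A distance below nl leaves no full period, so the orders of the a's and of the b's determine
     the difference of the exponents. *)
  have /Lj0 mE : L * (mres n l k1 - mres n l k2
    - (if ares n k1 <= ares n k2 then 0 else 1)
    - (if bres n l k1 <= bres n l k2 then 0 else 1)) = 0.
    by move: md; rewrite bz => md'; move: k2E md'; set X := L * _; lia.
  have b12 : bres n l k1 = bres n l k2 by apply/eqP; rewrite -(beta_eq0 n0 l0) bz.
  have a12 : ares n k1 != ares n k2 by rewrite -(alpha_eq0 n0 l0) gt_eqF.
  rewrite /letters b12 in mE *; move: mE; rewrite lexx subr0.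
  case: (ltgtP (ares n k1) (ares n k2)) a12 => // a12 _ mE.
    have -> : mres n l k2 = mres n l k1 by lia.
    have := hH (ares n k1) (ares n k2) (bres n l k2, mres n l k1) (bres n l k2, mres n l k1).
    rewrite aff_same !app_finE eqxx (lt_eqF a12) a12 mul1r => ->.
    by rewrite /GRing.scale /= mulNr mulrN opprK mulKf.
  have -> : mres n l k1 = mres n l k2 + 1 by lia.
  have := hH (ares n k2) (ares n k1) (bres n l k2, mres n l k2 + 1) (bres n l k2, mres n l k2).
  rewrite aff_succ !app_finE eqxx (lt_eqF a12) a12 mul1r => ->.
  by rewrite /kap /GRing.scale /=; ring.
- move=> az /andP[bz bL] k2E; apply/(straightens_beta0 n0 l0) => //; first by rewrite bz bL.
  have /Lj0 mE : L * (mres n l k1 - mres n l k2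
    - (if ares n k1 <= ares n k2 then 0 else 1)
    - (if bres n l k1 <= bres n l k2 then 0 else 1)) = 0.
    by move: md; rewrite az => md'; move: k2E md'; set X := L * _; lia.
  have a12 : ares n k1 = ares n k2 by apply/eqP; rewrite -(alpha_eq0 n0 l0) az.
  have b12 : bres n l k1 != bres n l k2 by rewrite -(beta_eq0 n0 l0) gt_eqF.
  rewrite /letters a12 in mE *; move: mE; rewrite lexx subr0 => mE.
  have cl : close_letters (letter k1) (letter k2).
    move: mE; case: (ltgtP (bres n l k1) (bres n l k2)) b12 => // b12 _ mE.
      by apply: CloseSame => //=; lia.
    by apply: CloseSucc => //=; lia.
  have := hH (ares n k2) (ares n k2) (letter k1) (letter k2).
  rewrite (aff_close _ cl) app_finE eqxx => hx.
  by rewrite /GRing.scale /= -mulrN -hx mulVKf.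
- move=> az k2E; apply/(straightens_A0 n0 l0) => //; case: az => a0 alb abL.
  have /Lj0 mE : L * (mres n l k1 - mres n l k2
    - (if ares n k1 <= ares n k2 then 0 else 1)
    - (if bres n l k1 <= bres n l k2 then 0 else 1)) = 0.
    by move: k2E md; set X := L * _; lia.
  have a12 : ares n k1 < ares n k2 by rewrite -alpha_lt_beta; lia.
  have b12 : bres n l k1 != bres n l k2 by rewrite -(beta_eq0 n0 l0) gt_eqF //; lia.
  move: mE ma mb; rewrite (ltW a12) subr0 => mE ma mb.
  have cl : close_letters (letter k1) (letter k2).
    move: mE; case: (ltgtP (bres n l k1) (bres n l k2)) b12 => // b12 _ mE.
      by apply: CloseSame => //=; lia.
    by apply: CloseSucc => //=; lia.
  have m2 : mres n l (k1 + beta k1 k2) = mres n l k2 by rewrite mb; lia.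
  rewrite /letters aa ab ba bb m2 ma subr0.
  (* Two instances, with the letters a in both orders: the second one rewrites the kap term of the
     first as the monomial of the rule. *)
  have h1 := hH (ares n k2) (ares n k1) (letter k1) (letter k2).
  have h2 := hH (ares n k1) (ares n k2) (letter k1) (letter k2).
  move: h1 h2; rewrite !(aff_close _ cl) !app_finE (lt_eqF a12) (gt_eqF a12) a12.
  rewrite ltNge (ltW a12) /= !mul1r => h1 h2.
  move: h1; rewrite h2 => /(canRL (addrK _)) ->.
  by rewrite /kap /GRing.scale /=; ring.
move=> az k2E; apply/(straightens_B0 n0 l0) => //; case: az => b0 bla aL abL.
have /Lj0 mE : L * (mres n l k1 - mres n l k2 + 1
  - (if ares n k1 <= ares n k2 then 0 else 1)
  - (if bres n l k1 <= bres n l k2 then 0 else 1)) = 0.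
  rewrite -!addrA [1 + _]addrC !addrA mulrDr mulr1.
  by move: k2E md; set X := L * _; lia.
have a12 : ares n k2 < ares n k1.
  have an : ares n k1 != ares n k2 by rewrite -(alpha_eq0 n0 l0) gt_eqF //; lia.
  by rewrite ltNge le_eqVlt (negPf an) -alpha_lt_beta; lia.
have b12 : bres n l k1 != bres n l k2 by rewrite -(beta_eq0 n0 l0) gt_eqF //; lia.
move: mE; rewrite leNgt a12 /= => mE.
have cl : close_letters (letter k1) (letter k2).
  move: mE; case: (ltgtP (bres n l k1) (bres n l k2)) b12 => // b12 _ mE.
    by apply: CloseSame => //=; lia.
  by apply: CloseSucc => //=; lia.
have := hH (ares n k2) (ares n k1) (letter k1) (letter k2).
by rewrite !(aff_close _ cl) !app_finE (lt_eqF a12) a12 mul1r.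
Qed.

Lemma mres_shift k i : mres n l (k + L * i) = mres n l k - i.
Proof. by have [] := abm_shift n0 l0 k i. Qed.

Theorem hecke_alternating H : hecke_equal H -> alternating n l (letters H).
Proof.
move=> hH; pose P (h : int -> int -> Qq^o) := exists2 G, hecke_equal G & h = letters G.
apply: (@alternating_of_base n l n0 l0 Qq^o P); last by exists H.
  (* Lowering k by nl raises m by 1, so the shift comes from the sum of the two exponent shifts, in
     which the kap terms of the Bernstein relations cancel. *)
  move=> h [G hG ->]; exists (fun a a' p p' => G a a' (p.1, p.2 + 1) p'
     + G a a' p (p'.1, p'.2 + 1)).
    move=> a a' p p'.
    have e1 : app KX (fun a a' => G a a' (p.1, p.2 + 1) p' + G a a' p (p'.1, p'.2 + 1)) a a'
       = 1 * app KX (fun a a' => G a a' (p.1, p.2 + 1) p') a a'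
         + app KX (fun a a' => G a a' p (p'.1, p'.2 + 1)) a a'.
      by rewrite -app_lin; apply: eq_app => c d; rewrite mul1r.
    have e2 : app KY (fun p p' => G a a' (p.1, p.2 + 1) p' + G a a' p (p'.1, p'.2 + 1)) p p'
       = 1 * app KY (shift1 (G a a')) p p' + app KY (shift2 (G a a')) p p'.
      by rewrite -app_lin; apply: eq_app => c d; rewrite mul1r.
    rewrite e1 e2 !hG; have := aff_shift1 (G a a') p p'; have := aff_shift2 (G a a') p p'.
    by rewrite /shift1 /shift2 => -> ->; ring.
  apply/funext => c; apply/funext => d; rewrite /sigmaL /letters.
  have -> : c - L = c + L * (-1) by ring.
  have -> : d - L = d + L * (-1) by ring.
  by rewrite !ares_shift // !bres_shift // !mres_shift !opprK.
by move=> h [G hG ->]; exact: hecke_base.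
Qed.

End LocalHecke.

(* The local ring of rational functions regular at q = 1, and its maximal ideal. *)
Definition reg1 : set Qq := [set c | exists a b : {poly rat},
  b.[1] != 0 /\ c = eval_at q a / eval_at q b].
Definition van1 : set Qq := [set c | exists a b : {poly rat},
  [/\ b.[1] != 0, a.[1] = 0 & c = eval_at q a / eval_at q b]].

Lemma eval_at_q_neq0 (b : {poly rat}) : b.[1] != 0 -> eval_at q b != 0.
Proof.
by rewrite eval_at_q_eq0; apply: contra => /eqP ->; rewrite horner0.
Qed.

Lemma reg1D c d : reg1 c -> reg1 d -> reg1 (c + d).
Proof.
move=> [a [b [b0 ->]]] [a' [b' [b'0 ->]]]; exists (a * b' + a' * b), (b * b').
rewrite hornerM mulf_neq0 // addf_div ?eval_at_q_neq0 //.
by rewrite !rmorphD !rmorphM.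
Qed.

Lemma reg1M c d : reg1 c -> reg1 d -> reg1 (c * d).
Proof.
move=> [a [b [b0 ->]]] [a' [b' [b'0 ->]]]; exists (a * a'), (b * b').
by rewrite hornerM mulf_neq0 // mulf_div !rmorphM.
Qed.

Lemma van1D c d : van1 c -> van1 d -> van1 (c + d).
Proof.
move=> [a [b [b0 a0 ->]]] [a' [b' [b'0 a'0 ->]]]; exists (a * b' + a' * b), (b * b').
rewrite hornerM mulf_neq0 // hornerD !hornerM a0 a'0 !mul0r addr0; split=> //.
by rewrite addf_div ?eval_at_q_neq0 // !rmorphD !rmorphM.
Qed.

Lemma van1Ml c d : reg1 c -> van1 d -> van1 (c * d).
Proof.
move=> [a [b [b0 ->]]] [a' [b' [b'0 a'0 ->]]]; exists (a * a'), (b * b').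
by rewrite !hornerM mulf_neq0 // a'0 mulr0 mulf_div !rmorphM.
Qed.

Lemma van1_reg1 c : van1 c -> reg1 c.
Proof. by move=> [a [b [b0 _ ->]]]; exists a, b. Qed.

Lemma reg1_poly p : reg1 (eval_at q p).
Proof. by exists p, 1; rewrite hornerC oner_neq0 rmorph1 divr1. Qed.

Lemma reg1_0 : reg1 0. Proof. by have := reg1_poly 0; rewrite rmorph0. Qed.
Lemma reg1_1 : reg1 1. Proof. by have := reg1_poly 1; rewrite rmorph1. Qed.
Lemma reg1_q : reg1 q. Proof. by have := reg1_poly 'X; rewrite eval_atX. Qed.

Lemma reg1N c : reg1 c -> reg1 (- c).
Proof.
by rewrite -mulN1r; apply: reg1M; have := reg1_poly (-1); rewrite rmorphN1.
Qed.

Lemma reg1_qV : reg1 q^-1.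
Proof. by exists 1, 'X; rewrite hornerX oner_neq0 rmorph1 eval_atX div1r. Qed.

Lemma van1_0 : van1 0.
Proof. by exists 0, 1; rewrite hornerC oner_neq0 horner0 rmorph0 mul0r. Qed.

Lemma van1N c : van1 c -> van1 (- c).
Proof. by rewrite -mulN1r; apply/van1Ml/reg1N/reg1_1. Qed.

Lemma van1_q1 : van1 (q - 1).
Proof.
exists ('X - 1), 1; split.
- by rewrite hornerC oner_neq0.
- by rewrite hornerD hornerN hornerX hornerC subrr.
- by rewrite rmorphB !rmorph1 /= eval_atX divr1.
Qed.

Lemma van1_qV1 : van1 (q^-1 - 1).
Proof.
have -> : q^-1 - 1 = (- q^-1) * (q - 1).
  by rewrite mulrBr mulNr mulVf ?q_neq0 // mulr1 opprK addrC.
exact/van1Ml/van1_q1/reg1N/reg1_qV.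
Qed.

Lemma van1_kap : van1 kap.
Proof.
have -> : kap = (q^-1 - 1) + - (q - 1) by rewrite /kap; ring.
exact/van1D/van1N/van1_q1/van1_qV1.
Qed.

Lemma van1_1 : ~ van1 1.
Proof.
move=> [a [b [b0 a0]]] /esym/(canRL (divfK (eval_at_q_neq0 b0))); rewrite mul1r.
by move/eval_at_q_inj => ab; rewrite -ab a0 eqxx in b0.
Qed.

(** The local ring at q = 1 is a valuation ring: once common factors X - 1 are cancelled, the
    numerator or the denominator is nonzero at 1. *)
Lemma reg1_or_van1V c : reg1 c \/ van1 c^-1.
Proof.
have [a [b [b0 ->]]] := fractionP c.
have [->|a0] := eqVneq a 0; first by left; rewrite rmorph0 mul0r; exact: reg1_0.
have [n] := ubnP (size b); elim: n a b a0 b0 => // n IH a b a0 b0 sb.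
have [b1|b1] := eqVneq b.[1] 0; last by left; exists a, b.
have [a1|a1] := eqVneq a.[1] 0; last first.
  by right; exists b, a; rewrite invf_div.
have /factor_theorem[b' bE] : root b 1 by apply/rootP.
have /factor_theorem[a' aE] : root a 1 by apply/rootP.
have X1 : 'X - 1%:P != 0 :> {poly rat} by rewrite polyXsubC_eq0.
have a'0 : a' != 0 by apply: contraNneq a0 => a'0; rewrite aE a'0 mul0r.
have b'0 : b' != 0 by apply: contraNneq b0 => b'0; rewrite bE b'0 mul0r.
have := IH a' b' a'0 b'0; rewrite aE bE !rmorphM /= -mulf_div divff ?mulr1 ?eval_at_q_eq0 //.
by apply; move: sb; rewrite bE size_Mmonic ?monicXsubC // size_XsubC addn2.
Qed.


Section KernelsReg.
Variables (T : eqType) (K : kernel T).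

Definition kernel_reg := forall c d u, u \in K c d -> reg1 u.1.

Lemma reg1_app h c d : kernel_reg -> (forall c d, reg1 (h c d)) -> reg1 (app K h c d).
Proof.
move=> hK hh; rewrite /app; elim: (K c d) (@hK c d) => [|u t IH] ht.
  by rewrite big_nil; exact: reg1_0.
rewrite big_cons; apply: reg1D.
  by apply: reg1M => //; apply: ht; rewrite mem_head.
by apply: IH => v vt; apply: ht; rewrite inE vt orbT.
Qed.

End KernelsReg.

Local Notation KX := (fin_kernel q^-1 1).
Local Notation KY := aff_kernel.

Lemma fin_kernel_reg ev sg : reg1 ev -> reg1 sg -> kernel_reg (fin_kernel ev sg).
Proof.
have rk : reg1 kap by exact/van1_reg1/van1_kap.
move=> he hs c d u; rewrite /fin_kernel; case: eqP => _; first by rewrite inE => /eqP ->.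
case: ifP => _; first by rewrite inE => /eqP ->.
by rewrite !inE => /orP[/eqP ->|/eqP ->].
Qed.

Lemma reg1_opp1 : reg1 (- 1). Proof. exact/reg1N/reg1_1. Qed.

Lemma prim_terms_reg z u : u \in prim_terms z -> reg1 u.1.
Proof.
case: z => k; rewrite /prim_terms => /mapP[t _ ->]; first exact: reg1_1.
exact: reg1_opp1.
Qed.

Lemma aff_kernel_reg : kernel_reg KY.
Proof.
have rk : reg1 kap by exact/van1_reg1/van1_kap.
move=> c d u; rewrite !mem_cat => /or3P[] /mapP[v hv ->] /=.
- exact: (fin_kernel_reg (reg1N reg1_q) reg1_opp1 hv).
- by apply: reg1M => //; exact: prim_terms_reg hv.
- by apply: reg1M; [exact: reg1N|exact: prim_terms_reg hv].
Qed.

(** At q = 1 the eigenvalue ev becomes sg and kap becomes 0, which leaves the signed exchange. *)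
Lemma app_fin_mod ev sg h a b : reg1 ev -> reg1 sg -> van1 (ev - sg) ->
  (forall c d, reg1 (h c d)) -> van1 (app (fin_kernel ev sg) h a b - sg * h b a).
Proof.
move=> he hs hes hh; rewrite app_finE; case: eqP => [->|_].
  by rewrite -mulrBl mulrC; exact: van1Ml.
case: ifP => _; first by rewrite subrr; exact: van1_0.
by rewrite addrAC subrr add0r mulrC; apply: van1Ml => //; exact: van1_kap.
Qed.

Lemma reg1_prim G z : (forall u, reg1 (G u)) -> reg1 (prim G z).
Proof.
move=> hG; rewrite /prim; elim: (prim_terms z) (@prim_terms_reg z) => [|u t IH] ht.
  by rewrite big_nil; exact: reg1_0.
rewrite big_cons; apply: reg1D.
  by apply: reg1M => //; apply: ht; rewrite mem_head.
by apply: IH => v vt; apply: ht; rewrite inE vt orbT.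
Qed.

Lemma app_aff_mod h p p' : (forall c d, reg1 (h c d)) ->
  van1 (app KY h p p' + h p' p).
Proof.
case: p p' => [b1 m1] [b2 m2] hh; rewrite app_affE addrAC.
apply: van1D.
  rewrite -[X in _ + X]mul1r -[X in _ + X * _]opprK mulNr.
  apply: (app_fin_mod (h := fun c d => h (c, m2) (d, m1))) => //.
  - exact/reg1N/reg1_q.
  - exact: reg1_opp1.
  - by rewrite opprK addrC -opprB; exact/van1N/van1_q1.
rewrite mulrC; apply: van1Ml; last exact: van1_kap.
by apply/reg1D/reg1N; exact: reg1_prim.
Qed.

(** * Operators on words and their reduction at q = 1 *)

Definition flip_at (T : Type) (i : nat) (x : nat -> T) : nat -> T :=
  upd2 x i (x i.+1) (x i).

(** The letter at k travels to position r and those in between move one place to the left: the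
    cycles that serve as coset representatives in [dop]. *)
Definition mv (T : Type) (k r : nat) (x : nat -> T) : nat -> T :=
  fun j => if (j < k)%N then x j else if (j < r)%N then x j.+1
           else if j == r then x k else x j.

Lemma mv_id T k (x : nat -> T) : mv k k x = x.
Proof.
apply/funext => j; rewrite /mv; case: ifP => //; case: ltnP => // h _.
by case: eqP => // ->.
Qed.

Lemma flip_mv T k r (x : nat -> T) : (k <= r)%N -> flip_at r (mv k r x) = mv k r.+1 x.
Proof.
move=> kr; apply/funext => j; rewrite /flip_at /upd2 /mv.
case: (j =P r) => [->|jr].
  have -> : (r < k)%N = false by lia.
  have -> : (r.+1 < k)%N = false by lia.
  have -> : (r.+1 < r)%N = false by lia.
  have -> : (r.+1 == r)%N = false by lia.
  by rewrite ltnSn.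
case: (j =P r.+1) => [->|jr1].
  have -> : (r < k)%N = false by lia.
  have -> : (r.+1 < k)%N = false by lia.
  by rewrite !ltnn !eqxx.
case: ifP => // _; have -> // : (j < r.+1)%N = (j < r)%N by lia.
Qed.

Section Words.
Variables A B : Type.
Definition words : lmodType Qq := ((nat -> A) -> (nat -> B) -> Qq^o).
End Words.

Local Notation W := (words int (int * int)).

Definition hX (i : nat) (g : W) : W :=
  fun xa xb => opi KX i (fun xa => g xa xb) xa.
Definition hY (i : nat) (g : W) : W := fun xa xb => opi KY i (g xa) xb.

Lemma opi_lin (T : Type) (K : kernel T) i a (g g' : (nat -> T) -> Qq) x :
  opi K i (fun x => a * g x + g' x) x = a * opi K i g x + opi K i g' x.
Proof. by rewrite /opi app_lin. Qed.

Lemma fin_linE : q^-1 * q^-1 = kap * q^-1 + 1 * 1.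
Proof.
rewrite /kap mulrBl mulfV ?q_neq0 //; ring.
Qed.

Lemma hX_lin i a u v : hX i (a *: u + v) = a *: hX i u + hX i v.
Proof. by apply/funext => xa; apply/funext => xb; exact: opi_lin. Qed.

Lemma hY_lin i a u v : hY i (a *: u + v) = a *: hY i u + hY i v.
Proof. by apply/funext => xa; apply/funext => xb; exact: opi_lin. Qed.

Lemma hX_hY i j w : hX i (hY j w) = hY j (hX i w).
Proof.
apply/funext => xa; apply/funext => xb; rewrite /hX /hY /opi.
exact: (app_sum KX (KY (xb j) (xb j.+1)) (fun u => u.1)
  (fun u c d => w (upd2 xa i c d) (upd2 xb j u.2.1 u.2.2))).
Qed.

Lemma hX_far i j w : (i.+1 < j)%N -> hX i (hX j w) = hX j (hX i w).
Proof. by move=> ij; apply/funext => xa; apply/funext => xb; exact: opi_far. Qed.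

Lemma hY_far i j w : (i.+1 < j)%N -> hY i (hY j w) = hY j (hY i w).
Proof. by move=> ij; apply/funext => xa; apply/funext => xb; exact: opi_far. Qed.

Lemma hX_quadratic i w : hX i (hX i w) = kap *: hX i w + w.
Proof.
apply/funext => xa; apply/funext => xb; rewrite /hX opi_same.
rewrite (fin_quadratic fin_linE (mul1r 1)) /= upd2_id.
by [].
Qed.

Lemma hY_quadratic i w : hY i (hY i w) = kap *: hY i w + w.
Proof.
apply/funext => xa; apply/funext => xb; rewrite /hY opi_same.
by rewrite aff_quadratic upd2_id.
Qed.

Lemma hX_braid i w : hX i (hX i.+1 (hX i w)) = hX i.+1 (hX i (hX i.+1 w)).
Proof.
apply/funext => xa; apply/funext => xb; apply: opi_braid.
exact: (fin_braid fin_linE (mul1r 1)).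
Qed.

Lemma hY_braid i w : hY i (hY i.+1 (hY i w)) = hY i.+1 (hY i (hY i.+1 w)).
Proof.
by apply/funext => xa; apply/funext => xb; apply: opi_braid; exact: aff_braid.
Qed.

Local Notation zp := (zop hX hY).
Local Notation dp := (dop hX hY).
Local Notation bp := (bop hX hY).

Theorem hX_bop r w i : (i < r)%N -> hX i (bp r w) = hY i (bp r w).
Proof.
move=> ir; apply/eqP; rewrite -subr_eq0; apply/eqP.
apply: (uop_bop hX_lin hY_lin hX_hY hX_far hY_far hX_quadratic hY_quadratic
  hX_braid hY_braid w ir).
Qed.

Definition regw (g : W) : Prop := forall xa xb, reg1 (g xa xb).

Lemma regw_zop i g : regw g -> regw (zp i g).
Proof.
move=> hg xa xb; rewrite /zop /hX /hY; apply: reg1_app => [|c d].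
  apply: fin_kernel_reg; [exact: reg1_qV|exact: reg1_1].
by apply: reg1_app => //; exact: aff_kernel_reg.
Qed.

Lemma regw_dop r g : regw g -> regw (dp r g).
Proof.
elim: r g => //= r IH g hg xa xb; apply: reg1D => //.
exact/IH/regw_zop.
Qed.

Lemma regw_bop r g : regw g -> regw (bp r g).
Proof. by elim: r => // r IH hg; exact/regw_dop/IH. Qed.

Lemma zop_mod i g xa xb : regw g ->
  van1 (zp i g xa xb + g (flip_at i xa) (flip_at i xb)).
Proof.
move=> hg; have hYr : regw (hY i g).
  by move=> x y; apply: reg1_app => //; exact: aff_kernel_reg.
have h1 : van1 (zp i g xa xb - 1 * hY i g (flip_at i xa) xb).
  apply: (app_fin_mod (h := fun c d => hY i g (upd2 xa i c d) xb)) => //.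
  - exact: reg1_qV.
  - exact: reg1_1.
  - exact: van1_qV1.
have h2 : van1 (hY i g (flip_at i xa) xb + g (flip_at i xa) (flip_at i xb)).
  exact: (app_aff_mod (h := fun c d => g (flip_at i xa) (upd2 xb i c d))).
have := van1D h1 h2; rewrite mul1r; set a := zp i g _ _; set b := hY _ _ _ _.
by set c := g _ _; rewrite -[a - b + _]/((a : Qq) - b + (b + c)) addrA subrK.
Qed.

(** Modulo q - 1 the terms of [dop] are, up to sign, the values of g at the words with one letter
    moved to position r. *)
Lemma dop_mod r g xa xb : regw g ->
  (forall k, (k <= r)%N -> van1 (g (mv k r xa) (mv k r xb))) -> van1 (dp r g xa xb).
Proof.
elim: r g => [|r IH] g hg hm; first by have := hm 0%N isT; rewrite !mv_id.
apply: van1D; first by have := hm r.+1 (leqnn _); rewrite !mv_id.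
apply: IH => [|k kr]; first exact: regw_zop.
have := zop_mod r (mv k r xa) (mv k r xb) hg; rewrite !flip_mv //.
move=> /van1D/(_ (van1N (hm k (leqW kr)))).
by set a := zp _ _ _ _; set b := g _ _; rewrite -[a + b + _]/((a : Qq) + b - b) addrK.
Qed.

(** * Independence of the ordered monomials *)

Section Independence.
Variables (n l : nat) (s : int).
Hypotheses (n0 : (0 < n)%N) (l0 : (0 < l)%N).
Local Notation bp := (bop hX hY).

(** Functionals see the whole semi-infinite word, so the limit identifications hold for them on the
    nose and only the straightening rules remain. *)
Definition padseq (x : seq int) : nat -> int := fun i => nth (s - i%:Z) x i.

Definition enc_a (y : nat -> int) : nat -> int := fun j => ares n (y j).
Definition enc_b (y : nat -> int) : nat -> int * int :=
  fun j => (bres n l (y j), mres n l (y j)).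

Lemma enc_inj y y' : enc_a y = enc_a y' -> enc_b y = enc_b y' -> y = y'.
Proof.
move=> ha hb; apply/funext => j; rewrite (abm_eq n l (y j)) (abm_eq n l (y' j)).
have := congr1 (fun f => f j) ha; have := congr1 (fun f => f j) hb.
by rewrite /enc_a /enc_b => -[-> ->] ->.
Qed.

Definition delta_word (y0 : nat -> int) : W := fun xa xb =>
  if `[< xa = enc_a y0 /\ xb = enc_b y0 >] then 1 else 0.

Lemma delta_wordE y0 y : delta_word y0 (enc_a y) (enc_b y) = (`[< y = y0 >])%:R :> Qq.
Proof.
rewrite /delta_word; case: asboolP => [[h1 h2]|h]; case: asboolP => //.
  by move/(_ (enc_inj h1 h2)).
by move=> yy; case: h; rewrite yy.
Qed.

Definition decr_upto (r : nat) (y : nat -> int) := forall i, (i < r)%N -> y i.+1 < y i.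

(** A letter moved past smaller ones to position r + 1 creates an ascent there, so the moved word is
    not [y0]. Its letters up to position r still decrease, and induction applies; only the unmoved
    term survives modulo q - 1. *)
Lemma bop_delta_mod y0 r y : (forall i, y0 i.+1 < y0 i) -> decr_upto r y ->
  van1 (bp r (delta_word y0) (enc_a y) (enc_b y) - (`[< y = y0 >])%:R).
Proof.
move=> hy0; have hd : regw (delta_word y0).
  move=> xa xb; rewrite /delta_word; case: ifP => _; [exact: reg1_1|exact: reg1_0].
elim: r y => [|r IH] y hy.
  by rewrite /= delta_wordE subrr; exact: van1_0.
rewrite [bop _ _ _ _]/=; set G := bp r _.
have hG : regw G by exact: regw_bop.
have h1 : van1 (G (enc_a y) (enc_b y) - (`[< y = y0 >])%:R).
  by apply: IH => i ir; apply: hy; exact: ltnW.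
have h2 : van1 (dop hX hY r (zop hX hY r G) (enc_a y) (enc_b y)).
  apply: dop_mod => [|k kr]; first exact: regw_zop.
  have := zop_mod r (mv k r (enc_a y)) (mv k r (enc_b y)) hG; rewrite !flip_mv //.
  pose y' := mv k r.+1 y.
  have -> : mv k r.+1 (enc_a y) = enc_a y'.
    by apply/funext => j; rewrite /y' /mv /enc_a; do 3!case: ifP => // _.
  have -> : mv k r.+1 (enc_b y) = enc_b y'.
    by apply/funext => j; rewrite /y' /mv /enc_b; do 3!case: ifP => // _.
  have hy' : decr_upto r y'.
    move=> i ir; rewrite /y' /mv.
    have [-> ->] : ((i.+1 < r.+1)%N = true) * ((i < r.+1)%N = true) by split; lia.
    case: ltnP => [ik|ik]; first by rewrite (ltnW ik); apply: hy; lia.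
    case: ltnP => ik'; last by apply: hy; lia.
    by apply: (lt_trans (y := y i.+1)); apply: hy; lia.
  have y'0 : y' <> y0.
    move=> e; have := hy0 r; rewrite -e /y' /mv !ltnn eqxx.
    have -> : (r.+1 < k)%N = false by lia.
    rewrite ltnSn; case: ltnP => [|_]; first by lia.
    suff h : forall m, (k <= m)%N -> (m <= r)%N -> y m.+1 < y k.
      by move=> h'; have := lt_trans h' (h r kr (leqnn _)); rewrite ltxx.
    elim=> [|m IHm] km mr; first by have -> : k = 0%N by [lia]; apply: hy.
    have [e'|km'] := eqVneq k m.+1; first by rewrite e'; apply: hy.
    by apply: lt_trans (IHm _ _); [apply: hy|lia|lia].
  have := IH y' hy'; case: asboolP => // _; rewrite subr0 => hv /van1D/(_ (van1N hv)).
  by set a := zop _ _ _ _ _ _; set b := bp _ _ _ _;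
    rewrite -[a + b - b]/((a : Qq) + b - b) addrK.
have := van1D h1 h2; set a := G _ _; set b := dop _ _ _ _ _ _.
move=> h; rewrite -[_ + _ - _]/((a : Qq) + b - (`[< y = y0 >])%:R).
by rewrite addrAC.
Qed.

Lemma straighten_linear (V V' : lmodType Qq) (f : V -> V') (h : int -> int -> V) k1 k2 :
  (forall u v, f (u + v) = f u + f v) -> (forall a u, f (a *: u) = a *: f u) ->
  k1 <= k2 -> f (straighten n l h k1 k2) = straighten n l (fun c d => f (h c d)) k1 k2.
Proof.
move=> fD fZ k12; have [t [_ tE]] := straighten_form n0 l0 k12.
have f0 : f 0 = 0 by rewrite -(scale0r 0) fZ scale0r.
rewrite !tE fD fZ /wsum; congr (_ + _).
by elim: t {tE} => [|u t IH]; rewrite ?big_nil // !big_cons fD fZ IH.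
Qed.

Definition word_eval (g : W) (x : seq int) : Qq^o :=
  g (enc_a (padseq x)) (enc_b (padseq x)).

Lemma padseq_upd x c d k1 k2 y : padseq (x ++ [:: c; d] ++ y) =
  upd2 (padseq (x ++ [:: k1; k2] ++ y)) (size x) c d.
Proof.
apply/funext => j; rewrite /padseq /upd2 !nth_cat.
case: (j =P size x) => [->|jx]; first by rewrite ltnn subnn.
case: (j =P (size x).+1) => [->|jx'].
  have -> : ((size x).+1 < size x)%N = false by lia.
  by rewrite subSn ?subnn.
case: (ltnP j (size x)) => // h.
have -> : (j - size x = (j - (size x).+2).+2)%N by lia.
by [].
Qed.

(** A rule changes one adjacent pair, so agreement of the operators at that place suffices; the
    bound on r therefore depends on the relation. *)
Lemma relation_vanish v : wedge_rel n l s v -> exists r0, forall r g, (r0 <= r)%N ->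
  (forall i, (i < r)%N -> hX i g = hY i g) -> lincomb (word_eval g) v = 0.
Proof.
case=> [x y k1 k2 k12|x].
  exists (size x).+1 => r g xr hg.
  rewrite lincombB straighten_linear //; first last.
  - by move=> a u; rewrite lincombZ.
  - by move=> u u'; rewrite lincombD.
  have lm z : lincomb (word_eval g) (mono z) = word_eval g z.
    by rewrite /mono lincombU scale1r.
  rewrite lm; have -> : (fun c d => lincomb (word_eval g) (mono (x ++ [:: c; d] ++ y))) =
     (fun c d => word_eval g (x ++ [:: c; d] ++ y)).
    by apply/funext => c; apply/funext => d; rewrite lm.
  pose pad0 := padseq (x ++ [:: k1; k2] ++ y).
  pose H a a' p p' : Qq := g (upd2 (enc_a pad0) (size x) a a')
     (upd2 (enc_b pad0) (size x) p p').
  have hH : hecke_equal H.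
    move=> a a' p p'; have := hg (size x) xr.
    move/(congr1 (fun f : W => f (upd2 (enc_a pad0) (size x) a a')
       (upd2 (enc_b pad0) (size x) p p'))).
    rewrite /hX /hY /opi !upd2l !upd2r => h.
    have -> : app (fin_kernel q^-1 1) (fun a a' => H a a' p p') a a' =
      app (fin_kernel q^-1 1) (fun c d => g (upd2 (upd2 (enc_a pad0) (size x) a a')
        (size x) c d) (upd2 (enc_b pad0) (size x) p p')) a a'.
      by apply: eq_app => c d; rewrite upd2_same.
    by rewrite h; apply: eq_app => c d; rewrite upd2_same.
  have := hecke_alternating n0 l0 hH k12; rewrite /straightens.
  have -> : letters n l H = (fun c d => word_eval g (x ++ [:: c; d] ++ y)).
    apply/funext => c; apply/funext => d; rewrite /letters /H /word_eval.
    rewrite (padseq_upd x c d k1 k2 y) -/pad0; congr g; apply/funext => j;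
    by rewrite /enc_a /enc_b /upd2; do 2!case: ifP => // _.
  by move=> ->; rewrite subrr.
exists 0%N => r g _ _; rewrite lincombB /mono !lincombU !scale1r.
rewrite /word_eval; suff -> : padseq (rcons x (s - (size x)%:Z)) = padseq x by rewrite subrr.
apply/funext => j; rewrite /padseq nth_rcons; case: ltngtP => // h.
  by rewrite nth_default // ltnW.
by rewrite h nth_default.
Qed.

Lemma kernel_vanish v : v \in wedge_ker n l s -> exists r0, forall r g, (r0 <= r)%N ->
  (forall i, (i < r)%N -> hX i g = hY i g) -> lincomb (word_eval g) v = 0.
Proof.
move=> /asboolP[t tP ->]; elim: t tP => [|u t IH] tP.
  by exists 0%N => r g _ _; rewrite big_nil lincomb0.
have [_ /relation_vanish[r1 h1]] := tP u (mem_head _ _).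
have [|r2 h2] := IH; first by move=> w wt; apply: tP; rewrite inE wt orbT.
exists (maxn r1 r2) => r g; rewrite geq_max => /andP[hr1 hr2] hg.
by rewrite big_cons lincombD lincombZ (h1 r) // (h2 r) // scaler0 addr0.
Qed.

Lemma kseq_decr (lam : intpart) i : kseq lam s i.+1 < kseq lam s i.
Proof.
clear n0 l0; rewrite /kseq.
suff : (nth 0%N lam i.+1 <= nth 0%N lam i)%N by lia.
case: lam => p /= /andP[ps _]; case: (ltnP i.+1 (size p)) => h; last first.
  by rewrite (nth_default 0%N h).
have ps' : sorted (fun x y => geq x y) p by [].
by apply: (sorted_ltn_nth (leT := geq) _ 0%N ps); rewrite ?inE //; [move=> a b c; rewrite /geq /= => h1 h2; exact: leq_trans h2 h1|lia].
Qed.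

Lemma padseq_ket (lam : intpart) : padseq (mkseq (kseq lam s) (size lam)) = kseq lam s.
Proof.
apply/funext => j; rewrite /padseq; case: (ltnP j (size lam)) => h.
  by rewrite nth_mkseq.
by rewrite nth_default ?size_mkseq // /kseq (nth_default 0%N h) add0r.
Qed.

Lemma kseq_inj (lam mu : intpart) : kseq lam s = kseq mu s -> lam = mu.
Proof.
move=> h; have hn i : nth 0%N lam i = nth 0%N mu i.
  by have := congr1 (fun f => f i) h; rewrite /kseq => /addIr/addIr[].
apply: val_inj; case: lam mu {h} hn => p hp [r hr] /= hn.
have sz (u v : seq nat) : (0%N \notin u) -> (forall i, nth 0%N u i = nth 0%N v i) ->
    (size u <= size v)%N.
  move=> u0 e; rewrite leqNgt; apply/negP => vu.
  by move: u0; rewrite -{1}(nth_default 0%N (leqnn (size v))) -e mem_nth.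
case/andP: hp => _ hp; case/andP: hr => _ hr.
apply: (@eq_from_nth _ 0%N) => //; apply/eqP; rewrite eqn_leq !sz //.
Qed.

(** A coefficient of least valuation at q = 1 divides all the others in the local ring. *)
Lemma valuation_min (I : choiceType) (c : {malg Qq[I]}) : c != 0 ->
  exists i, c@_i != 0 /\ forall j, reg1 (c@_j / c@_i).
Proof.
move=> c0; have : (msupp c : seq I) != [::].
  apply: contra c0 => /eqP h; apply/eqP/malgP => i; rewrite mcoeff0; apply/eqP.
  rewrite mcoeff_eq0; apply/negP => hi.
  by have : i \in (msupp c : seq I) by []; rewrite h.
have hs i : i \in (msupp c : seq I) -> c@_i != 0 by rewrite mcoeff_neq0.
suff : forall t : seq I, t != [::] -> {in t, forall i, c@_i != 0} ->
   exists2 i, i \in t & {in t, forall j, reg1 (c@_j / c@_i)}.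
  move=> H sc; have [i ii hi] := H _ sc hs; exists i; split; first exact: hs.
  move=> j; case: (boolP (j \in msupp c)) => hj; first exact: hi.
  by rewrite (mcoeff_outdom hj) mul0r; exact: reg1_0.
elim=> // i t IH _ hit; have ci : c@_i != 0 by apply: hit; rewrite mem_head.
have ht : {in t, forall i, c@_i != 0} by move=> j jt; apply: hit; rewrite inE jt orbT.
case: (eqVneq t [::]) => [t0|t0].
  exists i; first exact: mem_head.
  by move=> j; rewrite t0 inE => /eqP ->; rewrite divff //; exact: reg1_1.
have [k kt hk] := IH t0 ht; have ck := ht k kt.
have [h|h] := reg1_or_van1V (c@_i / c@_k).
  exists k; first by rewrite inE kt orbT.
  by move=> j; rewrite inE => /orP[/eqP ->//|]; exact: hk.
exists i; first exact: mem_head.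
move=> j; rewrite inE => /orP[/eqP ->|/hk hj].
  by rewrite (divff ci); exact: reg1_1.
have e (F : fieldType) (x y z : F) : y != 0 -> x / z = (x / y) * (z / y)^-1.
  by move=> y0; rewrite invf_div mulrA divfK.
rewrite (e _ _ _ _ ck); exact: (reg1M hj (van1_reg1 h)).
Qed.

(* Normalise a relation so that its coefficients are regular at q = 1 and one
   of them is 1, then read off that coefficient modulo q - 1. *)
Theorem ket_free (c : {malg Qq[intpart]}) : lincomb (ket n l s) c = 0 -> c = 0.
Proof.
move=> hc; apply/eqP; case: eqP => // /eqP c0.
pose w : free_wedge := lincomb (fun lam : intpart => mono (mkseq (kseq lam s) (size lam))) c.
have wE : wedge_pi n l s w = lincomb (ket n l s) c.
  rewrite /w /lincomb; elim: (msupp c : seq _) => [|lam t IH].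
    rewrite !big_nil; apply: (addrI (wedge_pi n l s 0)).
    by rewrite -wedge_piD !addr0.
  by rewrite !big_cons wedge_piD wedge_piZ IH.
have wk : w \in wedge_ker n l s.
  rewrite -[w]subr0; apply/wedge_piE; rewrite wE hc; apply: (addrI (wedge_pi n l s 0)).
  by rewrite -wedge_piD !addr0.
have [r hr] := kernel_vanish wk; have [lam [lam0 hlam]] := valuation_min c0.
pose g := bp r (delta_word (kseq lam s)).
have := hr r g (leqnn _) (fun i ir => hX_bop _ ir).
have gE mu : word_eval g (mkseq (kseq mu s) (size mu)) = g (enc_a (kseq mu s)) (enc_b (kseq mu s)).
  by rewrite /word_eval padseq_ket.
have -> : lincomb (word_eval g) w = \sum_(mu <- msupp c) c@_mu * g (enc_a (kseq mu s)) (enc_b (kseq mu s)).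
  rewrite /w [X in lincomb (word_eval g) X]/lincomb lincomb_sum; apply: eq_bigr => mu _.
  by rewrite lincombZ /mono lincombU scale1r gE.
move=> h0; exfalso; apply: van1_1.
have dk mu : decr_upto r (kseq mu s) by move=> i _; exact: kseq_decr.
have hm mu := bop_delta_mod (kseq_decr lam) (dk mu).
(* The values of g sum to 0 against c and the delta terms pick out lam, so 1 becomes a combination
   of elements of the maximal ideal with regular coefficients. *)
have -> : 1 = - \sum_(mu <- msupp c) c@_mu / c@_lam *
    (g (enc_a (kseq mu s)) (enc_b (kseq mu s)) - (`[< kseq mu s = kseq lam s >])%:R).
  under eq_bigr => mu _ do rewrite mulrBr.
  rewrite sumrB; under eq_bigr => mu _ do rewrite mulrAC.
  rewrite -mulr_suml h0 mul0r sub0r opprK.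
  rewrite (big_fsetD1 lam) /=; last by rewrite -mcoeff_neq0.
  rewrite asboolT // mulr1 divff // big_seq big1 ?addr0 // => mu.
  rewrite !inE => /andP[ml _]; case: asboolP; last by rewrite mulr0.
  by move/kseq_inj => e; rewrite e eqxx in ml.
apply: van1N; rewrite big_seq; elim/big_rec: _ => [|mu x _ hx]; first exact: van1_0.
by apply: van1D hx; apply: van1Ml.
Qed.

End Independence.

(** * Spanning *)

Definition sumw (x : seq int) : int := \sum_(c <- x) c.
Definition sqw (x : seq int) : int := \sum_(c <- x) c ^+ 2.

(* The termination measure: exchanging the pair c < d or replacing it by an
   inner pair lowers the sum of i x_i. *)
Fixpoint wt (lo : int) (x : seq int) : int :=
  if x is _ :: x' then wt lo x' + \sum_(d <- x') (d - lo) else 0.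

Lemma wt_ge0 (lo : int) (x : seq int) : all (fun c => lo <= c) x -> 0 <= wt lo x.
Proof.
elim: x => //= c x IH /andP[_ hx]; apply: addr_ge0; first exact: IH.
by rewrite big_seq; apply: sumr_ge0 => d dx; rewrite subr_ge0 (allP hx).
Qed.

Lemma wt_cat lo x u u' : \sum_(d <- u) (d - lo) = \sum_(d <- u') (d - lo) ->
  wt lo (x ++ u) - wt lo (x ++ u') = wt lo u - wt lo u'.
Proof.
by move=> h; elim: x => //= c x <-; rewrite !big_cat h /=; ring.
Qed.

Lemma wt_pair (lo : int) (x : seq int) (c d c' d' : int) (y : seq int) : c + d = c' + d' ->
  wt lo (x ++ [:: c'; d'] ++ y) = wt lo (x ++ [:: c; d] ++ y) + (d' - d).
Proof.
move=> h; apply/eqP; rewrite addrC -subr_eq wt_cat /= ?big_cons; last lia.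
by apply/eqP; ring.
Qed.

Lemma not_sortedP (x : seq int) : ~~ sorted (fun a b => b < a) x ->
  exists y c d z, x = y ++ [:: c; d] ++ z /\ c <= d.
Proof.
elim: x => // c [//|d x] IH /=; rewrite negb_and -leNgt => /orP[cd|h].
  by exists [::], c, d, x.
have [y [c' [d' [z [-> cd]]]]] := IH h.
by exists (c :: y), c', d', z.
Qed.

Section Umono.
Variables (n l : nat) (s : int).
Hypotheses (n0 : (0 < n)%N) (l0 : (0 < l)%N).
Local Notation U := (umono n l s).
Local Notation wedge := (wedge n l s).
Local Notation lead := (lead n l).

Lemma wedge_pi0 : wedge_pi n l s 0 = 0.
Proof. by apply: (addrI (wedge_pi n l s 0)); rewrite -wedge_piD !addr0. Qed.

Lemma wedge_pi_ker v : v \in wedge_ker n l s -> wedge_pi n l s v = 0.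
Proof. by move=> hv; rewrite -wedge_pi0; apply/wedge_piE; rewrite subr0. Qed.

Lemma wedge_pi_rel v : wedge_rel n l s v -> wedge_pi n l s v = 0.
Proof.
move=> hv; apply: wedge_pi_ker; apply/asboolP; rewrite -[v]scale1r.
exact: lspan_in.
Qed.

Lemma wedge_piB u v : wedge_pi n l s (u - v) = wedge_pi n l s u - wedge_pi n l s v.
Proof.
by apply: (addIr (wedge_pi n l s v)); rewrite -wedge_piD !subrK.
Qed.

Lemma umono_alternating x y :
  alternating n l (fun c d => U (x ++ [:: c; d] ++ y) : wedge).
Proof.
move=> k1 k2 k12; have := wedge_pi_rel (@Rel_straighten n l s x y k1 k2 k12).
rewrite wedge_piB => /eqP; rewrite subr_eq0 => /eqP h; rewrite /straightens [LHS]h.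
exact: (straighten_linear n0 l0 (V := free_wedge) (V' := wedge) _ (@wedge_piD n l s)
  (@wedge_piZ n l s) k12).
Qed.

Lemma umono_rcons x : U (rcons x (s - (size x)%:Z)) = U x.
Proof.
have := wedge_pi_rel (@Rel_limit n l s x); rewrite wedge_piB => /eqP.
by rewrite subr_eq0 => /eqP.
Qed.

Lemma umono_step (k1 k2 : int) : k1 < k2 -> exists t : seq wterm,
  (forall u, u \in t -> inner_term n l k1 k2 u) /\
  forall x y : seq int, U (x ++ [:: k1; k2] ++ y) = lead k1 k2 *: U (x ++ [:: k2; k1] ++ y)
    + \sum_(u <- t) u.1 *: U (x ++ [:: u.2.1; u.2.2] ++ y).
Proof.
move=> k12; have [t [tP tE]] := straighten_form n0 l0 (ltW k12).
exists t; split=> // x y; rewrite (umono_alternating x y (ltW k12)) tE.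
by [].
Qed.

Lemma umono_same x k y : U (x ++ [:: k; k] ++ y) = 0.
Proof.
have := umono_alternating x y (lexx k); rewrite straightens_same //.
Qed.

Lemma lead_laurent k1 k2 : laurent (lead k1 k2).
Proof. exact/laurent_opp/laurent_exprz. Qed.

Definition word_span (P : seq int -> Prop) : set wedge :=
  lspan laurent (fun v => exists2 y, P y & v = U y).

Lemma word_span_sub (P Q : seq int -> Prop) v :
  (forall y, P y -> word_span Q (U y)) -> word_span P v -> word_span Q v.
Proof.
move=> PQ; apply: lspan_sub; first exact: laurent_mul.
by move=> u [y Py ->]; exact: PQ.
Qed.

Lemma word_span_in (P : seq int -> Prop) y : P y -> word_span P (U y).
Proof.
by move=> Py; rewrite -[U y]scale1r; apply: lspan_in; [exact: laurent1|exists y].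
Qed.

Lemma word_spanZ (P : seq int -> Prop) a v : laurent a -> word_span P v ->
  word_span P (a *: v).
Proof. by move=> la; apply: lspanZ => //; exact: laurent_mul. Qed.

(** Length, sum and lower bound are respected by the rules, and only finitely many words share
    them. *)
Definition window (lo : int) (x y : seq int) : Prop :=
  [/\ size y = size x, sumw y = sumw x & all (fun c => lo <= c) y].

Lemma window_pair (lo : int) x (k1 k2 : int) u y : k1 < k2 -> inner_term n l k1 k2 u ->
  all (fun c => lo <= c) (x ++ [:: k1; k2] ++ y) ->
  window lo (x ++ [:: k1; k2] ++ y) (x ++ [:: u.2.1; u.2.2] ++ y) /\
  sqw (x ++ [:: u.2.1; u.2.2] ++ y) < sqw (x ++ [:: k1; k2] ++ y).
Proof.
clear n0 l0; move=> k12 [[_ h1 h2 h3] [h4 _ _]]; rewrite !all_cat => /andP[hx /andP[hk hy]].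
move: hk => /= /and3P[hk1 hk2 _].
have h5 : u.2.1 ^+ 2 + u.2.2 ^+ 2 < k1 ^+ 2 + k2 ^+ 2.
  have -> : u.2.1 = k1 + k2 - u.2.2 by lia.
  rewrite -subr_gt0; have -> : k1 ^+ 2 + k2 ^+ 2 - ((k1 + k2 - u.2.2) ^+ 2 + u.2.2 ^+ 2)
    = 2 * ((u.2.2 - k1) * (k2 - u.2.2)) by ring.
  by rewrite !mulr_gt0 // subr_gt0 //; lia.
rewrite /window /sumw /sqw !size_cat !big_cat !big_cons ?big_nil !all_cat /=.
split; first split=> //.
- by congr (_ + _); rewrite !addrA h4.
- have l1 : lo <= u.2.2 := le_trans hk1 (ltW h1).
  by rewrite hx hy l1 (le_trans l1 (ltW h2)).
by rewrite ltrD2l !addrA ltrD2r.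
Qed.

(** Each application of a rule lowers [wt], which stays nonnegative because all letters remain at
    least lo. The bound on [sqw] is carried along for the triangularity of the bar map. *)
Theorem umono_span (lo : int) (x : seq int) : all (fun c => lo <= c) x ->
  word_span (fun y => [/\ sorted (fun a b => b < a) y, window lo x y & sqw y <= sqw x]) (U x).
Proof.
have [m] := ubnP (absz (wt lo x)); elim: m x => // m IH x hm hx.
have [sx|] := boolP (sorted (fun a b : int => b < a) x).
  by apply: word_span_in; split.
move=> /not_sortedP[y [c [d [z [xE cd]]]]].
move: cd; rewrite le_eqVlt => /orP[/eqP cd|cd].
  by rewrite xE cd umono_same; exact: lspan0.
have [t [tP tE]] := umono_step cd; rewrite xE tE.
have tot (c' d' : int) : c + d = c' + d' -> all (fun c => lo <= c) (y ++ [:: c'; d'] ++ z) ->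
    d' < d -> (absz (wt lo (y ++ [:: c'; d'] ++ z)) < m)%N.
  move=> e ha hd; have := wt_ge0 ha; have := wt_pair lo y z e; rewrite -xE.
  by have := wt_ge0 hx; lia.
have sim u v : window lo u v -> (forall w, window lo v w -> window lo u w).
  by move=> [e1 e2 e3] w [f1 f2 f3]; split; rewrite ?f1 ?f2.
apply: lspanD.
  apply: word_spanZ; first exact: lead_laurent.
  have hdc : all (fun c => lo <= c) (y ++ [:: d; c] ++ z).
    by move: hx; rewrite xE !all_cat /= => /and3P[-> /and3P[-> -> _] ->].
  apply: word_span_sub (IH _ (tot _ _ (addrC _ _) hdc cd) hdc) => w [w1 w2 w3].
  apply: word_span_in; split=> //.
    apply: sim w2; split=> //; first by rewrite !size_cat.
    by rewrite /sumw !big_cat !big_cons /=; congr (_ + _); rewrite addrCA.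
  by move: w3; rewrite /sqw !big_cat !big_cons /= [d ^+ 2 + _]addrCA.
apply: lspan_sum => u ut; have hu := tP u ut.
apply: word_spanZ; first by case: hu => -[].
rewrite xE in hx; have [sm sq] := window_pair cd hu hx; have [_ _ hu3] := sm.
have [[_ u1 u2 u3] [u4 _ _]] := hu.
apply: word_span_sub (IH _ (tot _ _ _ hu3 _) hu3); last 2 first.
- by rewrite u4.
- by lia.
move=> w [w1 w2 w3]; apply: word_span_in; split=> //; first exact: sim w2.
by apply: le_trans w3 (ltW sq).
Qed.

End Umono.

Lemma sorted_lower (y : seq int) (s : int) : sorted (fun a b : int => b < a) y ->
  all (fun c => s - (size y)%:Z + 1 <= c) y ->
  forall i, (i < size y)%N -> s - i%:Z <= nth (0 : int) y i.
Proof.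
elim: y s => // a y IH s /= hs /andP[ha hy].
have IH' i : (i < size y)%N -> s - 1 - i%:Z <= nth (0 : int) y i.
  apply: IH; first exact: path_sorted hs.
  by apply: sub_all hy => c /=; lia.
case=> [_|i] /=; last by move=> /IH'; lia.
case: y hs {IH} ha hy IH' => [|b y] /= hs ha _ IH'; first by lia.
by move: hs => /andP[hs _]; have := IH' 0%N isT => /=; lia.
Qed.

(** The zeros of a weakly decreasing sequence come last, where 0 is the default value anyway. *)
Lemma nth_filter_geq (p : seq nat) i : sorted geq p ->
  nth 0%N [seq k <- p | k != 0%N] i = nth 0%N p i.
Proof.
elim: p i => // a p IH i hs /=; have hp := path_sorted hs.
case: eqP => [a0|_] /=; last by case: i => //= i; exact: IH.
have p0 : forall j, nth 0%N p j = 0%N.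
  move=> j; case: (ltnP j (size p)) => hj; last by rewrite nth_default.
  have tr : transitive geq by move=> b c d h1 h2; exact: leq_trans h2 h1.
  have := order_path_min tr hs => /allP/(_ _ (mem_nth 0%N hj)).
  by rewrite a0 /geq /= leqn0 => /eqP.
by rewrite IH // p0 a0; case: i => //= i; rewrite p0.
Qed.

(** * Truncations of semi-infinite words *)

Section Pad.
Variable s : int.

Definition pad (R : nat) (x : seq int) : seq int := mkseq (padseq s x) R.

Lemma size_pad R x : size (pad R x) = R.
Proof. exact: size_mkseq. Qed.

Lemma padS R x : (size x <= R)%N -> pad R.+1 x = rcons (pad R x) (s - R%:Z).
Proof.
by move=> xR; rewrite /pad mkseqS /padseq nth_default.
Qed.

Lemma pad_self x : pad (size x) x = x.
Proof.
apply: (@eq_from_nth _ 0); rewrite size_pad // => i ix.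
by rewrite nth_mkseq // /padseq; exact: set_nth_default.
Qed.

Lemma pad_cat R x : (size x <= R)%N ->
  pad R x = x ++ [seq s - i%:Z | i <- iota (size x) (R - size x)].
Proof.
move=> xR; apply: (@eq_from_nth _ 0).
  by rewrite size_pad size_cat size_map size_iota subnKC.
rewrite size_pad => i iR; rewrite nth_mkseq // /padseq nth_cat.
case: ltnP => ix; first exact: set_nth_default.
have h : (i - size x < R - size x)%N.
  by rewrite ltn_sub2r // (leq_ltn_trans ix).
by rewrite nth_default // (nth_map 0%N) ?size_iota // nth_iota // subnKC.
Qed.

Lemma sorted_ket (y : seq int) : sorted (fun a b : int => b < a) y ->
  all (fun c => s - (size y)%:Z + 1 <= c) y ->
  exists lam : intpart, (size lam <= size y)%N /\ y = mkseq (kseq lam s) (size y).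
Proof.
move=> hs hy; have low := sorted_lower hs hy.
pose p := mkseq (fun i => absz (nth (0 : int) y i - s + i%:Z)) (size y).
have ps : sorted geq p.
  apply/(sortedP 0%N) => i; rewrite size_mkseq => hi.
  rewrite !nth_mkseq //; last exact: ltnW.
  have h1 := low i (ltnW hi); have h2 := low i.+1 hi.
  have : nth (0 : int) y i.+1 < nth (0 : int) y i by move/(sortedP 0): hs => /(_ i hi).
  by rewrite /geq /=; lia.
have tr : transitive geq by move=> b c d h1 h2; exact: leq_trans h2 h1.
have hp : sorted geq [seq k <- p | k != 0%N] && (0%N \notin [seq k <- p | k != 0%N]).
  by rewrite sorted_filter //= mem_filter eqxx.
exists (IntPart hp) => /=; split.
  by rewrite size_filter (leq_trans (count_size _ _)) // size_mkseq.
apply: (@eq_from_nth _ 0); first by rewrite size_mkseq.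
move=> i iy; rewrite nth_mkseq // /kseq /= nth_filter_geq // nth_mkseq //.
by have := low i iy; lia.
Qed.

Lemma pad_ket R (lam : intpart) :
  pad R (mkseq (kseq lam s) (size lam)) = mkseq (kseq lam s) R.
Proof. by rewrite /pad padseq_ket. Qed.

Lemma kseq_sorted (lam : intpart) R : sorted (fun a b : int => b < a) (mkseq (kseq lam s) R).
Proof.
apply/(sortedP 0) => i; rewrite size_mkseq => hi.
by rewrite !nth_mkseq ?(ltnW hi) //; exact: kseq_decr.
Qed.

End Pad.

Lemma telescope_step (V : lmodType Qq) (A B C S : V) (x y : Qq) :
  B = x *: C + S -> A - (x * y) *: C = (A - y *: B) + y *: S.
Proof. by move=> ->; lmod. Qed.

(** * Moving letters through a word *)

Section Moves.
Variables (n l : nat) (s : int).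
Hypotheses (n0 : (0 < n)%N) (l0 : (0 < l)%N).
Local Notation U := (umono n l s).
Local Notation wedge := (wedge n l s).
Local Notation lead := (lead n l).
Local Notation word_span := (@word_span n l s).

Lemma umono_pad R x : (size x <= R)%N -> U (pad s R x) = U x.
Proof.
elim: R => [|R IH]; rewrite leq_eqVlt => /orP[/eqP xR|xR].
- by rewrite -xR pad_self.
- by [].
- by rewrite -xR pad_self.
by rewrite padS // -(IH xR) -{2}(size_pad s R x) umono_rcons.
Qed.

Definition leadprod (a : int) (ys : seq int) : Qq := \prod_(y <- ys) lead y a.

Lemma leadprod_laurent a ys : laurent (leadprod a ys).
Proof.
by rewrite /leadprod; elim/big_ind: _ => *; [exact: laurent1|exact: laurent_mul|exact: lead_laurent].
Qed.

(** All letters of ys are below a, so every exchange is the leading term of a rule whose inner terms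
    have smaller [sqw]; the scalars multiply to [leadprod]. *)
Lemma move_left (lo a : int) (x ys y : seq int) : all (fun c => c < a) ys ->
  all (fun c => lo <= c) (x ++ ys ++ a :: y) ->
  word_span (fun z => window lo (x ++ ys ++ a :: y) z /\ sqw z < sqw (x ++ ys ++ a :: y))
    (U (x ++ ys ++ a :: y) - leadprod a ys *: U (x ++ a :: ys ++ y)).
Proof.
elim: ys x => [|b ys IH] x /=.
  by move=> _ _; rewrite /leadprod big_nil scale1r subrr; exact: lspan0.
move=> /andP[ba hys] hx.
have hx' : all (fun c => lo <= c) (rcons x b ++ ys ++ a :: y) by rewrite cat_rcons.
have := IH (rcons x b) hys hx'; rewrite !cat_rcons => h1.
have [t [tP tE]] := umono_step s n0 l0 ba.
have e := tE x (ys ++ y); rewrite /= in e.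
rewrite /leadprod big_cons -/(leadprod a ys).
rewrite (telescope_step (U (x ++ b :: ys ++ a :: y)) (leadprod a ys) e).
apply: lspanD; first exact: h1.
apply: word_spanZ; first exact: leadprod_laurent.
apply: lspan_sum => u ut; have hu := tP u ut; apply: word_spanZ; first by case: hu => -[].
have sq : sqw (x ++ b :: a :: ys ++ y) = sqw (x ++ b :: ys ++ a :: y).
  by rewrite /sqw; apply: perm_big; rewrite !perm_cat2l perm_cons -cat1s perm_catCA.
have su : sumw (x ++ b :: a :: ys ++ y) = sumw (x ++ b :: ys ++ a :: y).
  by rewrite /sumw; apply: perm_big; rewrite !perm_cat2l perm_cons -cat1s perm_catCA.
have hx2 : all (fun c => lo <= c) (x ++ [:: b; a] ++ ys ++ y).
  rewrite (@perm_all _ _ (x ++ b :: ys ++ a :: y)) //.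
  by rewrite perm_cat2l perm_cons -[a :: _]cat1s perm_catCA.
have [[s1 s2 s3] sq2] := window_pair ba hu hx2.
apply: word_span_in; split; last by rewrite -sq.
split=> [||//]; last by rewrite s2 -su.
by rewrite s1 !size_cat /= !size_cat /= !addnS.
Qed.


Lemma window_perm (lo : int) (u v z : seq int) : perm_eq u v -> window lo u z -> window lo v z.
Proof.
clear n0 l0; move=> uv [h1 h2 h3]; split=> //; first by rewrite h1 (perm_size uv).
by rewrite h2 /sumw; apply: perm_big.
Qed.

Lemma sqw_perm (u v : seq int) : perm_eq u v -> sqw u = sqw v.
Proof. by clear n0 l0; move=> uv; rewrite /sqw; exact: perm_big. Qed.

Fixpoint leadrev (x : seq int) : Qq :=
  if x is a :: x' then leadprod a x' * leadrev x' else 1.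

Lemma reversal (lo : int) (pre x post : seq int) : sorted (fun a b => b < a) x ->
  all (fun c => lo <= c) (pre ++ rev x ++ post) ->
  word_span (fun z => window lo (pre ++ rev x ++ post) z /\
      sqw z < sqw (pre ++ rev x ++ post))
    (U (pre ++ rev x ++ post) - leadrev x *: U (pre ++ x ++ post)).
Proof.
elim: x pre post => [|a x IH] pre post hs hlo.
  by rewrite /= scale1r subrr; exact: lspan0.
have hlt : all (fun c => c < a) (rev x).
  rewrite all_rev; have tr : transitive (fun b c : int => c < b).
    by move=> b c d h1 h2; exact: lt_trans h2 h1.
  exact: (order_path_min tr hs).
have e : pre ++ rev (a :: x) ++ post = pre ++ rev x ++ a :: post.
  by rewrite rev_cons cat_rcons.
have pe : perm_eq (rcons pre a ++ rev x ++ post) (pre ++ rev x ++ a :: post).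
  by rewrite cat_rcons perm_cat2l -[a :: post]cat1s -[a :: _ ++ _]cat1s perm_catCA.
rewrite e in hlo *; have h1 := move_left hlt hlo.
have h2 := IH (rcons pre a) post (path_sorted hs).
rewrite (perm_all _ pe) in h2; have {h2} := h2 hlo; rewrite !cat_rcons => h2.
have lp : leadprod a (rev x) = leadprod a x by apply: perm_big; rewrite perm_rev.
rewrite lp in h1; rewrite /= -scalerA.
rewrite -(subrK (leadprod a x *: U (pre ++ a :: rev x ++ post)) (U (pre ++ rev x ++ a :: post))).
rewrite -addrA -scalerBr; apply: lspanD; first exact: h1.
apply: word_spanZ; first exact: leadprod_laurent.
apply: word_span_sub h2 => z [z1 z2]; apply: word_span_in.
rewrite cat_rcons in pe; split; first exact: window_perm z1.
by rewrite -(sqw_perm pe).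
Qed.

(** As m is the smallest letter, the inner terms of each rule on its way have both letters above m:
    in the error terms m no longer occurs. *)
Lemma move_right (m : int) (x ys : seq int) : all (fun c => m < c) x ->
  all (fun c => m < c) ys ->
  word_span (window (m + 1) (x ++ m :: ys))
    (U (x ++ m :: ys) - leadprod m ys *: U (x ++ ys ++ [:: m])).
Proof.
elim: ys x => [|b ys IH] x hx.
  by move=> _; rewrite /leadprod big_nil scale1r subrr; exact: lspan0.
move=> /= /andP[mb hys].
have hx' : all (fun c => m < c) (rcons x b) by rewrite all_rcons mb.
have := IH (rcons x b) hx' hys; rewrite !cat_rcons => h1.
have [t [tP tE]] := umono_step s n0 l0 mb.
have e := tE x ys; rewrite /= in e.
rewrite /leadprod big_cons -/(leadprod m ys) -scalerA leadC.
rewrite -(subrK (lead m b *: U (x ++ b :: m :: ys)) (U (x ++ m :: b :: ys))).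
rewrite -addrA -scalerBr; apply: lspanD; last first.
  apply: word_spanZ; first exact: lead_laurent.
  apply: word_span_sub h1 => z; move/window_perm => hz; apply/word_span_in/hz.
  by rewrite perm_cat2l -[m :: ys]cat1s -cat1s perm_catCA.
rewrite e addrAC subrr add0r.
apply: lspan_sum => u ut; have hu := tP u ut; apply: word_spanZ; first by case: hu => -[].
apply: word_span_in; case: hu => -[_ u1 u2 u3] [u4 _ _].
have w1 : all (fun c => m + 1 <= c) x by apply: sub_all hx => c; rewrite lezD1.
have w2 : all (fun c => m + 1 <= c) ys by apply: sub_all hys => c; rewrite lezD1.
split.
- by rewrite !size_cat /=.
- rewrite /sumw !big_cat !big_cons /= ?big_nil; congr (_ + _).
  by rewrite !addrA u4.
rewrite !all_cat /= w1 w2 !lezD1 u1 (lt_trans u1 u2) //.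
Qed.

(** Decreasing letters above s - R force the letter of index i to be at least s + 1 - i, one more
    than in the vacuum, so the degree is at least R + 1. *)
Lemma no_sorted_word (R : nat) (y : seq int) : sorted (fun a b : int => b < a) y ->
  size y = R.+1 -> all (fun c => s - R%:Z + 1 <= c) y ->
  \sum_(i < R.+1) (s - i%:Z) + R%:Z < sumw y.
Proof.
clear n0 l0; move=> hs sy hy; have low := @sorted_lower y (s + 1) hs.
rewrite sy in low.
have low' i : (i < R.+1)%N -> s + 1 - i%:Z <= nth (0 : int) y i.
  by apply: low; apply: sub_all hy => c /=; lia.
rewrite /sumw (big_nth (0 : int)) sy big_mkord.
have : \sum_(i < R.+1) (s + 1 - i%:Z) <= \sum_(i < R.+1) nth (0 : int) y i.
  by apply: ler_sum => i _; exact: low'.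
apply: lt_le_trans.
under [X in _ < X]eq_bigr => i _ do rewrite addrAC.
by rewrite [ltRHS]big_split /= ltrD2l sumr_const card_ord natz ltz_nat.
Qed.

Lemma umono_vanish (R : nat) (x : seq int) : size x = R.+1 ->
  all (fun c => s - R%:Z + 1 <= c) x -> sumw x <= \sum_(i < R.+1) (s - i%:Z) + R%:Z ->
  U x = 0.
Proof.
move=> sx hx hd; have [t tP ->] := umono_span s n0 l0 hx.
case: t tP => [|u t] tP; first by rewrite big_nil.
have [_ [y [ys [y1 y2 y3] _] _]] := tP u (mem_head _ _).
have := no_sorted_word ys (etrans y1 sx) y3; rewrite y2; lia.
Qed.

End Moves.

(** * The bar involution *)

Definition sgnq (r : nat) : Qq := (-1) ^+ (r * (r - 1))./2.

Lemma sgnqS r : sgnq r.+1 = (-1) ^+ r * sgnq r.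
Proof.
have e k : (k * (k - 1))./2 = 'C(k, 2) by rewrite bin2 subn1.
by rewrite /sgnq !e binS bin1 addnC exprD.
Qed.

Lemma sgnq_sqr r : sgnq r * sgnq r = 1.
Proof. by rewrite /sgnq -exprD addnn -mul2n exprM sqrrN expr1n expr1n. Qed.

Lemma qinv_sgnq r : qinv (sgnq r) = sgnq r.
Proof. by rewrite /sgnq rmorphXn rmorphN rmorph1. Qed.

Lemma sgnq_laurent r : laurent (sgnq r).
Proof. exact/laurent_exp/laurent_opp/laurent1. Qed.

Section Cw.
Variables (n l : nat).

Definition ldeg (y z : int) : int :=
  (ares n y == ares n z)%:Z - (bres n l y == bres n l z)%:Z.

(** The exponent [Cexp] as a function of a finite word. It is defined on unordered words too,
    because the bar map is first built on all words. *)
Fixpoint Cw (x : seq int) : int :=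
  if x is m :: x' then Cw x' - \sum_(y <- x') ldeg m y else 0.

Lemma ldegC y z : ldeg y z = ldeg z y.
Proof. by rewrite /ldeg eq_sym [bres _ _ y == _]eq_sym. Qed.

Lemma Cw_double x : \sum_(y <- x) \sum_(z <- x) ldeg y z = - (Cw x *+ 2).
Proof.
elim: x => [|m x IH]; first by rewrite !big_nil.
have e : \sum_(y <- x) \sum_(z <- m :: x) ldeg y z = \sum_(y <- x) ldeg y m
    + \sum_(y <- x) \sum_(z <- x) ldeg y z.
  by rewrite -big_split; apply: eq_bigr => y _; rewrite big_cons.
rewrite big_cons e IH big_cons [ldeg m m]/ldeg !eqxx subrr add0r /=.
have -> : \sum_(i <- x) ldeg i m = \sum_(i <- x) ldeg m i.
  by apply: eq_bigr => y _; rewrite ldegC.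
by ring.
Qed.

(** Twice [Cw] is, up to sign, a symmetric double sum with vanishing diagonal, so only the multisets
    of residues matter and all terms of a rule share one value. *)
Lemma Cw_perm x y : perm_eq (map (ares n) x) (map (ares n) y) ->
  perm_eq (map (bres n l) x) (map (bres n l) y) -> Cw x = Cw y.
Proof.
move=> ha hb.
have cnt (f : int -> int) (u v : seq int) : perm_eq (map f u) (map f v) ->
    \sum_(c <- u) \sum_(d <- u) (f c == f d)%:Z =
    \sum_(c <- v) \sum_(d <- v) (f c == f d)%:Z.
  have e (w : seq int) : \sum_(c <- w) \sum_(d <- w) (f c == f d)%:Z =
      \sum_(c <- map f w) \sum_(d <- map f w) (c == d)%:Z.
    by rewrite big_map; apply: eq_bigr => c _; rewrite big_map.
  move=> h; rewrite !e (perm_big _ h) /=; apply: eq_bigr => c _.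
  exact: perm_big.
have e w : - (Cw w *+ 2) = \sum_(c <- w) \sum_(d <- w) (ares n c == ares n d)%:Z
     - \sum_(c <- w) \sum_(d <- w) (bres n l c == bres n l d)%:Z.
  rewrite -Cw_double -sumrB; apply: eq_bigr => c _.
  by rewrite -sumrB; apply: eq_bigr.
have : - (Cw x *+ 2) = - (Cw y *+ 2) by rewrite !e (cnt _ _ _ ha) (cnt _ _ _ hb).
lia.
Qed.

Lemma Cw_rcons x m : Cw (rcons x m) = Cw x - \sum_(y <- x) ldeg y m.
Proof.
elim: x => [|a x IH] /=; first by rewrite !big_nil.
by rewrite IH big_rcons big_cons /=; ring.
Qed.

Lemma Cw_mkseq (k : nat -> int) r : Cw (mkseq k r) = Cexp n l k r.
Proof.
elim: r => [|r IH]; first by rewrite /Cexp big_ord0.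
rewrite mkseqS Cw_rcons IH /Cexp big_ord_recr /=; congr (_ + _).
rewrite /mkseq big_map -{1}(subn0 r) -/(index_iota 0 r) big_mkord -sumrN.
by apply: eq_bigr => i _; rewrite /ldeg opprB.
Qed.

Lemma leadE y z : lead n l y z = - q ^ ldeg y z.
Proof. by []. Qed.

Lemma leadprodE m ys : leadprod n l m ys = (-1) ^+ size ys * q ^ (\sum_(y <- ys) ldeg m y).
Proof.
elim: ys => [|y ys IH]; first by rewrite /leadprod !big_nil expr0 mul1r.
rewrite /leadprod !big_cons -/(leadprod n l m ys) IH leadE ldegC /= exprS expfzDr ?q_neq0 //.
by ring.
Qed.

(** The scalar produced by reversing a decreasing word is inverse to the normalisation of the bar
    map, whence its diagonal entries 1. *)
Lemma leadrevE x : leadrev n l x = sgnq (size x) * q ^ (- Cw x).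
Proof.
elim: x => [|m x IH] /=; first by rewrite /sgnq mul1r.
rewrite IH leadprodE sgnqS opprB expfzDr ?q_neq0 //.
by ring.
Qed.

End Cw.

Section Bar.
Variables (n l : nat) (s : int).
Hypotheses (n0 : (0 < n)%N) (l0 : (0 < l)%N).
Local Notation U := (umono n l s).
Local Notation wedge := (wedge n l s).
Local Notation lead := (lead n l).
Local Notation Cw := (Cw n l).
Local Notation pad := (pad s).

Definition vac (R : nat) : int := \sum_(i < R) (s - i%:Z).

Lemma vacS R : vac R.+1 = vac R + (s - R%:Z).
Proof. by rewrite /vac big_ord_recr. Qed.

(* The reversal of the first R factors does not depend on such an R. *)
Definition valid (R : nat) (x : seq int) : Prop :=
  [/\ (size x <= R)%N, all (fun c => s - R%:Z < c) x &
      sumw x - vac (size x) <= R%:Z].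

Lemma validS R x : valid R x -> valid R.+1 x.
Proof.
clear n0 l0; move=> [h1 h2 h3]; split; [exact: leqW| |lia].
by apply: sub_all h2 => c /=; lia.
Qed.

Lemma valid_leq R R' x : (R <= R')%N -> valid R x -> valid R' x.
Proof.
by move=> /subnKC <- h; elim: (R' - R)%N => [|k IH]; rewrite ?addn0 ?addnS //; exact: validS.
Qed.

Lemma valid_exists x : exists R, valid R x.
Proof.
clear n0 l0; have [R hR] : exists R : nat, all (fun c => s - R%:Z < c) x.
  elim: x => [|c x [R hR]]; first by exists 0%N.
  exists (R + `|c - s|%N.+1)%N => /=; apply/andP; split; first lia.
  by apply: sub_all hR => d /=; lia.
exists (R + size x + `|sumw x - vac (size x)|)%N; split; [lia| |lia].
by apply: sub_all hR => d /=; lia.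
Qed.

Lemma sumw_pad R x : (size x <= R)%N -> sumw (pad R x) = sumw x - vac (size x) + vac R.
Proof.
clear n0 l0; elim: R => [|R IH]; rewrite leq_eqVlt => /orP[/eqP xR|xR].
- by rewrite -xR pad_self subrK.
- by [].
- by rewrite -xR pad_self subrK.
rewrite padS // /sumw big_rcons /= -/(sumw (pad R x)) IH // vacS; ring.
Qed.

Lemma all_pad R x : valid R x -> all (fun c => s - R%:Z < c) (pad R x).
Proof.
clear n0 l0; move=> [h1 h2 _]; rewrite pad_cat // all_cat h2 /=.
by apply/allP => c /mapP[i]; rewrite mem_iota => hi ->; lia.
Qed.

Definition barw (R : nat) (x : seq int) : wedge :=
  (sgnq R * q ^ Cw (pad R x)) *: U (rev (pad R x)).

(** After reversal the extra factor u_{s-R} stands first. Moving it to the end costs a scalar that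
    cancels the change of normalisation, and there the limit absorbs it. The error terms have R + 1
    letters above s - R and degree at most R, so they vanish. *)
Lemma barwS R x : valid R x -> barw R.+1 x = barw R x.
Proof.
move=> hv; have [h1 h2 h3] := hv; have hp := all_pad hv.
have hpr : all (fun c => s - R%:Z < c) (rev (pad R x)) by rewrite all_rev.
have h : word_span (window (s - R%:Z + 1) (s - R%:Z :: rev (pad R x)))
    (U (s - R%:Z :: rev (pad R x)) -
     leadprod n l (s - R%:Z) (rev (pad R x)) *: U (rev (pad R x) ++ [:: s - R%:Z])).
  exact: (move_right s n0 l0 (x := [::]) isT hpr).
rewrite /barw (padS s h1) rev_rcons.
have : U (s - R%:Z :: rev (pad R x)) -
    leadprod n l (s - R%:Z) (rev (pad R x)) *: U (rev (pad R x) ++ [:: s - R%:Z]) = 0.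
  case: h => t tP ->; rewrite big_seq big1 // => u /tP[_ [y [y1 y2 y3] ->]].
  rewrite (@umono_vanish n l s n0 l0 R) ?scaler0 //.
    by rewrite y1 /= size_rev size_pad.
  rewrite y2 /sumw big_cons (perm_big (pad R x)) ?perm_rev //= -/(sumw _).
  by rewrite sumw_pad // big_ord_recr /= -/(vac R); lia.
move/eqP; rewrite subr_eq0 => /eqP ->.
have -> : U (rev (pad R x) ++ [:: s - R%:Z]) = U (rev (pad R x)).
  by have := umono_rcons n l s (rev (pad R x)); rewrite size_rev size_pad cats1.
rewrite scalerA.
congr (_ *: _); rewrite leadprodE size_rev size_pad Cw_rcons sgnqS.
have -> : \sum_(y <- rev (pad R x)) ldeg n l (s - R%:Z) y = \sum_(y <- pad R x) ldeg n l y (s - R%:Z).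
  by rewrite (perm_big (pad R x)) ?perm_rev //; apply: eq_bigr => y _; rewrite ldegC.
set D := \sum_(y <- _) _; have e : q ^ (Cw (pad R x) - D) * q ^ D = q ^ Cw (pad R x).
  by rewrite -expfzDr ?q_neq0 // subrK.
have e2 : (-1) ^+ R * (-1) ^+ R = 1 :> Qq by rewrite -exprMn mulrNN mul1r expr1n.
by rewrite -e; ring: e2.
Qed.

Lemma barw_valid R R' x : valid R x -> valid R' x -> barw R x = barw R' x.
Proof.
wlog le : R R' / (R <= R')%N.
  by move=> H h h'; case/orP: (leq_total R R') => ?; [exact: H|symmetry; exact: H].
move=> h _; rewrite -(subnKC le); elim: (R' - R)%N => [|k IH]; first by rewrite addn0.
rewrite addnS (barwS (valid_leq (leq_addr k R) h)); exact: IH.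
Qed.

(** The values lie in the twisted module, so the semilinear extension is an ordinary linear
    combination and the lemmas on [straighten] apply to it. *)
Definition barU (x : seq int) : twist wedge := barw (xget 0%N [set R | valid R x]%classic) x.

Lemma barUE R x : valid R x -> barU x = barw R x.
Proof.
move=> h; apply: barw_valid h; rewrite /barU; case: xgetP => [R' _ //|].
by have [R' hR'] := valid_exists x; move/(_ R')/(_ hR').
Qed.

End Bar.

Lemma straighten_scale (V : lmodType Qq) (a k : Qq) (F G : int -> int -> V) (t : seq wterm)
    (k1 k2 : int) :
  F k1 k2 = a *: F k2 k1 + wsum F t -> G k1 k2 = k *: F k1 k2 -> G k2 k1 = k *: F k2 k1 ->
  (forall u, u \in t -> G u.2.1 u.2.2 = k *: F u.2.1 u.2.2) ->
  G k1 k2 = a *: G k2 k1 + wsum G t.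
Proof.
move=> e -> -> h; rewrite e scalerDr !scalerA [k * a]mulrC /wsum scaler_sumr; congr (_ + _).
by apply: eq_big_seq => u /h ->; rewrite !scalerA mulrC.
Qed.

Lemma padseq_rcons (s : int) (x : seq int) :
  padseq s (rcons x (s - (size x)%:Z)) = padseq s x.
Proof.
apply/funext => j; rewrite /padseq nth_rcons; case: ltngtP => // h.
  by rewrite nth_default // ltnW.
by rewrite h nth_default.
Qed.

Section Bar.
Variables (n l : nat) (s : int).
Hypotheses (n0 : (0 < n)%N) (l0 : (0 < l)%N).
Local Notation U := (umono n l s).
Local Notation wedge := (wedge n l s).
Local Notation lead := (lead n l).
Local Notation Cw := (Cw n l).
Local Notation pad := (pad s).
Local Notation valid := (valid s).
Local Notation barw := (@barw n l s).
Local Notation barU := (@barU n l s).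

(** All monomials of one rule have the same length, sum and residues, so a single R and a single
    scalar serve them all. *)
Lemma barU_pair R x k1 k2 y c d : valid R (x ++ [:: k1; k2] ++ y) ->
  s - R%:Z < c -> s - R%:Z < d -> c + d = k1 + k2 ->
  perm_eq [:: ares n c; ares n d] [:: ares n k1; ares n k2] ->
  perm_eq [:: bres n l c; bres n l d] [:: bres n l k1; bres n l k2] ->
  barU (x ++ [:: c; d] ++ y) =
    (sgnq R * q ^ Cw (pad R (x ++ [:: k1; k2] ++ y))) *:
    U (rev (drop (size x).+2 (pad R (x ++ [:: k1; k2] ++ y))) ++ [:: d; c] ++ rev x).
Proof.
move=> hv hc hd e ha hb; have [h1 h2 h3] := hv.
have sE : size (x ++ [:: c; d] ++ y) = size (x ++ [:: k1; k2] ++ y) by rewrite !size_cat.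
have hv' : valid R (x ++ [:: c; d] ++ y).
  split; rewrite ?sE //.
    by move: h2; rewrite !all_cat /= hc hd => /and3P[-> /and3P[_ _ _] ->].
  suff -> : sumw (x ++ [:: c; d] ++ y) = sumw (x ++ [:: k1; k2] ++ y) by [].
  by rewrite /sumw !big_cat !big_cons big_nil /= !addr0 e.
rewrite (barUE n0 l0 hv') /barw; have h1' := h1; rewrite -sE in h1'.
rewrite (pad_cat s h1) (pad_cat s h1') sE -!catA.
set tl := [seq _ | _ <- _].
have -> : drop (size x).+2 (x ++ [:: k1; k2] ++ y ++ tl) = y ++ tl.
  by rewrite -addn2 addnC -drop_drop drop_size_cat // /= drop0.
have -> : Cw (x ++ [:: c; d] ++ y ++ tl) = Cw (x ++ [:: k1; k2] ++ y ++ tl).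
  by apply: Cw_perm; rewrite !map_cat perm_cat2l perm_cat2r.
by congr (_ *: U _); rewrite !rev_cat -!catA.
Qed.

Lemma barU_straighten x y k1 k2 : k1 <= k2 ->
  barU (x ++ [:: k1; k2] ++ y) = straighten n l (fun c d => barU (x ++ [:: c; d] ++ y)) k1 k2.
Proof.
move=> k12; have [R hv] := valid_exists s (x ++ [:: k1; k2] ++ y).
have [t [tP tE]] := straighten_form n0 l0 k12.
set A := rev (drop (size x).+2 (pad R (x ++ [:: k1; k2] ++ y))).
set K := sgnq R * q ^ Cw (pad R (x ++ [:: k1; k2] ++ y)).
(* The reversed words satisfy the rule in the twisted module, where the common scalar K acts as
   [qinv K]. *)
have := alternating_flip n0 l0 (umono_alternating s n0 l0 A (rev x)) k12.
rewrite /straightens tE => hF; rewrite tE.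
have [_ h2 _] := hv.
have /andP[hk1 hk2] : (s - R%:Z < k1) && (s - R%:Z < k2).
  by move: h2; rewrite !all_cat /= => /and3P[_ /and3P[-> -> _] _].
have KE (c d : int) : barU (x ++ [:: c; d] ++ y) = K *: U (A ++ [:: d; c] ++ rev x) ->
    barU (x ++ [:: c; d] ++ y) = qinv K *: flip (fun c d => U (A ++ [:: c; d] ++ rev x)) c d.
  by move=> ->; rewrite twist_scaleE qinvK.
apply: (straighten_scale (k := qinv K) (G := fun c d => barU (x ++ [:: c; d] ++ y)) hF).
- by apply/KE/barU_pair.
- apply/KE/barU_pair => //; first by rewrite addrC.
    by rewrite -[[:: ares n k2; _]]cat1s perm_catC.
  by rewrite -[[:: bres n l k2; _]]cat1s perm_catC.
move=> u /tP[[_ u1 u2 u3] [u4 u5 u6]]; apply/KE/barU_pair => //; last exact: lt_trans hk1 u1.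
exact: lt_trans hk1 (lt_trans u1 u2).
Qed.

Definition barF : free_wedge -> twist wedge := lincomb barU.

Lemma barF_rel v : wedge_rel n l s v -> barF v = 0.
Proof.
have lm z : lincomb barU (mono z) = barU z by rewrite /mono lincombU scale1r.
case=> [x y k1 k2 k12|x]; rewrite /barF lincombB !lm.
  rewrite (straighten_linear n0 l0 (V := free_wedge) (V' := twist wedge) _
    (@lincombD _ _ barU) (@lincombZ _ _ barU) k12).
  have -> : (fun c d => lincomb barU (mono (x ++ [:: c; d] ++ y))) =
      (fun c d => barU (x ++ [:: c; d] ++ y)).
    by apply/funext => c; apply/funext => d; rewrite lm.
  by apply/eqP; rewrite subr_eq0; apply/eqP/barU_straighten.
have [R hv] := valid_exists s x; have {hv} := validS hv; set R' := R.+1 => hv.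
have [R'' hw] := valid_exists s (rcons x (s - (size x)%:Z)).
have v1 := valid_leq (leq_maxl R' R'') hv; have v2 := valid_leq (leq_maxr R' R'') hw.
rewrite (barUE n0 l0 v1) (barUE n0 l0 v2) /barw.
suff -> : pad (maxn R' R'') (rcons x (s - (size x)%:Z)) = pad (maxn R' R'') x by rewrite subrr.
by rewrite /pad padseq_rcons.
Qed.

Lemma barF_ker v : v \in wedge_ker n l s -> barF v = 0.
Proof.
move=> /asboolP[t tP ->]; rewrite /barF lincomb_sum big_seq big1 // => u /tP[_ hu].
by rewrite lincombZ -/barF barF_rel ?scaler0.
Qed.

Definition Bar (v : wedge) : wedge :=
  barF (repr (v : Quotient.quot (wedge_ker n l s))).

Lemma Bar_pi v : Bar (wedge_pi n l s v) = barF v.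
Proof.
set w := repr (wedge_pi n l s v : Quotient.quot (wedge_ker n l s)).
have hk : w - v \in wedge_ker n l s by apply/wedge_piE; rewrite /wedge_pi reprK.
by have := barF_ker hk; rewrite /barF lincombB => /eqP; rewrite subr_eq0 => /eqP.
Qed.

Lemma BarD u v : Bar (u + v) = Bar u + Bar v.
Proof.
have [u' ->] := wedge_pi_surj u; have [v' ->] := wedge_pi_surj v.
by rewrite -wedge_piD !Bar_pi; exact: (lincombD barU u' v').
Qed.

Lemma BarZ a v : Bar (a *: v) = qinv a *: Bar v.
Proof.
have [v' ->] := wedge_pi_surj v.
by rewrite -[a *: _]wedge_piZ !Bar_pi; exact: (lincombZ barU a v').
Qed.

Lemma Bar_U R x : valid R x -> Bar (U x) = barw R x.
Proof.
by move=> hv; rewrite Bar_pi /barF /mono lincombU scale1r (barUE n0 l0 hv).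
Qed.

End Bar.

Lemma basis_scale (I : choiceType) (V : lmodType Qq) (b : I -> V) (e : I -> Qq) :
  (forall i, e i != 0) -> is_basis b -> is_basis (fun i => e i *: b i).
Proof.
move=> e0 [bgen bfree].
pose D (f : I -> Qq) (c : {malg Qq[I]}) : {malg Qq[I]} :=
  \sum_(i <- msupp c) << c@_i * f i *g i >>.
have DE f c i : (D f c)@_i = c@_i * f i.
  rewrite /D raddf_sum /=; case: (boolP (i \in msupp c)) => ic.
    rewrite (big_fsetD1 i) //= mcoeffUU big_seq big1 ?addr0 // => j.
    by rewrite !inE mcoeffU => /andP[/negPf ->].
  rewrite (mcoeff_outdom ic) mul0r big_seq big1 // => j jc.
  by rewrite mcoeffU; case: eqP => // ji; rewrite -ji jc in ic.
have DL f c : lincomb b (D f c) = lincomb (fun i => f i *: b i) c.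
  rewrite /D lincomb_sum; apply: eq_bigr => i _.
  by rewrite lincombU scalerA.
split=> [v|c hc].
  have [c ->] := bgen v; exists (D (fun i => (e i)^-1) c).
  rewrite -DL; congr (lincomb b _); apply/malgP => i.
  by rewrite !DE divfK.
apply/malgP => i; rewrite mcoeff0; apply/eqP.
have : (D e c)@_i = 0 by rewrite (bfree (D e c)) ?mcoeff0 // DL.
by rewrite DE => /eqP; rewrite mulf_eq0 (negPf (e0 i)) orbF.
Qed.

Lemma scale_factor (V : lmodType Qq) (a b : Qq) (u v : V) :
  a * b = 1 -> a *: u - v = a *: (u - b *: v).
Proof. by move=> e; rewrite scalerBr scalerA e scale1r. Qed.

Section Semilinear.
Variables (V : lmodType Qq) (f : V -> V).
Hypotheses (fD : forall u v, f (u + v) = f u + f v).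
Hypotheses (fZ : forall a v, f (a *: v) = qinv a *: f v).

Lemma semilinear_lincomb (I : choiceType) (b : I -> V) c :
  f (lincomb b c) = \sum_(i <- msupp c) qinv c@_i *: f (b i).
Proof.
have f0 : f 0 = 0 by have := fZ 0 0; rewrite rmorph0 !scale0r.
rewrite /lincomb; elim: (msupp c : seq I) => [|i t IH]; first by rewrite !big_nil.
by rewrite !big_cons fD fZ IH.
Qed.

Lemma semilinear_involutive (I : choiceType) (b : I -> V) :
  (forall i, f (f (b i)) = b i) -> forall c, f (f (lincomb b c)) = lincomb b c.
Proof.
move=> h c; have f0 : f 0 = 0 by have := fZ 0 0; rewrite rmorph0 !scale0r.
rewrite /lincomb; elim: (msupp c : seq I) => [|i t IH]; first by rewrite big_nil !f0.
by rewrite big_cons !fD !fZ IH h qinvK.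
Qed.

End Semilinear.

(** * The ordered basis and the bar map *)

Section BarInvolution.
Variables (n l : nat) (s : int).
Hypotheses (n0 : (0 < n)%N) (l0 : (0 < l)%N).
Local Notation U := (umono n l s).
Local Notation wedge := (wedge n l s).
Local Notation Cw := (Cw n l).
Local Notation pad := (pad s).
Local Notation valid := (valid s).
Local Notation barw := (@barw n l s).
Local Notation Bar := (@Bar n l s).
Local Notation ket := (ket n l s).

Lemma lincomb_scale (I : choiceType) (b : I -> wedge) (P : wedge -> Prop) :
  (forall i, P (b i)) -> P 0 -> (forall u v, P u -> P v -> P (u + v)) ->
  (forall a u, P u -> P (a *: u)) -> forall c, P (lincomb b c).
Proof.
move=> hb h0 hD hZ c; rewrite /lincomb; elim: (msupp c : seq I) => [|i t IH].
  by rewrite big_nil.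
by rewrite big_cons; apply: hD => //; exact: hZ.
Qed.

Lemma umono_gen v : exists c : {malg Qq[seq int]}, v = lincomb (U : _ -> wedge) c.
Proof.
have [u ->] := wedge_pi_surj v; exists u; rewrite {1}[u]monalgE /lincomb.
elim: (msupp u : seq _) => [|x t IH]; first by rewrite !big_nil wedge_pi0.
rewrite !big_cons wedge_piD IH; congr (_ + _).
have -> : << u@_x *g x >> = u@_x *: mono x.
  by apply/malgP => y; rewrite /mono mcoeffZ !mcoeffU mulr_natr.
by rewrite wedge_piZ.
Qed.

Lemma umono_ket (R : nat) (y : seq int) : sorted (fun a b : int => b < a) y ->
  size y = R -> all (fun c => s - R%:Z + 1 <= c) y ->
  exists lam : intpart, [/\ (size lam <= R)%N, y = mkseq (kseq lam s) R & U y = ket lam].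
Proof.
move=> ys <- hy; have [lam [h1 h2]] := sorted_ket ys hy; exists lam; split=> //.
rewrite /ket {1}h2 -pad_ket umono_pad // size_mkseq //.
Qed.

Lemma ket_gen v : exists c, v = lincomb ket c.
Proof.
have [u ->] := umono_gen v.
apply: (lincomb_scale (P := fun v => exists c, v = lincomb ket c)); last first.
- by move=> a w [c ->]; exists (a *: c); rewrite lincombZ.
- by move=> w w' [c ->] [c' ->]; exists (c + c'); rewrite lincombD.
- by exists 0; rewrite lincomb0.
move=> x; have [R [h1 h2 _]] := valid_exists s x.
have hp : all (fun c => s - R%:Z + 1 <= c) (pad R x).
  rewrite pad_cat // all_cat; apply/andP; split.
    by apply: sub_all h2 => c /=; lia.
  by apply/allP => c /mapP[i]; rewrite mem_iota => hi ->; lia.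
rewrite -(umono_pad n l s h1); have [t tP ->] := umono_span s n0 l0 hp.
elim: t tP => [|a t IH] tP; first by exists 0; rewrite big_nil lincomb0.
have [|c hc] := IH; first by move=> b bt; apply: tP; rewrite inE bt orbT.
have [_ [y [ys [y1 y2 y3] _] yE]] := tP a (mem_head _ _).
rewrite size_pad in y1; have [lam [_ _ hl]] := umono_ket ys y1 y3.
by exists (a.1 *: mkmalgU lam 1 + c); rewrite big_cons hc lincombD lincombZ lincombU scale1r yE hl.
Qed.

Lemma ket_basis : is_basis ket.
Proof. by split; [exact: ket_gen|exact: ket_free]. Qed.

(** Reversal only permutes the letters, so the same R is admissible for the reversed word and [Cw]
    is unchanged; the powers of q are opposite and the signs square to 1. *)
Lemma Bar_barw R x : valid R x -> Bar (barw R x) = U x.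
Proof.
move=> hv; have [h1 h2 h3] := hv; have hp := all_pad hv.
rewrite /barw (BarZ n0 l0); set P := pad R x.
have sP : size (rev P) = R by rewrite size_rev size_pad.
have hv' : valid R (rev P).
  split; rewrite ?sP ?all_rev //.
  rewrite /sumw (perm_big P) ?perm_rev //= -/(sumw _) sumw_pad //; lia.
rewrite (Bar_U n0 l0 hv') /barw.
have -> : pad R (rev P) = rev P by rewrite -{1}sP pad_self.
rewrite revK; have -> : Cw (rev P) = Cw P.
  by apply: Cw_perm; rewrite map_rev perm_rev.
rewrite /P umono_pad // scalerA rmorphM /= qinv_sgnq qinv_exprz.
set c := Cw _; have e : q ^ (- c) * q ^ c = 1 by rewrite -expfzDr ?q_neq0 // addNr expr0z.
have -> : sgnq R * q ^ (- c) * (sgnq R * q ^ c) = 1.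
  by rewrite mulrACA sgnq_sqr e mulr1.
by rewrite scale1r.
Qed.

Lemma BarK v : Bar (Bar v) = v.
Proof.
have [u ->] := umono_gen v; apply: (semilinear_involutive (BarD n0 l0) (BarZ n0 l0)) => x.
by have [R hv] := valid_exists s x; rewrite (Bar_U n0 l0 hv) Bar_barw.
Qed.

Lemma sumw_ket (lam : intpart) R : (size lam <= R)%N ->
  sumw (mkseq (kseq lam s) R) = (sumn lam)%:Z + vac s R.
Proof.
move=> h; have sz : (size (mkseq (kseq lam s) (size lam)) <= R)%N by rewrite size_mkseq.
rewrite -pad_ket sumw_pad // size_mkseq; congr (_ + _).
rewrite /sumw /mkseq big_map -{1}(subn0 (size lam)) -/(index_iota 0 (size lam)) big_mkord.
rewrite /vac -sumrB sumnE (big_nth 0%N) big_mkord (big_morph _ PoszD (erefl 0%:Z)).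
by apply: eq_bigr => i _; rewrite /kseq; ring.
Qed.

Lemma size_intpart (lam : intpart) : (size lam <= sumn lam)%N.
Proof.
case: lam => p /= /andP[_]; elim: p => // a p IH; rewrite inE negb_or => /andP[a0 /IH].
by rewrite /=; case: a a0 => // a _; lia.
Qed.

Lemma valid_ket (lam : intpart) : valid (sumn lam) (mkseq (kseq lam s) (size lam)).
Proof.
have h := size_intpart lam; split; first by rewrite size_mkseq.
  apply/allP => c /mapP[i]; rewrite mem_iota => hi ->; rewrite /kseq; lia.
by rewrite size_mkseq sumw_ket // addrK.
Qed.

Lemma Bar_ket lam : Bar (ket lam) = bar_ket n l s lam (sumn lam).
Proof.
by rewrite (Bar_U n0 l0 (valid_ket lam)) /barw /bar_ket pad_ket Cw_mkseq.
Qed.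

(** Both maps act semilinearly on the expansion in kets and agree on each ket; [Bar], defined on all
    words, can thus replace the definition by coordinates. *)
Lemma barE v : bar v = Bar v.
Proof.
have hc : v = lincomb ket (Defs.coord v).
  have [c hc] := ket_gen v; rewrite /Defs.coord; case: xgetP => [d _ //|/(_ c)].
  by case.
rewrite {2}hc (semilinear_lincomb (BarD n0 l0) (BarZ n0 l0)) /bar.
by apply: eq_bigr => lam _; rewrite Bar_ket.
Qed.

(** Every mu in the bar of lam has the size of lam, so the words are truncated at the same length
    and their sums of squares are comparable. *)
Definition height (lam : intpart) : nat := absz (sqw (mkseq (kseq lam s) (sumn lam))).

Lemma sqw_ge0 x : 0 <= sqw x.
Proof. by rewrite /sqw; apply: sumr_ge0 => c _; exact: sqr_ge0. Qed.

(** Reversal gives back the original word, with the scalar inverse to the normalisation, up to words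
    of smaller [sqw]. Straightening these never raises [sqw], and the preserved sum of letters
    forces |mu| = |lam|. *)
Lemma Bar_triangular lam : lspan laurent
  (fun v => exists2 mu, (height mu < height lam)%N & v = ket mu) (Bar (ket lam) - ket lam).
Proof.
have hv := valid_ket lam; rewrite (Bar_U n0 l0 hv) /barw; set R := sumn lam.
have hp : all (fun c => s - R%:Z + 1 <= c) (pad R (mkseq (kseq lam s) (size lam))).
  by apply: sub_all (all_pad hv) => c /=; rewrite lezD1 //; lia.
have hk : U (pad R (mkseq (kseq lam s) (size lam))) = ket lam.
  by rewrite umono_pad // size_mkseq; exact: size_intpart.
rewrite -hk; rewrite pad_ket in hp *; set P := mkseq _ R in hp *.
have hp' : all (fun c => s - R%:Z + 1 <= c) ([::] ++ rev P ++ [::]) by rewrite /= cats0 all_rev.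
have := reversal s n0 l0 (kseq_sorted s lam R) hp'; rewrite /= !cats0 => h.
have e : sgnq R * q ^ Cw P * leadrev n l P = 1.
  rewrite leadrevE size_mkseq mulrACA sgnq_sqr mul1r -expfzDr ?q_neq0 //.
  by rewrite subrr expr0z.
rewrite (scale_factor _ _ e).
apply: lspanZ; first exact: laurent_mul.
  by apply: laurent_mul; [exact: sgnq_laurent|exact: laurent_exprz].
apply: lspan_sub h => [|_ [z [[z1 z2 z3] z4] ->]]; first exact: laurent_mul.
have [t tP ->] := umono_span s n0 l0 z3.
apply: lspan_sum => u /tP[ul [y [ys [y1 y2 y3] y4] ->]].
apply: lspan_in => //.
have sy : size y = R by rewrite y1 z1 size_rev size_mkseq.
have [mu [m1 m2 m3]] := umono_ket ys sy y3; exists mu => //.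
have sm : sumn mu = R.
  have := sumw_ket m1; rewrite -m2 y2 z2 /sumw (perm_big P) ?perm_rev //= -/(sumw _).
  by rewrite sumw_ket ?size_intpart // => /addIr[].
rewrite /height sm -m2 -/R -/P.
have rP : sqw (rev P) = sqw P by rewrite /sqw; apply: perm_big; rewrite perm_rev.
by rewrite -ltz_nat !gez0_abs ?sqw_ge0 // -rP; exact: le_lt_trans y4 z4.
Qed.

End BarInvolution.

Lemma sign_exprz (z : int) : (-1 : Qq) ^ z = 1 \/ (-1 : Qq) ^ z = -1.
Proof.
have e : ((-1 : Qq) ^ z) ^+ 2 = 1.
  by rewrite expr2 -expfzMl mulrNN mul1r exp1rz.
by move/eqP: e; rewrite sqrf_eq1 => /orP[/eqP|/eqP]; [left|right].
Qed.

(* Only (-1)^Phi = 1 or -1 matters, so Phi is never evaluated. *)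
Section Phi.
Variables (n l : nat) (s : int).
Hypotheses (n0 : (0 < n)%N) (l0 : (0 < l)%N).
Local Notation wedge := (wedge n l s).
Local Notation ket := (ket n l s).
Local Notation phi := (phi n l s).

Lemma phi_ket lam : exists e : Qq, [/\ laurent e, e * e = 1, qinv e = e & phi lam = e *: ket lam].
Proof.
exists ((-1) ^ Phi n l lam s); case: (sign_exprz (Phi n l lam s)) => e; split=> //; rewrite e.
- exact: laurent1.
- by rewrite mulr1.
- exact: rmorph1.
- exact/laurent_opp/laurent1.
- by rewrite mulrNN mulr1.
- by rewrite rmorphN rmorph1.
Qed.

Lemma phi_basis : is_basis phi.
Proof.
apply: (@basis_scale _ _ ket (fun lam => (-1 : Qq) ^ Phi n l lam s)); last exact: ket_basis.
by move=> lam; case: (sign_exprz (Phi n l lam s)) => ->; rewrite ?oppr_eq0 oner_eq0.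
Qed.

Lemma bar_phi lam : lspan laurent
  (fun v => exists2 mu, (height s mu < height s lam)%N & v = phi mu) (bar (phi lam) - phi lam).
Proof.
have [e [le ee qe ->]] := phi_ket lam.
rewrite barE // (BarZ n0 l0) qe -scalerBr.
apply: lspanZ => //; first exact: laurent_mul.
have := Bar_triangular s n0 l0 lam; apply: lspan_sub => [|_ [mu h ->]]; first exact: laurent_mul.
have [e' [le' ee' _ pe]] := phi_ket mu.
have -> : ket mu = e' *: phi mu by rewrite pe scalerA ee' scale1r.
exact: (lspan_in le' (ex_intro2 _ _ mu h erefl)).
Qed.

Lemma bar_canonical_basis (x : Qq) : x = q \/ x = q^-1 ->
  exists! G : intpart -> wedge, is_basis G /\ forall lam,
    bar (G lam) = G lam /\
    eq_mod x (lspan (range (eval_at x)) (range phi)) (G lam) (phi lam).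
Proof.
apply: (canonical_basis (ht := height s) phi_basis).
- by move=> u v; rewrite !(barE n0 l0); exact: BarD.
- by move=> a v; rewrite !(barE n0 l0); exact: BarZ.
- by move=> v; rewrite !(barE n0 l0); exact: BarK.
exact: bar_phi.
Qed.

End Phi.

Theorem theorem3p4 (n l : nat) (s : int) (hn : (1 < n)%N) (hl : (1 < l)%N) :
  (exists! Gplus : intpart -> wedge n l s,
     is_basis Gplus /\
     forall lam : intpart,
       bar (Gplus lam) = Gplus lam /\
       eq_mod q (Lplus n l s) (Gplus lam) (phi n l s lam)) /\
  (exists! Gminus : intpart -> wedge n l s,
     is_basis Gminus /\
     forall lam : intpart,
       bar (Gminus lam) = Gminus lam /\
       eq_mod q^-1 (Lminus n l s) (Gminus lam) (phi n l s lam)).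
Proof.
have n0 : (0 < n)%N := ltnW hn; have l0 : (0 < l)%N := ltnW hl.
(* [Lplus] and [Lminus] unfold to the spans of the general statement at x = q and x = q^-1. *)
split; first exact: (bar_canonical_basis s n0 l0 (or_introl (erefl q))).
exact: (bar_canonical_basis s n0 l0 (or_intror (erefl q^-1))).
Qed.
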